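(* Consider the $d$-armed bandit model described in the context with $d$ fixed. Suppose that there are non-random $\sigma>0$ and $\Delta>0$ such that $\mathbb{E}[\epsilon_i\mid\mathcal{F}_{i-1}]=0$ and $\mathbb{E}[\epsilon_i^2\mid\mathcal{F}_{i-1}]=\sigma^2$ for all $i\ge 1$ and $\sup_{i\ge1}\mathbb{E}[|\epsilon_i|^{2+\Delta}\mid\mathcal{F}_{i-1}]<\infty$ almost surely, and that the minimum arm count satisfies $N_{\min}=\min_{k\in\{1,\dots,d\}}N_{k,n}\ge(\log n)^2$ for all sufficiently large $n$. Let $\hat\theta_{\mathrm{OD}}$ be the online debiasing estimator computed with $$\gamma_n=\frac{1}{(\log n)\cdot\log\log(n)},\qquad \Gamma_{i,n}=\max\{S_i,\ (\log n)^2 I_d\},$$ where the maximum is taken elementwise. Then, for any consistent estimate $\hat\sigma^2$ of $\sigma^2$, as $n\to\infty$, $$\big(\hat\sigma^2\cdot(\log n)\cdot\log\log(n)\big)^{-1/2}\, S_n^{1/2}\big(\hat\theta_{\mathrm{OD}}-\theta^*\big)\ \longrightarrow\ \mathcal{N}(0,I_d)\quad\text{in distribution.}$$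
   Context: Bandit model: $(\mathcal{F}_i)_{i\ge 0}$ is a filtration; at each time $i\ge 1$ an algorithm selects an arm $k_i\in\{1,\dots,d\}$, with $k_i$ being $\mathcal{F}_{i-1}$-measurable, and observes $y_i=\langle e_{k_i},\theta^*\rangle+\epsilon_i$, where $e_k$ is the $k$-th standard basis vector, $\theta^*\in\mathbb{R}^d$ is the vector of mean rewards, and $\epsilon_i$ is $\mathcal{F}_i$-measurable. Put $x_i=e_{k_i}$; $N_{k,i}$ is the number of times arm $k$ is pulled in the first $i$ rounds; $S_i=\sum_{j\le i}x_jx_j^\top=\operatorname{diag}(N_{1,i},\dots,N_{d,i})$. Online debiasing estimator: with $z_i=\Gamma_{i,n}^{-1/2}x_i$ define recursively $w_i=\big(I_d-\sum_{j=1}^{i-1}w_jz_j^\top\big)z_i\big/(\gamma_n/2+\|z_i\|_2^2)$, $i=1,\dots,n$. Let $\hat\theta_{\mathrm{LS}}=S_n^{-1}\sum_{i=1}^n x_iy_i$ and $\hat\theta_{\mathrm{OD}}=\hat\theta_{\mathrm{LS}}+S_n^{-1/2}\sum_{i=1}^n w_i\,(y_i-\langle x_i,\hat\theta_{\mathrm{LS}}\rangle)$. A consistent estimate is one converging in probability to its target. *)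

(* Defs.v *)
From HB Require Import structures.
From mathcomp Require Export all_boot all_order all_algebra.
From mathcomp Require Export all_classical all_reals all_analysis.
From mathcomp Require Export measurable_realfun.

Set Implicit Arguments.
Unset Strict Implicit.
Unset Printing Implicit Defensive.

Import Order.TTheory GRing.Theory Num.Theory.
Import numFieldNormedType.Exports.

Local Open Scope classical_set_scope.
Local Open Scope ring_scope.

Section probability_notions.
Context {d : measure_display} {T : measurableType d} {R : realType}.
Variable P : probability T R.

Definition filtration (F : nat -> set (set T)) : Prop :=
  [/\ forall i, sigma_algebra [set: T] (F i),
      forall i, F i `<=` measurable
    & forall i j, (i <= j)%N -> F i `<=` F j].

Definition measurable_wrt {d'} {U : measurableType d'} (G : set (set T))
  (f : T -> U) : Prop := forall B, measurable B -> G (f @^-1` B).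

(* [Y] is a version of the conditional expectation E[X | G]; it is defined for
   integrable [X], and for nonnegative [X] with values in [0, +oo]. *)
Definition is_cond_exp (G : set (set T)) (X Y : T -> \bar R) : Prop :=
  [/\ P.-integrable [set: T] X \/
        (measurable_fun [set: T] X /\ forall w, (0 <= X w)%E),
      measurable_wrt G Y
    & forall A, G A -> (\int[P]_(w in A) Y w = \int[P]_(w in A) X w)%E].

Definition cvg_in_probability (X : nat -> T -> R) (c : R) : Prop :=
  forall e : R, 0 < e -> P [set w | e < `|X n w - c|] @[n --> \oo] --> 0%E.

Definition joint_cdf {m : nat} (X : T -> 'cV[R]_m) (t : 'cV[R]_m) : R :=
  fine (P [set w | forall k, X w k 0 <= t k 0]).

End probability_notions.

(* Pointwise convergence of the distribution functions at the continuity points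
   of that of [Z], a random vector which may live on another space. *)
Definition cvg_in_distribution {R : realType}
    {d} {T : measurableType d} (P : probability T R)
    {d'} {T' : measurableType d'} (Q : probability T' R) {m : nat}
    (X : nat -> T -> 'cV[R]_m) (Z : T' -> 'cV[R]_m) : Prop :=
  forall t : 'cV[R]_m, {for t, continuous (joint_cdf Q Z)} ->
    joint_cdf P (X n) t @[n --> \oo] --> joint_cdf Q Z t.

Section std_normal.
Context {R : realType}.

(* [normal_prob] is a measure on [measurableTypeR R], that is [R] with the same
   Borel sets but a different display. *)
Definition tuple_cons m (u : measurableTypeR R * m.-tuple R) : m.+1.-tuple R :=
  [the m.+1.-tuple R of u.1 :: u.2].

Lemma measurable_tuple_cons m : measurable_fun [set: _] (@tuple_cons m).
Proof.
apply: (@measurable_cons _ _ _ R fst m snd); last exact: measurable_snd.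
exact: (@measurable_fst _ _ (measurableTypeR R) (m.-tuple R)).
Qed.

HB.instance Definition _ m :=
  isMeasurableFun.Build _ _ _ _ (@tuple_cons m) (measurable_tuple_cons (m := m)).

(* The [m]-fold product of N(0,1), i.e. N(0, I_m). *)
Fixpoint std_normal m : probability (m.-tuple R) R :=
  if m is p.+1 then
    distribution (normal_prob (0 : R) 1 \x std_normal p)%E (@tuple_cons p)
  else dirac [tuple].

Definition std_normal_vec m (u : m.-tuple R) : 'cV[R]_m := \col_k tnth u k.

Lemma std_normal_box m (B : 'I_m -> set R) : (forall k, measurable (B k)) ->
  std_normal m [set u | forall k, B k (tnth u k)] =
  (\prod_(k < m) normal_prob (0 : R) 1 (B k))%E.
Proof.
elim: m B => [|m IH] B mB /=.
  rewrite big_ord0 diracE mem_set//; by case.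
rewrite big_ord_recl -IH; last by move=> k; exact: mB.
rewrite /distribution /pushforward -product_measure1E; first last.
- have -> : [set u : m.-tuple R | forall k, B (lift ord0 k) (tnth u k)] =
      \bigcap_(k in [set: 'I_m]) ((@tnth _ _)^~ k @^-1` B (lift ord0 k)).
    by apply/seteqP; split=> u /= h k *; exact: h.
  apply: fin_bigcap_measurable => // k _.
  by rewrite -[X in measurable X]setTI; exact: measurable_tnth.
- exact: mB.
congr (_ _); apply/seteqP; split=> -[x u] /=.
  move=> h; split; first exact: (h ord0).
  by move=> k; have := h (lift ord0 k); rewrite tnthS.
move=> [h0 h] k; case: (unliftP ord0 k) => [j|] ->; last by [].
by rewrite tnthS; exact: h.
Qed.

End std_normal.

Section matrix_notions.
Context {R : realType} {d : nat}.
Implicit Types (A B : 'M[R]_d) (u v : 'cV[R]_d).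

Definition dotv u v : R := (u^T *m v) 0 0.

(* The matrix norm of the library is the sup norm. *)
Definition sqnorm2 u : R := dotv u u.

Definition psd A : Prop := A^T = A /\ forall v, 0 <= dotv v (A *m v).

(* The square root of a psd matrix is its unique psd square root; [0] is a
   default value, returned if there is none. *)
Definition sqrtmx A : 'M[R]_d := xget 0 [set B | psd B /\ B *m B = A].

Definition isqrtmx A : 'M[R]_d := invmx (sqrtmx A).

Let dotvBl u v w : dotv (u - v) w = dotv u w - dotv v w.
Proof. by rewrite /dotv raddfB mulmxBl !mxE. Qed.

Let dotvBr u v w : dotv u (v - w) = dotv u v - dotv u w.
Proof. by rewrite /dotv mulmxBr !mxE. Qed.

Let dotvZl (a : R) u v : dotv (a *: u) v = a * dotv u v.
Proof. by rewrite /dotv linearZ /= -scalemxAl !mxE. Qed.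

Let dotvZr (a : R) u v : dotv u (a *: v) = a * dotv u v.
Proof. by rewrite /dotv -scalemxAr !mxE. Qed.

Lemma sqnorm2_eq0 u : sqnorm2 u = 0 -> u = 0.
Proof.
rewrite /sqnorm2 /dotv mxE => /eqP; rewrite psumr_eq0; last first.
  by move=> i _; rewrite mxE -expr2 sqr_ge0.
move=> /allP h; apply/colP => i; rewrite [RHS]mxE.
have := h i (mem_index_enum _).
by rewrite /= mxE -expr2 sqrf_eq0 => /eqP.
Qed.

Lemma psd_ker B v : psd B -> dotv v (B *m v) = 0 -> B *m v = 0.
Proof.
move=> [Bs Bp] h; apply: sqnorm2_eq0.
set q := sqnorm2 _; set c := dotv (B *m v) (B *m (B *m v)).
have c0 : 0 <= c by exact: Bp.
have q0 : 0 <= q.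
  by rewrite /q /sqnorm2 /dotv mxE sumr_ge0// => i _; rewrite mxE -expr2 sqr_ge0.
have key (s : R) : 0 <= s * (s * c - q *+ 2).
  have := Bp (v - s *: (B *m v)).
  have -> : dotv (v - s *: (B *m v)) (B *m (v - s *: (B *m v))) =
      dotv v (B *m v) - s * dotv v (B *m (B *m v)) -
      s * dotv (B *m v) (B *m v) + s * s * c.
    rewrite mulmxBr -scalemxAr !dotvBl !dotvBr !dotvZl !dotvZr -/c.
    by rewrite opprB mulrA !addrA addrAC.
  have -> : dotv v (B *m (B *m v)) = q.
    by rewrite /q /sqnorm2 /dotv trmx_mul Bs !mulmxA.
  rewrite h -/(sqnorm2 (B *m v)) -/q => H.
  suff <- : 0 - s * q - s * q + s * s * c = s * (s * c - q *+ 2) by [].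
  by rewrite sub0r mulrBr mulrnAr mulr2n opprD mulrA addrC.
apply/eqP/contraT => qn0.
have qp : 0 < q by rewrite lt_neqAle eq_sym qn0.
have c1 : 0 < c + 1 by rewrite ltr_wpDl.
have := key (q / (c + 1)); rewrite pmulr_rge0 ?divr_gt0// subr_ge0.
have : q / (c + 1) * c <= q.
  by rewrite mulrAC ler_pdivrMr// ler_wpM2l// lerDl.
move=> h1 h2; have := le_trans h2 h1.
by rewrite mulr2n gerDl leNgt qp.
Qed.

Lemma psdD A B : psd A -> psd B -> psd (A + B).
Proof.
move=> [As Ap] [Bs Bp]; split; first by rewrite raddfD /= As Bs.
by move=> v; rewrite /dotv mulmxDl mulmxDr mxE addr_ge0 ?Ap ?Bp.
Qed.

Lemma psd_diag (r : 'rV[R]_d) : (forall k, 0 <= r 0 k) -> psd (diag_mx r).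
Proof.
move=> r0; split; first exact: tr_diag_mx.
move=> v; rewrite /dotv mul_diag_mx !mxE sumr_ge0// => k _.
by rewrite !mxE mulrCA mulr_ge0// -expr2 sqr_ge0.
Qed.

Lemma sqrtmx_diag (r : 'rV[R]_d) : (forall k, 0 <= r 0 k) ->
  sqrtmx (diag_mx r) = diag_mx (map_mx Num.sqrt r).
Proof.
move=> r0; set C := diag_mx (map_mx _ r).
have pC : psd C by apply: psd_diag => k; rewrite mxE sqrtr_ge0.
have CC : C *m C = diag_mx r.
  apply/matrixP => i j; rewrite mul_diag_mx !mxE.
  by rewrite mulrnAr -expr2 sqr_sqrtr.
have : [set B | psd B /\ B *m B = diag_mx r] (sqrtmx (diag_mx r)).
  by apply: xgetPex; exists C.
move: (sqrtmx _) => B [pB BB].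
have cB : B *m C = C *m B.
  have cD : B *m diag_mx r = diag_mx r *m B by rewrite -BB mulmxA.
  apply/matrixP => i j; move/matrixP : cD => /(_ i j).
  rewrite /C !mul_mx_diag !mul_diag_mx !mxE => /eqP.
  rewrite [X in _ == X]mulrC -subr_eq0 -mulrBr mulf_eq0.
  by case/orP => [/eqP ->|]; rewrite ?mul0r ?mulr0// subr_eq0 => /eqP ->;
    rewrite mulrC.
apply/eqP; rewrite -subr_eq0; apply/eqP/matrixP => i j; rewrite [RHS]mxE.
pose x : 'cV[R]_d := delta_mx j 0; pose v := (B - C) *m x.
have sv : (B + C) *m v = 0.
  by rewrite /v mulmxA mulmxDl !mulmxBr BB CC cB addrA subrK subrr mul0mx.
have [Bv Cv] : B *m v = 0 /\ C *m v = 0.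
  have h : dotv v (B *m v) + dotv v (C *m v) = 0.
    by have := congr1 (dotv v) sv; rewrite /dotv mulmxDl mulmxDr mulmx0 !mxE.
  have [hB hC] := (pB.2 v, pC.2 v).
  move/eqP : h; rewrite paddr_eq0// => /andP[/eqP h1 /eqP h2].
  by split; exact: psd_ker.
have v0 : v = 0.
  apply: sqnorm2_eq0; rewrite /sqnorm2 /dotv {1}/v trmx_mul raddfB /=.
  by rewrite pB.1 pC.1 -mulmxA mulmxBl Bv Cv subrr mulmx0 mxE.
by have := congr1 (fun M : 'cV[R]_d => M i 0) v0; rewrite /v -colE !mxE.
Qed.

End matrix_notions.

(* Everything here is for one realization of the arms [k] and rewards [y].
   Rounds are numbered from 1: [k 0] and [y 0] are never used. *)

Section online_debiasing.
Context {R : realType} {d : nat}.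
Variables (k : nat -> 'I_d) (y : nat -> R).

Definition arm_vec (i : nat) : 'cV[R]_d := delta_mx (k i) 0.

Definition pulls (a : 'I_d) (i : nat) : nat := \sum_(1 <= j < i.+1) (k j == a).

(* The default value [n] of the minimum is harmless, as [pulls a n <= n]. *)
Definition min_pulls (n : nat) : nat := \big[minn/n]_(a < d) pulls a n.

Definition gram (i : nat) : 'M[R]_d :=
  \sum_(1 <= j < i.+1) arm_vec j *m (arm_vec j)^T.

Definition theta_LS (n : nat) : 'cV[R]_d :=
  invmx (gram n) *m \sum_(1 <= i < n.+1) y i *: arm_vec i.

Variables (gamma : R) (Gamma : nat -> 'M[R]_d).

Definition od_dir (i : nat) : 'cV[R]_d := isqrtmx (Gamma i) *m arm_vec i.

Definition od_step (M : 'M[R]_d) (z : 'cV[R]_d) : 'cV[R]_d :=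
  (gamma / 2 + sqnorm2 z)^-1 *: ((1%:M - M) *m z).

(* The sum of w_j z_j^T over 1 <= j <= i; see [od_weightE] for the recursion
   satisfied by the weights w_i. *)
Fixpoint od_acc (i : nat) : 'M[R]_d :=
  if i is j.+1 then
    od_acc j + od_step (od_acc j) (od_dir i) *m (od_dir i)^T
  else 0.

Definition od_weight (i : nat) : 'cV[R]_d := od_step (od_acc i.-1) (od_dir i).

Lemma od_weightE i : (1 <= i)%N ->
  od_weight i = (gamma / 2 + sqnorm2 (od_dir i))^-1 *:
    ((1%:M - \sum_(1 <= j < i) od_weight j *m (od_dir j)^T) *m od_dir i).
Proof.
case: i => // i _; rewrite /od_weight /od_step /=.
congr (_ *: ((1%:M - _) *m _)).
elim: i => [|i IH]; first by rewrite big_nil.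
by rewrite big_nat_recr //= -IH.
Qed.

Definition theta_OD (n : nat) : 'cV[R]_d :=
  theta_LS n + isqrtmx (gram n) *m
    \sum_(1 <= i < n.+1) (y i - dotv (arm_vec i) (theta_LS n)) *: od_weight i.

End online_debiasing.

Lemma gram_diag (R : realType) (d : nat) (k : nat -> 'I_d) (i : nat) :
  gram k i = diag_mx (\row_a (pulls k a i)%:R) :> 'M[R]_d.
Proof.
apply/matrixP => a b; rewrite /gram summxE !mxE natr_sum -sumrMnl.
apply: eq_bigr => j _; rewrite trmx_delta mul_delta_mx !mxE.
case: (eqVneq a b) => [<-|ab] /=.
  by rewrite eq_sym; case: eqVneq => //= _; rewrite mulr1n.
rewrite mulr0n; case: eqVneq => //= ak; rewrite -ak eq_sym.
by rewrite (negbTE ab).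
Qed.

Section tuning.
Context {R : realType}.

Definition log (n : nat) : R := ln n%:R.
Definition loglog (n : nat) : R := ln (log n).

Definition gammaL (n : nat) : R := (log n * loglog n)^-1.

Definition GammaL {d : nat} (k : nat -> 'I_d) (n i : nat) : 'M[R]_d :=
  map2_mx Num.max (gram k i) ((log n ^+ 2)%:M).

End tuning.

(* Main.v *)
Require Import Defs.
From HB Require Import structures.
From mathcomp Require Import ring lra.

Set Implicit Arguments.
Unset Strict Implicit.
Unset Printing Implicit Defensive.

Import Order.TTheory GRing.Theory Num.Theory.
Import numFieldNormedType.Exports.

Local Open Scope classical_set_scope.
Local Open Scope ring_scope.

(** Every matrix in the construction is diagonal, so the arms decouple.  The
    weight of a pull is a deterministic function [od_coef] of the number of
    times its arm has been pulled, and if the arm [a] was pulled N times with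
    total noise M, the coordinate [a] of S_n^(1/2) (theta_OD - theta) is
    (sum of weight * noise) + (1 - (sum of weights) / sqrt N) * (M / sqrt N);
    this is [od_error_decomp].

    The second term is a bias.  Its first factor lies in [0, 1] as soon as
    N >= (log n)^2 ([sum_od_coef_le]).  In its second factor the random N is
    handled by weighting M^2 with the predictable, nonincreasing 1 / N: this
    gives E(M^2 / N) <= sigma^2 * (1 + 1/2 + ... + 1/n), which is at most
    sigma^2 (1 + log n) ([mean_weighted_transform2], [mean_noise_sqr]).  The
    normalization divides by (log n)(loglog n), so the factor loglog n makes
    the bias negligible.

    The first term, multiplied by sqrt gamma / sigma, is a martingale transform
    of the noise.  Its conditional variance never exceeds 1, because
    gamma * weight^2 is at most the decrease of the square of a residual that
    starts at 1 ([od_var_le1]), and it is close to 1 once the arm has (log n)^2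
    pulls ([od_var_defect]).

    The central limit theorem for these transforms, [arm_clt], is proved by
    Lindeberg's method and needs no characteristic functions.  Let X_a be the
    current sum of the arm a and r_a the conditional variance that it has not
    used yet.  The test function is the product over a of
    Phi ((t_a - X_a) / sqrt (s^2 + r_a)).  Since Phi (x / sqrt q) solves the heat
    equation, the second order effect of the noise on X_a is cancelled by the
    simultaneous decrease of r_a, and the expected change of the test function
    over one round is of third order ([ncdf_heat_expansion],
    [lindeberg_step]).  The sum of these changes tends to 0 by the moment
    condition on the noise ([noise_tail]).  At time 0 the test function is a
    product of normal distribution functions; at time n, where r_a is close to
    0, it is compared with the indicators of slightly shifted boxes
    ([box_upper], [box_lower]).

    A Slutsky argument for probabilities of boxes ([box_slutsky]) then replaces
    sigma by its estimate and removes the bias ([cvg_od_student]). *)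
(** * The standard normal distribution function *)

Section normal_cdf.
Context {R : realType}.
Implicit Types (x y h q v D : R).

Definition ncdf x : R := fine (normal_prob (0 : R) 1 `]-oo, x]).

Definition npdf x : R := normal_pdf 0 1 x.

Lemma npdfE x : npdf x = normal_peak 1 * expR (- (x ^+ 2 / 2)).
Proof.
by rewrite /npdf normal_pdfE ?oner_eq0// /normal_fun subr0 expr1n mulr2n mulNr.
Qed.

Lemma npdf_ge0 x : 0 <= npdf x.
Proof. exact: normal_pdf_ge0. Qed.

Lemma ncdfE x : (ncdf x)%:E = normal_prob (0 : R) 1 `]-oo, x].
Proof. by rewrite fineK// fin_num_measure. Qed.

Lemma ncdf_ge0 x : 0 <= ncdf x.
Proof. by rewrite fine_ge0. Qed.

Lemma ncdf_le1 x : ncdf x <= 1.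
Proof. by rewrite -lee_fin ncdfE probability_le1. Qed.

Lemma ncdf_homo : {homo ncdf : x y / x <= y}.
Proof.
move=> x y xy; rewrite -lee_fin !ncdfE le_measure ?inE//.
by apply: subset_itvl; rewrite bnd_simp.
Qed.

Global Instance is_derive_ncdf x : is_derive x (1 : R) ncdf (npdf x).
Proof.
have intf y : lebesgue_measure.-integrable `]-oo, y] (EFin \o npdf).
  apply: (@integrableS _ _ _ _ setT) => //.
  exact: integrable_normal_pdf.
have [] := @continuous_FTC1 R npdf -oo%O x (x + 1) _ (intf _) _ _.
- by rewrite ltrDl.
- by rewrite ltNyr.
- by apply: continuous_normal_pdf; rewrite oner_eq0.
rewrite -/ncdf => dF FE; split; first exact: dF.
by rewrite -derive1E.
Qed.

Global Instance is_derive_npdf x : is_derive x (1 : R) npdf (- x * npdf x).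
Proof.
have -> : npdf = (fun x => normal_peak 1 * expR (- (x ^+ 2 / 2))).
  by apply/funext => y; rewrite npdfE.
have dg : is_derive x (1 : R) (fun x : R => - (x ^+ 2 / 2)) (- x).
  have -> : (fun x : R => - (x ^+ 2 / 2)) = (- (2^-1 \*: (@GRing.exp R ^~ 2%N))).
    by apply/funext => y; rewrite /= mulrC.
  by apply: is_derive_eq; rewrite /GRing.scale/=; field.
have de := @is_derive1_comp _ expR (fun x : R => - (x ^+ 2 / 2)) x _ _
  (is_derive_expR _) dg.
have dz := is_deriveZ (normal_peak 1) de.
apply: (@is_derive_eq _ _ _ _ _ _ _ _ dz).
by rewrite /GRing.scale/=; ring.
Qed.

Lemma ncdf_continuous : continuous ncdf.
Proof.
move=> x; apply: differentiable_continuous; apply/derivable1_diffP.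
exact: ex_derive.
Qed.

Let idTR : measurableTypeR R -> R := idfun.

#[local] HB.instance Definition _ :=
  @isMeasurableFun.Build _ _ _ _ idTR (@measurable_id _ _ setT).

Let ncdf_cdf : ncdf = fine \o cdf (idTR : {RV normal_prob (0 : R) 1 >-> R}).
Proof. by []. Qed.

Lemma cvg_ncdfy1 : ncdf x @[x --> +oo] --> (1 : R).
Proof. rewrite ncdf_cdf; exact/fine_cvg/cvg_cdfy1. Qed.

Lemma cvg_ncdfNy0 : ncdf x @[x --> -oo] --> (0 : R).
Proof. rewrite ncdf_cdf; exact/fine_cvg/cvg_cdfNy0. Qed.

(** The mean value theorem is applied to [l |-> f (l * t)] on the unit interval,
    so that [t] may have either sign and the derivative has to be controlled
    only between 0 and [t].  Iterating this lemma gives Taylor's inequality up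
    to the constant, which is not optimal but suffices. *)
Lemma mvt_pow (f f' : R -> R) (K t : R) (m : nat) : 0 <= K -> f 0 = 0 ->
  (forall l : R, 0 <= l <= 1 ->
     is_derive (l * t) (1 : R) f (f' (l * t)) /\
     `|f' (l * t)| <= K * `|l * t| ^+ m) ->
  `|f t| <= K * `|t| ^+ m.+1.
Proof.
move=> K0 f0 df.
pose g l := f (l * t).
have dg (l : R) : l \in `[0, 1] -> is_derive l (1 : R) g (f' (l * t) * t).
  rewrite in_itv/= => l01; have [dfl _] := df _ l01.
  have dl : is_derive l (1 : R) ( *%R^~ t) t.
    have -> : ( *%R^~ t) = t \*: (@id R) by apply/funext => z; rewrite /= mulrC.
    by apply: is_derive_eq; rewrite /GRing.scale/= mulr1.
  exact: (@is_derive1_comp _ f ( *%R^~ t) l _ _ dfl dl).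
have cg : {within `[0, 1], continuous g}.
  apply: derivable_within_continuous => l l01.
  by have [] := dg _ l01.
pose g' (l : R) : R := f' (l * t) * t.
have dg' (l : R) : l \in `](0 : R), 1[ -> is_derive l (1 : R) g (g' l).
  by move=> l01; apply: dg; apply: subset_itv_oo_cc.
have [c c01] := MVT_segment (@ler01 R) dg' cg.
have g0 : g 0 = 0 by rewrite /g mul0r.
have g1 : g 1 = f t by rewrite /g mul1r.
rewrite g0 g1 [_ - 0]subr0 [1 - 0]subr0 [_ * 1]mulr1 => ->.
move: c01; rewrite in_itv/= => c01; have [_ h] := df _ c01.
rewrite normrM exprS mulrCA mulrC ler_wpM2l// (le_trans h)// ler_wpM2l//.
rewrite lerXn2r ?nnegrE// normrM ler_piMl//.
by case/andP: c01 => c0 c1; rewrite ger0_norm.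
Qed.

Lemma is_derive_shiftr (F : R -> R) y h (a : R) :
  is_derive (y + h) (1 : R) F a -> is_derive h (1 : R) (fun h => F (y + h)) a.
Proof.
move=> dF; have dy : is_derive h (1 : R) (fun h : R => y + h) 1.
  have -> : (fun h : R => y + h) = cst y + id by [].
  by apply: is_derive_eq; rewrite add0r.
by have := @is_derive1_comp _ F (fun h => y + h) h _ _ dF dy; rewrite mulr1.
Qed.

Lemma taylor1 (F F1 : R -> R) (K y h : R) :
  (forall x, is_derive x (1 : R) F (F1 x)) -> (forall x, `|F1 x| <= K) ->
  `|F (y + h) - F y| <= K * `|h|.
Proof.
move=> dF F1K; rewrite -[`|h|]expr1.
apply: (@mvt_pow (fun h => F (y + h) - F y) (fun h => F1 (y + h))).
- exact: le_trans (F1K 0).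
- by rewrite addr0 subrr.
- move=> l _; split; last by rewrite expr0 mulr1.
  have d1 := is_derive_shiftr (dF (y + l * h)).
  have := is_deriveB d1 (@is_derive_cst _ _ _ (F y) (l * h) 1).
  by rewrite subr0.
Qed.

Lemma taylor2 (F F1 F2 : R -> R) (K y h : R) :
  (forall x, is_derive x (1 : R) F (F1 x)) ->
  (forall x, is_derive x (1 : R) F1 (F2 x)) -> (forall x, `|F2 x| <= K) ->
  `|F (y + h) - F y - F1 y * h| <= K * `|h| ^+ 2.
Proof.
move=> dF dF1 F2K.
apply: (@mvt_pow (fun h => F (y + h) - F y - F1 y * h)
  (fun h => F1 (y + h) - F1 y)).
- exact: le_trans (F2K 0).
- by rewrite addr0 subrr mulr0 subrr.
- move=> l _; split; last by rewrite expr1; exact: taylor1 dF1 F2K.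
  have d1 := is_derive_shiftr (dF (y + l * h)).
  have d2 := is_deriveB d1 (@is_derive_cst _ _ _ (F y) (l * h) 1).
  have d3 := is_deriveZ (F1 y) (@is_derive_id _ _ (l * h) 1).
  have := is_deriveB d2 d3.
  by rewrite subr0 /GRing.scale/= mulr1.
Qed.

Lemma taylor3 (F F1 F2 F3 : R -> R) (K y h : R) :
  (forall x, is_derive x (1 : R) F (F1 x)) ->
  (forall x, is_derive x (1 : R) F1 (F2 x)) ->
  (forall x, is_derive x (1 : R) F2 (F3 x)) -> (forall x, `|F3 x| <= K) ->
  `|F (y + h) - F y - F1 y * h - F2 y / 2 * h ^+ 2| <= K * `|h| ^+ 3.
Proof.
move=> dF dF1 dF2 F3K.
apply: (@mvt_pow (fun h => F (y + h) - F y - F1 y * h - F2 y / 2 * h ^+ 2)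
  (fun h => F1 (y + h) - F1 y - F2 y * h)).
- exact: le_trans (F3K 0).
- by rewrite addr0 subrr mulr0 expr0n mulr0 !subrr.
- move=> l _; split; last exact: taylor2 dF1 dF2 F3K.
  have d1 := is_derive_shiftr (dF (y + l * h)).
  have d2 := is_deriveB d1 (@is_derive_cst _ _ _ (F y) (l * h) 1).
  have d3 := is_deriveZ (F1 y) (@is_derive_id _ _ (l * h) 1).
  have d4 := is_deriveZ (F2 y / 2) (is_deriveX 2 (@is_derive_id _ _ (l * h) 1)).
  have d5 := is_deriveB (is_deriveB d2 d3) d4.
  by apply: (@is_derive_eq _ _ _ _ _ _ _ _ d5); rewrite /GRing.scale/=; field.
Qed.

Let p : R := normal_peak 1.
Let K1 : R := 7 * p.

Let p0 : 0 <= p. Proof. exact: normal_peak_ge0. Qed.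

Let K10 : 0 <= K1. Proof. by rewrite mulr_ge0. Qed.

(** Since e^u >= 1 + u, the density is at most a constant times
    (1 + x^2 / 4)^(-2); with B = 1 + x^2 / 4, both |x| and x^2 / 4 are at most
    B.  The constant 7 is what 3 |x| + |x|^3 <= 7 B^2 requires, and it also
    covers the polynomials of lower degree. *)
Let npdf_decay (b x : R) : `|b| <= 7 * (1 + x ^+ 2 / 4) ^+ 2 ->
  `|b * npdf x| <= K1.
Proof.
move=> hb; rewrite normrM npdfE [X in _ * X]ger0_norm ?mulr_ge0 ?expR_ge0//.
rewrite mulrCA /K1 [7 * p]mulrC; apply: ler_wpM2l => //.
have B0 : 0 < 1 + x ^+ 2 / 4 by rewrite ltr_wpDr// divr_ge0// sqr_ge0.
have -> : expR (- (x ^+ 2 / 2)) = (expR (x ^+ 2 / 4)) ^- 2.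
  rewrite expRN; congr (_^-1); rewrite [RHS]expr2 -expRD; congr expR; by field.
rewrite ler_pdivrMr ?exprn_gt0 ?expR_gt0//.
apply: (le_trans hb); rewrite ler_wpM2l// lerXn2r ?nnegrE ?expR_ge0 ?(ltW B0)//.
exact: expR_ge1Dx.
Qed.

Let B_ge x : let B := 1 + x ^+ 2 / 4 in [/\ 1 <= B, `|x| <= B & x ^+ 2 <= 4 * B].
Proof.
move=> B; rewrite /B; have := sqr_ge0 x; split; [lra| |lra].
rewrite -[x ^+ 2]real_normK ?num_real//.
have := sqr_ge0 (`|x| - 2); rewrite sqrrB; lra.
Qed.

Lemma npdf1_bounded x : `|- x * npdf x| <= 7 * normal_peak 1.
Proof.
apply: npdf_decay; rewrite normrN; have [h1 h2 _] := B_ge x.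
set B := 1 + _ in h1 h2 *; nra.
Qed.

Let bnd1 x : `|- x * npdf x| <= K1. Proof. exact: npdf1_bounded. Qed.

Let bnd2 x : `|(x ^+ 2 - 1) * npdf x| <= K1.
Proof.
apply: npdf_decay; have [h1 _ h2] := B_ge x.
set B := 1 + _ in h1 h2 *; have := sqr_ge0 x => x0.
by rewrite ler_norml; apply/andP; split; nra.
Qed.

Let bnd3 x : `|(3 * x - x ^+ 3) * npdf x| <= K1.
Proof.
apply: npdf_decay; have [h1 h2 h3] := B_ge x.
set B := 1 + _ in h1 h2 h3 *.
apply: (@le_trans _ _ (3 * `|x| + `|x| * x ^+ 2)).
  rewrite (le_trans (ler_normB _ _))// normrM ger0_norm// lerD2l exprS normrM.
  by rewrite [X in _ * X]ger0_norm ?sqr_ge0.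
have : `|x| * x ^+ 2 <= B * (4 * B).
  by apply: ler_pM; rewrite ?sqr_ge0.
nra.
Qed.

Let is_derive_npdf1 x :
  is_derive x (1 : R) (fun x => - x * npdf x) ((x ^+ 2 - 1) * npdf x).
Proof.
have d := is_deriveM (is_deriveN (@is_derive_id _ _ x (1 : R))) (is_derive_npdf x).
apply: (@is_derive_eq _ _ _ _ _ _ _ _ d).
rewrite /GRing.scale/= (_ : (- id : R -> R) x = - x)//; ring.
Qed.

Let is_derive_scale x q : 0 < q ->
  is_derive q (1 : R) (fun q => x / Num.sqrt q) (- (x / Num.sqrt q) / (2 * q)).
Proof.
move=> q0; have s0 : Num.sqrt q != 0 by rewrite gt_eqF// sqrtr_gt0.
have d := is_deriveZ x (is_deriveV s0 (is_derive1_sqrt q0)).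
apply: (@is_derive_eq _ _ _ _ _ _ _ _ d).
rewrite /GRing.scale/= -[in RHS](sqr_sqrtr (ltW q0)) sqrtr_sqr.
rewrite ger0_norm ?sqrtr_ge0//; field.
by rewrite s0.
Qed.

Let is_derive_time x q : 0 < q ->
  is_derive q (1 : R) (fun q => ncdf (x / Num.sqrt q))
   (- (x / Num.sqrt q) * npdf (x / Num.sqrt q) / (2 * q)).
Proof.
move=> q0.
have d := @is_derive1_comp _ ncdf (fun q => x / Num.sqrt q) q _ _
  (is_derive_ncdf _) (is_derive_scale x q0).
apply: (@is_derive_eq _ _ _ _ _ _ _ _ d); field.
by rewrite ?andbT !gt_eqF ?sqrtr_gt0.
Qed.

Let is_derive_time2 x q : 0 < q ->
  is_derive q (1 : R)
   (fun q => - (x / Num.sqrt q) * npdf (x / Num.sqrt q) / (2 * q))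
   ((3 * (x / Num.sqrt q) - (x / Num.sqrt q) ^+ 3) * npdf (x / Num.sqrt q)
    / (4 * q ^+ 2)).
Proof.
move=> q0; have qn : q != 0 by rewrite gt_eqF.
have d1 := @is_derive1_comp _ (fun y => - y * npdf y) (fun q => x / Num.sqrt q)
  q _ _ (is_derive_npdf1 _) (is_derive_scale x q0).
have d2 : is_derive q (1 : R) (fun q : R => (2 * q)^-1) (- (2 * q ^+ 2)^-1).
  have q2 : (2 \*: (@id R)) q != 0 by rewrite /= mulf_neq0.
  have d := is_deriveV q2 (is_deriveZ 2 (@is_derive_id _ _ q (1 : R))).
  apply: (@is_derive_eq _ _ _ _ _ _ _ _ d).
  by rewrite /= /GRing.scale/=; field.
have d := is_deriveM d1 d2.
apply: (@is_derive_eq _ _ _ _ _ _ _ _ d).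
rewrite /GRing.scale/=; field.
by rewrite qn gt_eqF// sqrtr_gt0.
Qed.

(** Second order Taylor bound in the time variable q of Phi (x / sqrt q).  It is
    uniform in x because the derivatives in q are bounded functions of
    x / sqrt q divided by powers of q >= s^2. *)
Let time_expansion (s q v x : R) : 0 < s -> s ^+ 2 <= q -> 0 <= v ->
  `|ncdf (x / Num.sqrt (q + v)) - ncdf (x / Num.sqrt q)
    - - (x / Num.sqrt q) * npdf (x / Num.sqrt q) / (2 * q) * v|
  <= K1 / s ^+ 4 * v ^+ 2.
Proof.
move=> s0 sq v0; have q0 : 0 < q by apply: lt_le_trans sq; rewrite exprn_gt0.
pose f1 q := - (x / Num.sqrt q) * npdf (x / Num.sqrt q) / (2 * q).
have K0 : 0 <= K1 / s ^+ 4 by rewrite divr_ge0// exprn_ge0// ltW.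
have pos (l u : R) : 0 <= l <= 1 -> 0 <= u -> 0 < q + l * u.
  by move=> /andP[l0 _] u0; rewrite ltr_wpDr// mulr_ge0.
have step u : 0 <= u -> `|f1 (q + u) - f1 q| <= K1 / s ^+ 4 * `|u| ^+ 1.
  move=> u0.
  apply: (@mvt_pow (fun u => f1 (q + u) - f1 q)
    (fun u => (3 * (x / Num.sqrt (q + u)) - (x / Num.sqrt (q + u)) ^+ 3)
      * npdf (x / Num.sqrt (q + u)) / (4 * (q + u) ^+ 2))) => //.
    by rewrite addr0 subrr.
  move=> l l01; split.
    have d1 := is_derive_shiftr (is_derive_time2 x (pos _ _ l01 u0)).
    have := is_deriveB d1 (@is_derive_cst _ _ _ (f1 q) (l * u) 1).
    by rewrite subr0.
  rewrite expr0 mulr1 normrM; apply: ler_pM => //.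
  rewrite ger0_norm; last first.
    by rewrite invr_ge0 mulr_ge0// exprn_ge0// ltW// pos.
  rewrite lef_pV2 ?posrE ?mulr_gt0 ?exprn_gt0 ?pos//.
  have -> : s ^+ 4 = (s ^+ 2) ^+ 2 by rewrite -exprM.
  have : s ^+ 2 <= q + l * u.
    by rewrite (le_trans sq)// lerDl; case/andP: l01 => l0 _; rewrite mulr_ge0.
  have : 0 <= s ^+ 2 by rewrite exprn_ge0// ltW.
  set a := s ^+ 2; set b := q + _ => a0 ab.
  have : a ^+ 2 <= b ^+ 2 by rewrite lerXn2r ?nnegrE// (le_trans a0).
  have := sqr_ge0 b; lra.
rewrite (_ : v ^+ 2 = `|v| ^+ 2); last by rewrite ger0_norm.
apply: (@mvt_pow (fun v => ncdf (x / Num.sqrt (q + v)) - ncdf (x / Num.sqrt q) - f1 q * v)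
  (fun v => f1 (q + v) - f1 q)) => //.
  by rewrite addr0 subrr mulr0 subrr.
move=> l l01; split; last first.
  by apply: step; case/andP: l01 => l0 _; rewrite mulr_ge0.
have d1 := is_derive_shiftr (is_derive_time x (pos _ _ l01 v0)).
have d2 := is_deriveB d1 (@is_derive_cst _ _ _ (ncdf (x / Num.sqrt q)) (l * v) 1).
have d3 := is_deriveZ (f1 q) (@is_derive_id _ _ (l * v) 1).
have := is_deriveB d2 d3.
by rewrite subr0 /GRing.scale/= mulr1.
Qed.

(** The function u(q, x) = Phi (x / sqrt q) satisfies du/dq = (1/2) d^2u/dx^2.
    Hence moving x by D while q loses v costs u_x D + u_q (D^2 - v) up to
    higher order; for D of mean 0 and variance v the expectation of this main
    part vanishes.  The minimum in the error term reflects that only moments of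
    order slightly above 2 are available: the cubic bound serves for small D,
    the quadratic one for large D. *)
Lemma ncdf_heat_expansion (s : R) : 0 < s -> exists2 K, 0 <= K &
  forall q v x D, s ^+ 2 <= q -> 0 <= v ->
  `|ncdf ((x + D) / Num.sqrt q) - ncdf (x / Num.sqrt (q + v))
    - npdf (x / Num.sqrt q) / Num.sqrt q * D
    - - (x / Num.sqrt q) * npdf (x / Num.sqrt q) / (2 * q) * (D ^+ 2 - v)|
  <= K * (Num.min (D ^+ 2) (`|D| ^+ 3) + v ^+ 2).
Proof.
move=> s0.
exists (K1 / s ^+ 3 + 2 * K1 / s ^+ 2 + K1 / s ^+ 4).
  by rewrite !addr_ge0// ?divr_ge0 ?mulr_ge0 ?exprn_ge0// ltW.
move=> q v x D sq v0.
have e m : 0 <= s ^+ m by rewrite exprn_ge0// ltW.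
have K20 : 0 <= 2 * K1 by rewrite mulr_ge0.
have q0 : 0 < q by apply: lt_le_trans sq; rewrite exprn_gt0.
have := time_expansion x s0 sq v0.
set a := Num.sqrt q; have a0 : 0 < a by rewrite sqrtr_gt0.
have sa : s <= a.
  by rewrite -[s]gtr0_norm// -sqrtr_sqr ler_wsqrtr.
have qa : q = a ^+ 2 by rewrite sqr_sqrtr// ltW.
set y := x / a; set Z := ncdf (x / _).
set h := D / a => hv.
have -> : (x + D) / a = y + h by rewrite mulrDl.
have h3 : `|h| ^+ 3 <= `|D| ^+ 3 / s ^+ 3.
  rewrite normrM exprMn ler_wpM2l ?exprn_ge0// -exprVn lerXn2r ?nnegrE//.
    by rewrite invr_ge0 ltW.
  by rewrite gtr0_norm ?invr_gt0// lef_pV2.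
have h2 : `|h| ^+ 2 <= D ^+ 2 / s ^+ 2.
  rewrite normrM exprMn real_normK ?num_real// ler_wpM2l ?sqr_ge0//.
  rewrite -exprVn lerXn2r ?nnegrE ?invr_ge0 ?(ltW s0)//.
  by rewrite gtr0_norm ?invr_gt0// lef_pV2.
(* The error splits into the space part E and the time part G; E has a cubic and
   a quadratic bound. *)
set E := ncdf (y + h) - ncdf y - npdf y * h - (- y * npdf y) / 2 * h ^+ 2.
have E3 : `|E| <= K1 / s ^+ 3 * `|D| ^+ 3.
  rewrite (le_trans (taylor3 y h is_derive_ncdf is_derive_npdf is_derive_npdf1 bnd2))//.
  by rewrite -mulrA ler_wpM2l// mulrC.
have E2 : `|E| <= 2 * K1 / s ^+ 2 * D ^+ 2.
  rewrite (le_trans (ler_normB _ _))//.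
  have t2 := taylor2 y h is_derive_ncdf is_derive_npdf bnd1.
  have : `|- y * npdf y / 2 * h ^+ 2| <= K1 * `|h| ^+ 2.
    rewrite 2!normrM normrX ler_wpM2r ?exprn_ge0//.
    rewrite [`|2^-1|]ger0_norm// (le_trans _ (bnd1 y))// ler_piMr//.
    by rewrite invf_le1// ler1n.
  have : K1 * `|h| ^+ 2 <= K1 / s ^+ 2 * D ^+ 2.
    by rewrite -mulrA ler_wpM2l// mulrC.
  have -> : 2 * K1 / s ^+ 2 * D ^+ 2 = K1 / s ^+ 2 * D ^+ 2 + K1 / s ^+ 2 * D ^+ 2.
    by ring.
  lra.
set G := (X in `|X| <= _ * v ^+ 2) in hv.
have -> : ncdf (y + h) - Z - npdf y / a * D - - y * npdf y / (2 * q) * (D ^+ 2 - v)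
  = E - G.
  by rewrite /E /G qa /h; field; rewrite gt_eqF.
rewrite (le_trans (ler_normB _ _))// mulrDr lerD//; last first.
  rewrite (le_trans hv)// ler_wpM2r ?sqr_ge0// lerDr addr_ge0//.
    by rewrite divr_ge0.
  by rewrite divr_ge0.
rewrite minEle; case: ifP => _.
  rewrite (le_trans E2)// ler_wpM2r ?sqr_ge0// -addrA addrCA lerDl addr_ge0//.
    by rewrite divr_ge0.
  by rewrite divr_ge0.
rewrite (le_trans E3)// ler_wpM2r ?exprn_ge0// -addrA lerDl addr_ge0//.
  by rewrite divr_ge0.
by rewrite divr_ge0.
Qed.

End normal_cdf.

(** * The weights of the estimator *)

Section pull_counts.
Context {d : nat}.
Implicit Types (k : nat -> 'I_d) (a : 'I_d).

Lemma pulls0 k a : pulls k a 0 = 0%N.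
Proof. by rewrite /pulls big_geq. Qed.

Lemma pullsS k a i : pulls k a i.+1 = (pulls k a i + (k i.+1 == a))%N.
Proof. by rewrite /pulls big_nat_recr. Qed.

Lemma pulls_le k a i : (pulls k a i <= i)%N.
Proof. by elim: i => [|i IH]; rewrite ?pulls0// pullsS -addn1 leq_add// leq_b1. Qed.

Lemma pulls_homo k a : {homo pulls k a : i j / (i <= j)%N}.
Proof.
move=> i j; elim: j => [|j IH]; first by rewrite leqn0 => /eqP ->.
rewrite leq_eqVlt => /predU1P[->//|]; rewrite ltnS => /IH.
by move=> /leq_trans; apply; rewrite pullsS leq_addr.
Qed.

(** Reindexes a sum over the rounds in which [a] is pulled by the number of pulls
    of [a].  This turns random sums of weights into deterministic sums with a
    random number of terms. *)
Lemma sum_pulls {R : pzRingType} k a (f : nat -> R) n :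
  \sum_(1 <= i < n.+1) (k i == a)%:R * f (pulls k a i) =
  \sum_(1 <= t < (pulls k a n).+1) f t.
Proof.
elim: n => [|n IH]; first by rewrite pulls0 !big_geq.
rewrite big_nat_recr//= {}IH pullsS; case: (k n.+1 == a).
  by rewrite addn1 mul1r [RHS]big_nat_recr.
by rewrite addn0 mul0r addr0.
Qed.

Lemma min_pulls_le k a n : (min_pulls k n <= pulls k a n)%N.
Proof.
rewrite /min_pulls; have : a \in index_enum 'I_d by rewrite mem_index_enum.
elim: (index_enum _) => // b s IH; rewrite big_cons inE geq_min.
by case/predU1P => [<-|/IH ->]; rewrite ?leqnn ?orbT.
Qed.

End pull_counts.

Section diagonal.
Context {R : realType} {d : nat}.

(** The inverse of a diagonal matrix in the convention of [invmx], which returns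
    a singular matrix unchanged.  Covering that case keeps the formulas for the
    estimator valid on every outcome, also when an arm has never been pulled, as
    is needed for measurability. *)
Definition diag_inv (r : 'I_d -> R) (a : 'I_d) : R :=
  (if [forall b, r b != 0] then fun b => (r b)^-1 else r) a.

Lemma invmx_diag (r : 'I_d -> R) :
  invmx (diag_mx (\row_a r a)) = diag_mx (\row_a diag_inv r a).
Proof.
rewrite /diag_inv; case: ifPn => [/forallP h|].
  have E : diag_mx (\row_a r a) *m diag_mx (\row_a (r a)^-1) = 1%:M.
    apply/matrixP => i j; rewrite mul_diag_mx !mxE.
    by case: eqVneq => [->|_]; rewrite ?mulr0n ?mulr0// !mulr1n divff.
  set A := diag_mx _ in E *; set B := diag_mx _ in E.
  have [U _] := mulmx1_unit E.
  by have := mulKmx U B; rewrite E mulmx1.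
rewrite negb_forall => /existsP[b]; rewrite negbK => /eqP b0.
rewrite /invmx ifN// unitmxE unitfE det_diag (bigD1 b)//= mxE b0 mul0r.
by rewrite eqxx.
Qed.

Lemma diag_inv_neq0 (r : 'I_d -> R) a : (forall b, r b != 0) ->
  diag_inv r a = (r a)^-1.
Proof. by move=> r0; rewrite /diag_inv ifT//; apply/forallP. Qed.

Lemma isqrtmx_diag (r : 'I_d -> R) : (forall a, 0 <= r a) ->
  isqrtmx (diag_mx (\row_a r a)) =
  diag_mx (\row_a diag_inv (fun b => Num.sqrt (r b)) a).
Proof.
move=> r0; rewrite /isqrtmx sqrtmx_diag; last by move=> a; rewrite mxE.
rewrite -invmx_diag; congr (invmx (diag_mx _)).
by apply/rowP => a; rewrite !mxE.
Qed.

Lemma dotv_arm (k : nat -> 'I_d) i (v : 'cV[R]_d) :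
  dotv (arm_vec k i) v = v (k i) 0.
Proof. by rewrite /dotv /arm_vec trmx_delta -rowE mxE. Qed.

End diagonal.

Section weights.
Context {R : realType}.
Variables (g c : R).

(** The length of z_i when round i is the [t]-th pull of its arm and
    [c] = (log n)^2. *)
Definition od_scale (t : nat) : R := (Num.sqrt (Num.max t%:R c))^-1.

(** The residual 1 - (sum of w_j z_j) of one arm after [t] pulls, that is, the
    diagonal entry of I - (sum of w_j z_j^T). *)
Fixpoint od_res (t : nat) : R :=
  if t is s.+1 then od_res s * (g / 2) / (g / 2 + od_scale t ^+ 2) else 1.

Definition od_coef (t : nat) : R :=
  od_res t.-1 * od_scale t / (g / 2 + od_scale t ^+ 2).

Hypotheses (g0 : 0 < g) (c0 : 0 < c).

Lemma od_scale_sqr t : od_scale t ^+ 2 = (Num.max t%:R c)^-1.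
Proof. by rewrite exprVn sqr_sqrtr// ltW// lt_max c0 orbT. Qed.

Lemma od_scale_gt0 t : 0 < od_scale t.
Proof. by rewrite invr_gt0 sqrtr_gt0 lt_max c0 orbT. Qed.

Let den_gt0 t : 0 < g / 2 + od_scale t ^+ 2.
Proof. by apply: addr_gt0; [exact: divr_gt0|rewrite exprn_gt0// od_scale_gt0]. Qed.

Lemma od_res_ge0 t : 0 <= od_res t.
Proof.
elim: t => //= t IH; rewrite divr_ge0 ?mulr_ge0 ?divr_ge0 ?(ltW (den_gt0 _))//.
exact: ltW.
Qed.

Lemma od_coef_ge0 t : 0 <= od_coef t.
Proof.
by rewrite divr_ge0 ?mulr_ge0 ?od_res_ge0 ?(ltW (den_gt0 _))// ltW// od_scale_gt0.
Qed.

Lemma od_resS t : od_res t.+1 = od_res t - od_coef t.+1 * od_scale t.+1.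
Proof.
have h := den_gt0 t.+1; rewrite /= /od_coef /=.
by field; rewrite gt_eqF//; lra.
Qed.

Lemma od_res_le1 t : od_res t <= 1.
Proof.
elim: t => // t IH; rewrite od_resS (le_trans _ IH)// gerBl.
by rewrite mulr_ge0 ?od_coef_ge0// ltW// od_scale_gt0.
Qed.

(** With z = [od_scale t.+1] and r the residual before the pull, the weight w
    is r z / (g/2 + z^2) and the new residual is r (g/2) / (g/2 + z^2); hence
    w^2 (g + z^2) is exactly the decrease of the squared residual.  The halving
    of gamma in the definition of the weights is what makes this an identity. *)
Lemma od_coef_sqr t :
  od_coef t.+1 ^+ 2 * (g + od_scale t.+1 ^+ 2) = od_res t ^+ 2 - od_res t.+1 ^+ 2.
Proof.
have h := den_gt0 t.+1; rewrite /= /od_coef /=.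
by field; rewrite gt_eqF//; lra.
Qed.

Lemma od_scale_le t : od_scale t ^+ 2 <= c^-1.
Proof. by rewrite od_scale_sqr lef_pV2 ?posrE ?lt_max ?c0 ?orbT// le_max lexx orbT. Qed.

Lemma sum_od_coef_sqr n :
  \sum_(1 <= t < n.+1) od_coef t ^+ 2 * (g + od_scale t ^+ 2) = 1 - od_res n ^+ 2.
Proof.
elim: n => [|n IH]; first by rewrite big_geq//= expr1n subrr.
by rewrite big_nat_recr//= IH od_coef_sqr addrA subrK.
Qed.

Lemma od_var_le1 n : g * \sum_(1 <= t < n.+1) od_coef t ^+ 2 <= 1.
Proof.
rewrite (@le_trans _ _ (1 - od_res n ^+ 2))//; last first.
  by rewrite gerBl sqr_ge0.
rewrite -sum_od_coef_sqr mulr_sumr ler_sum// => t _.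
by rewrite mulrC ler_wpM2l ?sqr_ge0// lerDl sqr_ge0.
Qed.

(** In the telescoped identity the part with z^2 is at most 1 / c times the sum
    of the squared weights, which is at most 1 / g. *)
Lemma od_var_ge n :
  1 - od_res n ^+ 2 - (c * g)^-1 <= g * \sum_(1 <= t < n.+1) od_coef t ^+ 2.
Proof.
rewrite lerBlDr -sum_od_coef_sqr mulr_sumr.
have h : c^-1 * \sum_(1 <= t < n.+1) od_coef t ^+ 2 <= (c * g)^-1.
  rewrite invfM ler_wpM2l ?invr_ge0 ?(ltW c0)//.
  by rewrite -[leRHS]mul1r ler_pdivlMr// mulrC od_var_le1.
apply: (le_trans _ (lerD (lexx _) h)).
rewrite mulr_sumr -big_split /=; apply: ler_sum => t _.
rewrite mulrDr lerD// 1?mulrC// ler_wpM2r ?sqr_ge0//.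
exact: od_scale_le.
Qed.

Lemma sum_od_coef_scale n :
  \sum_(1 <= t < n.+1) od_coef t * od_scale t = 1 - od_res n.
Proof.
elim: n => [|n IH]; first by rewrite big_geq//= subrr.
by rewrite big_nat_recr// IH od_resS [LHS]/=; ring.
Qed.

Lemma od_coef_le t : od_coef t <= 2 / (g * Num.sqrt c).
Proof.
have s0 := od_scale_gt0 t.
have sc : od_scale t <= (Num.sqrt c)^-1.
  rewrite lef_pV2 ?posrE ?sqrtr_gt0 ?lt_max ?c0 ?orbT//.
  by rewrite ler_wsqrtr// le_max lexx orbT.
rewrite /od_coef ler_pdivrMr//=.
apply: (@le_trans _ _ (od_scale t)).
  by rewrite ler_piMl ?od_res_le1// ltW.
apply: (le_trans sc).
have sq0 : 0 < Num.sqrt c by rewrite sqrtr_gt0.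
have -> : 2 / (g * Num.sqrt c) * (g / 2 + od_scale t ^+ 2) =
  (Num.sqrt c)^-1 + 2 / (g * Num.sqrt c) * od_scale t ^+ 2.
  by field; rewrite !gt_eqF.
by rewrite lerDl mulr_ge0 ?sqr_ge0// divr_ge0// mulr_ge0 ?sqrtr_ge0// ltW.
Qed.

(** For t <= n and c <= n one has z_t >= 1 / sqrt n, so the sum of the weights is
    at most sqrt n times the sum of w_t z_t = 1 - (residual) <= 1. *)
Lemma sum_od_coef_le n : c <= n%:R ->
  \sum_(1 <= t < n.+1) od_coef t <= Num.sqrt n%:R.
Proof.
move=> cn; have sn : 0 < Num.sqrt (n%:R : R) by rewrite sqrtr_gt0 (lt_le_trans c0).
have h : (Num.sqrt n%:R)^-1 * \sum_(1 <= t < n.+1) od_coef t <= 1.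
  rewrite (@le_trans _ _ (1 - od_res n))//; last by rewrite gerBl od_res_ge0.
  rewrite -sum_od_coef_scale mulr_sumr big_nat [leRHS]big_nat.
  apply: ler_sum => t /andP[_]; rewrite ltnS => tn.
  rewrite mulrC ler_wpM2l ?od_coef_ge0//.
  rewrite lef_pV2 ?posrE ?sqrtr_gt0 ?lt_max ?c0 ?orbT ?(lt_le_trans c0)//.
  by rewrite ler_wsqrtr// ge_max ler_nat tn.
by rewrite -ler_pdivlMl ?invr_gt0// invrK mulr1 in h.
Qed.

(** A pull multiplies 1 / residual by 1 + 2 z^2 / g, so it adds at least
    2 z^2 / g, because 1 / residual >= 1.  As z_t^2 >= 1 / n for t <= n, after n
    pulls 1 / residual is at least 2 / g. *)
Lemma od_res_le n : c <= n%:R -> od_res n <= g / 2.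
Proof.
move=> cn; have n0 : 0 < n%:R :> R by apply: lt_le_trans cn.
have pos t : 0 < od_res t.
  by elim: t => //= t IH; rewrite divr_gt0 ?mulr_gt0 ?divr_gt0.
have h m : (m <= n)%N -> 2 / g * (m%:R / n%:R) <= (od_res m)^-1.
  elim: m => [|m IH mn]; first by rewrite mul0r mulr0 /= invr1.
  have -> : (od_res m.+1)^-1 = (od_res m)^-1 * (1 + 2 / g * od_scale m.+1 ^+ 2).
    have h1 := den_gt0 m.+1; have h2 := pos m; rewrite /=; field.
    by rewrite !gt_eqF//; lra.
  have -> : 2 / g * (m.+1%:R / n%:R) = 2 / g * (m%:R / n%:R) + 2 / g * n%:R^-1.
    by rewrite -natr1; field; rewrite !gt_eqF.
  rewrite [leRHS]mulrDr mulr1 lerD// ?IH// 1?ltnW//.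
  rewrite (@le_trans _ _ (2 / g * od_scale m.+1 ^+ 2))//; last first.
    rewrite ler_peMl//; last by rewrite invf_ge1 ?od_res_le1.
    by apply: mulr_ge0; [rewrite divr_ge0// ltW|exact: sqr_ge0].
  rewrite ler_wpM2l ?divr_ge0 ?(ltW g0)// od_scale_sqr.
  by rewrite lef_pV2 ?posrE ?lt_max ?c0 ?orbT// ge_max cn ler_nat mn.
have := h n (leqnn n); rewrite divff ?gt_eqF// mulr1 => h1.
by rewrite -[od_res n]invrK -[g / 2]invrK lef_pV2 ?posrE ?invr_gt0 ?divr_gt0// invf_div.
Qed.

Lemma od_var_defect n : c <= n%:R ->
  1 - g * \sum_(1 <= t < n.+1) od_coef t ^+ 2 <= (g / 2) ^+ 2 + (c * g)^-1.
Proof.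
move=> cn; have := od_var_ge n; have := od_res_le cn; have := od_res_ge0 n.
move=> h1 h2; have : od_res n ^+ 2 <= (g / 2) ^+ 2.
  by rewrite lerXn2r ?nnegrE// (le_trans h1).
lra.
Qed.

End weights.

Section estimator.
Context {R : realType} {d : nat}.
Variables (k : nat -> 'I_d) (y : nat -> R) (n : nat).
Hypothesis logn0 : log n != 0 :> R.

Let c : R := log n ^+ 2.
Let c0 : 0 < c. Proof. by rewrite exprn_even_gt0/=. Qed.

Variable g : R.
Hypothesis g0 : 0 < g.

Lemma GammaLE i : GammaL k n i =
  diag_mx (\row_a Num.max (pulls k a i)%:R c) :> 'M[R]_d.
Proof.
apply/matrixP => a b; rewrite /GammaL gram_diag !mxE.
by case: eqVneq => [->|_]; rewrite ?mulr1n// !mulr0n maxxx.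
Qed.

Lemma od_dirE i : od_dir k (GammaL k n) i =
  od_scale c (pulls k (k i) i) *: arm_vec k i :> 'cV[R]_d.
Proof.
rewrite /od_dir GammaLE isqrtmx_diag; last first.
  by move=> a; rewrite le_max (ltW c0) orbT.
apply/colP => a; rewrite mul_diag_mx !mxE diag_inv_neq0; last first.
  by move=> b; rewrite gt_eqF// sqrtr_gt0 lt_max c0 orbT.
by case: (eqVneq a (k i)) => [->//|] _; rewrite !mulr0.
Qed.

Let sqnorm2_dir i :
  sqnorm2 (od_dir k (GammaL k n) i) = od_scale c (pulls k (k i) i) ^+ 2.
Proof.
rewrite od_dirE /sqnorm2 /dotv mxE (bigD1 (k i))//= big1 => [|a ak].
  by rewrite !mxE !eqxx mulr1 addr0 expr2.
by rewrite !mxE (negbTE ak) mulr0 mul0r.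
Qed.

(** The accumulated matrix stays diagonal since each w_j z_j^T is a multiple of
    a diagonal matrix unit; hence the recursion splits over the arms. *)
Lemma od_accE i : od_acc k g (GammaL k n) i =
  diag_mx (\row_a (1 - od_res g c (pulls k a i))) :> 'M[R]_d.
Proof.
elim: i => [|i IH].
  apply/matrixP => a b; rewrite !mxE pulls0 /= subrr.
  by rewrite mul0rn.
rewrite /= {}IH /od_step sqnorm2_dir od_dirE.
rewrite mulmxBl mul1mx mul_diag_mx; apply/matrixP => a b.
rewrite !mxE big_ord1 !mxE !pullsS.
case: (eqVneq a (k i.+1)) => [->|ak] /=; last first.
  rewrite addn0 !mulr0 subrr mulr0 mul0r addr0.
  by case: (a == b).
rewrite addn1 mulr1; case: (eqVneq b (k i.+1)) => _ /=.
  rewrite mulr1 !mulr1n -/(od_res g c _.+1) od_resS// /od_coef /=.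
  by rewrite eqxx addn1; ring.
by rewrite !mulr0 !mulr0n addr0.
Qed.

Lemma od_weightsE i : (0 < i)%N -> od_weight k g (GammaL k n) i =
  od_coef g c (pulls k (k i) i) *: arm_vec k i :> 'cV[R]_d.
Proof.
case: i => // i _; rewrite /od_weight /od_step sqnorm2_dir od_accE od_dirE /=.
rewrite -scalemxAr scalerA; apply/colP => a.
rewrite mulmxBl mul1mx mul_diag_mx !mxE.
case: (eqVneq a (k i.+1)) => [->|_] /=; last by rewrite !mulr0 subrr mulr0.
rewrite pullsS eqxx addn1 /od_coef /=.
by ring.
Qed.

Definition LS_mean (a : 'I_d) : R :=
  diag_inv (fun b => (pulls k b n)%:R) a *
  \sum_(1 <= i < n.+1) (k i == a)%:R * y i.

Lemma theta_LSE a : theta_LS k y n a 0 = LS_mean a.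
Proof.
rewrite /theta_LS gram_diag invmx_diag mul_diag_mx !mxE; congr (_ * _).
rewrite summxE; apply: eq_bigr => i _.
by rewrite !mxE andbT eq_sym mulrC.
Qed.

Lemma theta_ODE a : theta_OD k y g (GammaL k n) n a 0 = LS_mean a +
  diag_inv (fun b => Num.sqrt (pulls k b n)%:R) a *
  \sum_(1 <= i < n.+1)
    (k i == a)%:R * (od_coef g c (pulls k a i) * (y i - LS_mean a)).
Proof.
rewrite /theta_OD mxE theta_LSE gram_diag isqrtmx_diag//.
rewrite mul_diag_mx !mxE summxE; congr (_ + _ * _).
apply: eq_big_nat => i /andP[i1 _].
rewrite dotv_arm theta_LSE mxE od_weightsE// !mxE eqxx andbT [a == _]eq_sym.
by case: eqVneq => [->|_]; rewrite ?mulr0 ?mul0r// mulr1 mul1r mulrC.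
Qed.

(** Holds on every outcome, including those where an arm has not been pulled;
    [od_error_decomp] is the form used for the limit. *)
Lemma od_errorE (th : 'cV[R]_d) a :
  (sqrtmx (gram k n) *m (theta_OD k y g (GammaL k n) n - th)) a 0 =
  Num.sqrt (pulls k a n)%:R * (LS_mean a +
    diag_inv (fun b => Num.sqrt (pulls k b n)%:R) a *
    \sum_(1 <= i < n.+1)
      (k i == a)%:R * (od_coef g c (pulls k a i) * (y i - LS_mean a))
    - th a 0).
Proof.
rewrite gram_diag sqrtmx_diag; last by move=> b; rewrite mxE.
by rewrite mul_diag_mx mxE [X in _ * X]mxE theta_ODE !mxE.
Qed.

Variables (th : 'cV[R]_d) (e : nat -> R).
Hypothesis yE : forall i, (0 < i)%N -> y i = th (k i) 0 + e i.
Hypothesis pulls_n : forall a, (0 < pulls k a n)%N.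

Definition noise_sum (a : 'I_d) := \sum_(1 <= i < n.+1) (k i == a)%:R * e i.

Lemma LS_meanE a : LS_mean a = th a 0 + noise_sum a / (pulls k a n)%:R.
Proof.
have N0 b : (pulls k b n)%:R != 0 :> R by rewrite pnatr_eq0 -lt0n.
rewrite /LS_mean diag_inv_neq0//.
have -> : \sum_(1 <= i < n.+1) (k i == a)%:R * y i =
    (pulls k a n)%:R * th a 0 + noise_sum a.
  rewrite /pulls natr_sum mulr_suml -big_split /=.
  apply: eq_big_nat => i /andP[i1 _]; rewrite yE//.
  by case: eqVneq => [->|_]; rewrite ?mul0r ?addr0// !mul1r.
by rewrite mulrDr mulKf// mulrC.
Qed.

(** The least squares mean of the arm is theta_a + M / N.  Substituting this in
    the residuals y_i - theta_LS leaves the weighted noise and a multiple of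
    M / N, and the two contributions of M combine into the bias. *)
Lemma od_error_decomp a :
  (sqrtmx (gram k n) *m (theta_OD k y g (GammaL k n) n - th)) a 0 =
  \sum_(1 <= i < n.+1) (k i == a)%:R * (od_coef g c (pulls k a i) * e i) +
  (1 - (\sum_(1 <= t < (pulls k a n).+1) od_coef g c t)
        / Num.sqrt (pulls k a n)%:R)
  * (noise_sum a / Num.sqrt (pulls k a n)%:R).
Proof.
have s0 b : Num.sqrt (pulls k b n)%:R != 0 :> R.
  by rewrite gt_eqF// sqrtr_gt0 ltr0n.
rewrite od_errorE diag_inv_neq0//.
have -> : \sum_(1 <= i < n.+1)
      (k i == a)%:R * (od_coef g c (pulls k a i) * (y i - LS_mean a)) =
  \sum_(1 <= i < n.+1) (k i == a)%:R * (od_coef g c (pulls k a i) * e i) -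
  (\sum_(1 <= t < (pulls k a n).+1) od_coef g c t) * (noise_sum a / (pulls k a n)%:R).
  rewrite -sum_pulls mulr_suml -sumrB; apply: eq_big_nat => i /andP[i1 _].
  rewrite yE// LS_meanE; case: eqVneq => [->|_]; last by rewrite !mul0r subrr.
  by ring.
rewrite LS_meanE; set S := \sum_(_ <= _ < _) _; set W := \sum_(_ <= _ < _) _.
have -> : (pulls k a n)%:R = Num.sqrt (pulls k a n)%:R ^+ 2 :> R by rewrite sqr_sqrtr.
rewrite sqrtr_sqr ger0_norm ?sqrtr_ge0//; move: (s0 a).
by set r := Num.sqrt _ => r0; field.
Qed.

End estimator.

(** * Means over sub-sigma-algebras *)

Section expectation_calculus.
Context {disp : measure_display} {T : measurableType disp} {R : realType}.
Variable P : probability T R.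
Implicit Types (f g X : T -> R) (A : set T).

Definition has_mean f := P.-integrable [set: T] (EFin \o f).

Definition mean f : R := (\int[P]_w f w)%R.

Lemma has_mean_measurable f : has_mean f -> measurable_fun [set: T] f.
Proof. by move/measurable_int/measurable_EFinP. Qed.

Lemma has_meanD f g : has_mean f -> has_mean g -> has_mean (fun w => f w + g w).
Proof. exact: integrableD. Qed.

Lemma has_meanB f g : has_mean f -> has_mean g -> has_mean (fun w => f w - g w).
Proof. exact: integrableB. Qed.

Lemma has_meanZ a f : has_mean f -> has_mean (fun w => a * f w).
Proof. exact: integrableZl. Qed.

Lemma has_mean_sum I (s : seq I) (h : I -> T -> R) :
  (forall i, has_mean (h i)) -> has_mean (fun w => \sum_(i <- s) h i w).
Proof.
move=> ih; elim: s => [|i s IH].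
  rewrite /has_mean (_ : EFin \o _ = cst 0%E); first exact: integrable0.
  by apply/funext => w; rewrite /= big_nil.
rewrite (_ : (fun w => _) = (fun w => h i w + \sum_(j <- s) h j w)).
  exact: has_meanD.
by apply/funext => w; rewrite big_cons.
Qed.

Lemma has_mean_dom f g : measurable_fun [set: T] f -> has_mean g ->
  (forall w, `|f w| <= g w) -> has_mean f.
Proof.
move=> mf ig fg; apply: le_integrable ig => //; first exact/measurable_EFinP.
by move=> w _; rewrite /= lee_fin (le_trans (fg w))// ler_norm.
Qed.

Lemma has_mean_cst (a : R) : has_mean (fun=> a).
Proof. exact: (finite_measure_integrable_cst P a). Qed.

Lemma has_mean_bounded (K : R) f : measurable_fun [set: T] f ->
  (forall w, `|f w| <= K) -> has_mean f.
Proof. by move=> mf; apply: has_mean_dom => //; exact: has_mean_cst. Qed.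

Lemma has_mean_indic A : measurable A -> has_mean (\1_A : T -> R).
Proof. exact: integrable_indic. Qed.

Lemma meanD f g : has_mean f -> has_mean g ->
  mean (fun w => f w + g w) = mean f + mean g.
Proof. exact: RintegralD. Qed.

Lemma meanB f g : has_mean f -> has_mean g ->
  mean (fun w => f w - g w) = mean f - mean g.
Proof. exact: RintegralB. Qed.

Lemma meanZ a f : has_mean f -> mean (fun w => a * f w) = a * mean f.
Proof. exact: RintegralZl. Qed.

Lemma mean_cst (a : R) : mean (fun=> a) = a.
Proof.
rewrite /mean (Rintegral_cst _ measurableT a).
rewrite [X in fine X](_ : _ = 1%E) ?mulr1//.
exact: probability_setT.
Qed.

Lemma mean_sum I (s : seq I) (h : I -> T -> R) : (forall i, has_mean (h i)) ->
  mean (fun w => \sum_(i <- s) h i w) = \sum_(i <- s) mean (h i).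
Proof.
move=> ih; elim: s => [|i s IH].
  rewrite big_nil (_ : (fun w => _) = fun=> 0); first exact: mean_cst.
  by apply/funext => w; rewrite big_nil.
rewrite big_cons -IH -meanD//; last exact: has_mean_sum.
by congr mean; apply/funext => w; rewrite big_cons.
Qed.

Lemma le_mean f g : has_mean f -> has_mean g -> (forall w, f w <= g w) ->
  mean f <= mean g.
Proof. by move=> *; apply: le_Rintegral. Qed.

Lemma norm_mean f : has_mean f -> `|mean f| <= mean (fun w => `|f w|).
Proof. exact: le_normr_Rintegral. Qed.

Lemma mean_indic A : measurable A -> mean (\1_A) = fine (P A).
Proof.
move=> mA; rewrite /mean /Rintegral; congr fine.
by rewrite integral_indic// setIT.
Qed.

Lemma EFin_mean f : has_mean f -> (mean f)%:E = (\int[P]_w (f w)%:E)%E.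
Proof. by move=> sf; rewrite fineK//; exact: integrable_fin_num. Qed.

Lemma mean_mul_indic A f : measurable A ->
  mean (fun w => \1_A w * f w) = fine (\int[P]_(w in A) (f w)%:E)%E.
Proof.
move=> mA; rewrite /mean /Rintegral [in RHS]integral_mkcond; congr fine.
apply: eq_integral => w _; rewrite /patch/= indicE; case: ifPn => _.
  by rewrite mul1r.
by rewrite mul0r.
Qed.

Lemma has_mean_mul_bounded (K : R) f g : measurable_fun [set: T] g ->
  (forall w, `|g w| <= K) -> has_mean f -> has_mean (fun w => g w * f w).
Proof.
move=> mg gK sf.
apply: (@has_mean_dom _ (fun w => K * `|f w|)).
- by apply: measurable_funM => //; exact: has_mean_measurable.
- by apply: has_meanZ; exact: integrable_norm.
- by move=> w; rewrite normrM ler_wpM2r.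
Qed.

Lemma markov_mean A f (a : R) : measurable A -> has_mean f -> (forall w, 0 <= f w) ->
  0 < a -> (forall w, A w -> a <= f w) -> fine (P A) <= mean f / a.
Proof.
move=> mA sf f0 a0 Af; rewrite ler_pdivlMr// mulrC -mean_indic// -meanZ; last first.
  exact: has_mean_indic.
apply: le_mean => //; first exact/has_meanZ/has_mean_indic.
move=> w; rewrite indicE; case: (boolP (w \in A)) => [/set_mem/Af|_].
  by rewrite mulr1.
by rewrite mulr0.
Qed.

End expectation_calculus.

Section sub_sigma_algebra.
Context {disp : measure_display} {T : measurableType disp} {R : realType}.
Variable P : probability T R.
Variable G : set (set T).
Hypothesis sG : sigma_algebra [set: T] G.
Hypothesis Gm : G `<=` measurable.
Notation TG := (g_sigma_algebraType G).

(** A sub-sigma-algebra is turned into a measurable type of its own, so that the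
    closure properties of measurable functions apply to it. *)
Lemma measurable_wrtP {d'} {U : measurableType d'} (f : T -> U) :
  measurable_wrt G f <-> measurable_fun [set: TG] (f : TG -> U).
Proof.
split=> [h _ B mB|h B mB].
  by rewrite setTI; apply: sub_sigma_algebra; exact: h.
have := h measurableT _ mB; rewrite setTI.
by rewrite /measurable/= sigma_algebra_id.
Qed.

Lemma sub_measurable_fun {d'} {U : measurableType d'} (f : T -> U) :
  measurable_fun [set: TG] (f : TG -> U) -> measurable_fun [set: T] f.
Proof.
by move=> /measurable_wrtP h _ B mB; rewrite setTI; apply/Gm/h.
Qed.

Lemma sub_measurableP (A : set T) : measurable (A : set TG) <-> G A.
Proof. by rewrite /measurable/= sigma_algebra_id. Qed.

Variable X : T -> R.
Hypothesis sX : has_mean P X.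
Hypothesis X0 : forall A, G A -> mean P (fun w => \1_A w * X w) <= 0.

Import HBNNSimple.

Let mean_nnsfun (h : {nnsfun TG >-> R}) : mean P (fun w => h w * X w) <= 0.
Proof.
have -> : (fun w => h w * X w) = (fun w => \sum_(y <- finmap.enum_fset (fset_set (range h)))
   y * (\1_(h @^-1` [set y]) w * X w)).
  apply/funext => w; rewrite {1}(fimfunE h w) fsbig_finite//= mulr_suml.
  by apply: eq_bigr => y _; rewrite mulrA.
have GA y : G (h @^-1` [set y]).
  apply/sub_measurableP; rewrite -[X in measurable X]setTI.
  exact: measurable_funPT.
have s1 y : has_mean P (fun w => \1_(h @^-1` [set y]) w * X w).
  apply: (@has_mean_mul_bounded _ _ _ _ 1) => //.
    by apply: measurable_indic; exact/Gm/GA.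
  by move=> w; rewrite indicE ger0_norm// lern1 leq_b1.
rewrite mean_sum; last by move=> y; exact: has_meanZ.
rewrite big_seq sumr_le0// => y; rewrite in_fset_set// => /set_mem[w _ <-].
by rewrite meanZ// mulr_ge0_le0 ?X0// fun_ge0.
Qed.

(** If E(X 1_A) <= 0 for all A in G, then E(g X) <= 0 for nonnegative
    G-measurable g.  The simple functions below g give it in the limit by
    dominated convergence with bound |g X|; thus g may be unbounded, provided
    that g X is integrable. *)
Lemma mean_pull_out_le (g : T -> R) : measurable_fun [set: TG] (g : TG -> R) ->
  (forall w, 0 <= g w) -> has_mean P (fun w => g w * X w) ->
  mean P (fun w => g w * X w) <= 0.
Proof.
move=> mg g0 sgX.
have mge : measurable_fun [set: TG] (EFin \o g : TG -> \bar R) by exact/measurable_EFinP.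
pose h := nnsfun_approx measurableT mge.
have hle n w : h n w <= g w.
  rewrite -lee_fin nnsfun_approxE; apply: (@le_approx _ TG R setT (EFin \o g)) => // x _.
  by rewrite lee_fin.
have mX := has_mean_measurable sX.
have [] := @dominated_convergence _ _ _ P setT measurableT
  (fun n w => (h n w * X w)%:E) (fun w => (g w * X w)%:E)
  (fun w => (`|g w * X w|)%:E).
- move=> n; apply/measurable_EFinP/measurable_funM => //.
  by apply: sub_measurable_fun; exact: measurable_funPT.
- exact: measurable_int sgX.
- apply: aeW => w _; rewrite EFinM.
  under eq_fun do rewrite EFinM.
  apply: cvgeZr => //.
  by apply: (@cvg_nnsfun_approx _ TG) => //= x _; rewrite lee_fin.
- exact: integrable_norm.
- apply: aeW => w n _; rewrite /= lee_fin !normrM ler_wpM2r// !ger0_norm//.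
move=> _ _ hc; rewrite -lee_fin EFin_mean//.
rewrite -(cvg_lim _ hc)//; apply: lime_le.
  by apply/cvg_ex; eexists; exact: hc.
apply: nearW => n; rewrite /= -EFin_mean.
  by rewrite lee_fin mean_nnsfun.
apply: (@has_mean_dom _ _ _ _ _ (fun w => `|g w * X w|)).
- apply/measurable_funM => //.
  by apply: sub_measurable_fun; exact: measurable_funPT.
- exact: integrable_norm.
- by move=> w; rewrite !normrM ler_wpM2r// !ger0_norm.
Qed.

End sub_sigma_algebra.

Section pull_out.
Context {disp : measure_display} {T : measurableType disp} {R : realType}.
Variables (P : probability T R) (G : set (set T)).
Hypothesis sG : sigma_algebra [set: T] G.
Hypothesis Gm : G `<=` measurable.
Notation TG := (g_sigma_algebraType G).
Variable X : T -> R.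
Hypothesis sX : has_mean P X.
Hypothesis X0 : forall A, G A -> mean P (fun w => \1_A w * X w) = 0.

Let mean_nonneg (g : T -> R) : measurable_fun [set: TG] (g : TG -> R) ->
  (forall w, 0 <= g w) -> has_mean P (fun w => g w * X w) ->
  mean P (fun w => g w * X w) = 0.
Proof.
move=> mg g0 sgX; apply/eqP; rewrite eq_le; apply/andP; split.
  by apply: (mean_pull_out_le sG Gm sX) => // A GA; rewrite X0.
have sNX : has_mean P (fun w => -1 * X w) by exact: has_meanZ.
have E f : (fun w => f w * (-1 * X w)) = (fun w => -1 * (f w * X w)).
  by apply/funext => w; rewrite mulrCA.
have : mean P (fun w => g w * (-1 * X w)) <= 0.
  apply: (mean_pull_out_le sG Gm sNX) => //.
  - move=> A GA; rewrite E meanZ; first by rewrite (X0 GA) mulr0.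
    apply: (@has_mean_mul_bounded _ _ _ _ 1) => //.
      by apply: measurable_indic; exact/Gm.
    by move=> w; rewrite indicE ger0_norm// lern1 leq_b1.
  - by rewrite E; exact: has_meanZ.
by rewrite E meanZ// mulN1r oppr_le0.
Qed.

(** The positive and negative parts of g are treated separately, both for X and
    for -X. *)
Lemma mean_pull_out (g : T -> R) : measurable_fun [set: TG] (g : TG -> R) ->
  has_mean P (fun w => g w * X w) -> mean P (fun w => g w * X w) = 0.
Proof.
move=> mg sgX.
have mX := has_mean_measurable sX.
have mp : measurable_fun [set: TG] (g^\+ : TG -> R) by exact: measurable_funrpos.
have mn : measurable_fun [set: TG] (g^\- : TG -> R) by exact: measurable_funrneg.
have gle (g' : T -> R) : measurable_fun [set: TG] (g' : TG -> R) ->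
    (forall w, `|g' w| <= `|g w|) -> has_mean P (fun w => g' w * X w).
  move=> mg' h; apply: (@has_mean_dom _ _ _ _ _ (fun w => `|g w * X w|)).
  - by apply/measurable_funM => //; exact: (sub_measurable_fun sG Gm).
  - exact: integrable_norm.
  - by move=> w; rewrite !normrM ler_wpM2r.
have e w : g w * X w = g^\+ w * X w - g^\- w * X w.
  by rewrite -mulrBl; congr (_ * _); rewrite -[in LHS](funrposBneg g).
have sp : has_mean P (fun w => g^\+ w * X w).
  apply: gle => // w; rewrite /funrpos ger0_norm ?le_max ?lexx ?orbT//.
  by rewrite ge_max ler_norm normr_ge0.
have sn : has_mean P (fun w => g^\- w * X w).
  apply: gle => // w; rewrite /funrneg ger0_norm ?le_max ?lexx ?orbT//.
  by rewrite ge_max -normrN ler_norm normr_ge0.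
rewrite (_ : (fun w => _) = (fun w => g^\+ w * X w - g^\- w * X w)); last first.
  exact/funext.
rewrite meanB// !mean_nonneg ?subrr//.
Qed.

End pull_out.

(** * Martingale transforms of the noise *)

Section noise.
Context {disp : measure_display} {T : measurableType disp} {R : realType}.
Variables (P : probability T R) (F : nat -> set (set T)).
Hypothesis filtF : filtration F.
Notation mF i f :=
  (measurable_fun [set: g_sigma_algebraType (F i)]
     (f : g_sigma_algebraType (F i) -> R)).

Lemma filt_sigma i : sigma_algebra [set: T] (F i).
Proof. by case: filtF. Qed.

Lemma filt_sub i : F i `<=` measurable.
Proof. by case: filtF. Qed.

Lemma filt_setT i : F i setT.
Proof. by case: (filt_sigma i) => F0 FC _; rewrite -(setD0 setT); exact: FC. Qed.

Lemma mF_mono i j f : (i <= j)%N -> mF i f -> mF j f.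
Proof.
move=> ij /(measurable_wrtP (filt_sigma i)) h.
apply/(measurable_wrtP (filt_sigma j)) => B mB.
by have [_ _ Fm] := filtF; exact: Fm ij _ (h _ mB).
Qed.

Lemma mF_measurable i f : mF i f -> measurable_fun [set: T] f.
Proof. exact: sub_measurable_fun (filt_sigma i) (@filt_sub i) _ _ _. Qed.

Lemma mF_indic i (A : set T) : F i A -> mF i (\1_A).
Proof.
move=> FA; apply: measurable_indic.
by apply/(sub_measurableP (filt_sigma i)).
Qed.

Variables (eps : nat -> T -> R) (sigma : R).
Hypothesis eps_adapted : forall i, measurable_wrt (F i.+1) (eps i.+1).
Hypothesis eps_mean : forall i,
  is_cond_exp P (F i) (fun w => (eps i.+1 w)%:E) (cst 0%:E).
Hypothesis eps_var : forall i,
  is_cond_exp P (F i) (fun w => (eps i.+1 w ^+ 2)%:E) (cst (sigma ^+ 2)%:E).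

Lemma mF_eps i : mF i.+1 (eps i.+1).
Proof. exact/(measurable_wrtP (filt_sigma i.+1))/eps_adapted. Qed.
Arguments mF_eps : clear implicits.

Lemma eps_measurable i : measurable_fun [set: T] (eps i.+1).
Proof. exact: mF_measurable (mF_eps i). Qed.
Arguments eps_measurable : clear implicits.

(** Integrating the conditional variance over the whole space bounds the
    integral of the square. *)
Lemma has_mean_eps2 i : has_mean P (fun w => eps i.+1 w ^+ 2).
Proof.
have [_ _ /(_ _ (filt_setT i)) h] := eps_var i.
apply/integrableP; split.
  by apply/measurable_EFinP/measurable_funX; exact: eps_measurable.
under eq_integral do rewrite /= ger0_norm ?sqr_ge0//.
rewrite -h integral_cst// lte_mul_pinfty ?lee_fin ?sqr_ge0//.
by rewrite (le_lt_trans (probability_le1 P measurableT))// ltry.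
Qed.

Lemma has_mean_eps i : has_mean P (eps i.+1).
Proof.
apply: (@has_mean_dom _ _ _ _ _ (fun w => 1 + eps i.+1 w ^+ 2)).
- exact: eps_measurable.
- by apply: has_meanD; [exact: has_mean_cst|exact: has_mean_eps2].
- move=> w; rewrite -[_ ^+ 2]real_normK ?num_real//.
  have := sqr_ge0 (`|eps i.+1 w| - 1); rewrite sqrrB.
  have := normr_ge0 (eps i.+1 w); lra.
Qed.

Lemma mean_indic_eps i A : F i A -> mean P (fun w => \1_A w * eps i.+1 w) = 0.
Proof.
move=> FA; rewrite mean_mul_indic; last exact: filt_sub FA.
by have [_ _ /(_ _ FA) <-] := eps_mean i; rewrite integral0.
Qed.

Lemma mean_indic_eps2 i A : F i A ->
  mean P (fun w => \1_A w * (eps i.+1 w ^+ 2 - sigma ^+ 2)) = 0.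
Proof.
move=> FA; have mA := filt_sub FA.
have sA : has_mean P (fun w => \1_A w * eps i.+1 w ^+ 2).
  apply: (@has_mean_mul_bounded _ _ _ _ 1); last exact: has_mean_eps2.
    exact: measurable_indic.
  by move=> w; rewrite indicE ger0_norm// lern1 leq_b1.
rewrite (_ : (fun w => _) = (fun w => \1_A w * eps i.+1 w ^+ 2 - sigma ^+ 2 * \1_A w)).
  rewrite meanB//; last by apply: has_meanZ; exact: has_mean_indic.
  rewrite meanZ ?mean_indic//; last exact: has_mean_indic.
  rewrite mean_mul_indic//; have [_ _ /(_ _ FA) <-] := eps_var i.
  by rewrite integral_cst// fineM ?fin_num_measure// subrr.
by apply/funext => w; rewrite mulrBr [_ * sigma ^+ 2]mulrC.
Qed.

Lemma mean_predictable_eps i g : mF i g ->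
  has_mean P (fun w => g w * eps i.+1 w) -> mean P (fun w => g w * eps i.+1 w) = 0.
Proof.
move=> mg sg; apply: (mean_pull_out (filt_sigma i) (@filt_sub i)) => //.
  exact: has_mean_eps.
exact: mean_indic_eps.
Qed.

Lemma mean_predictable_eps2 i g (K : R) : mF i g -> (forall w, `|g w| <= K) ->
  mean P (fun w => g w * (eps i.+1 w ^+ 2 - sigma ^+ 2)) = 0.
Proof.
move=> mg gK.
have s2 : has_mean P (fun w => eps i.+1 w ^+ 2 - sigma ^+ 2).
  by apply: has_meanB; [exact: has_mean_eps2|exact: has_mean_cst].
apply: (mean_pull_out (filt_sigma i) (@filt_sub i)) => //.
  exact: mean_indic_eps2.
by apply: (@has_mean_mul_bounded _ _ _ _ K) => //; exact: mF_measurable mg.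
Qed.

Lemma mean_predictable_var i g (K : R) : mF i g -> (forall w, `|g w| <= K) ->
  mean P (fun w => g w * eps i.+1 w ^+ 2) = sigma ^+ 2 * mean P g.
Proof.
move=> mg gK; have mg' := mF_measurable mg.
have sg : has_mean P g by apply: (@has_mean_bounded _ _ _ _ K).
have := mean_predictable_eps2 mg gK.
rewrite (_ : (fun w => _) = (fun w => g w * eps i.+1 w ^+ 2 - sigma ^+ 2 * g w)).
  rewrite meanB ?meanZ//; last exact: has_meanZ.
    by move/eqP; rewrite subr_eq0 => /eqP.
  by apply: (has_mean_mul_bounded mg' gK); exact: has_mean_eps2.
by apply/funext => w; rewrite mulrBr [_ * sigma ^+ 2]mulrC.
Qed.

(** Discrete stochastic integrals of the noise against predictable bounded
    coefficients; the noise of round i + 1 is multiplied by a function that is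
    [F i]-measurable. *)
Section transform.
Variables (c : nat -> T -> R) (K : R).
Hypothesis c_predictable : forall i, mF i (c i.+1).
Hypothesis c_bounded : forall i w, `|c i w| <= K.

Definition transform (n : nat) (w : T) : R :=
  \sum_(i < n) c i.+1 w * eps i.+1 w.

Lemma transformS n w :
  transform n.+1 w = transform n w + c n.+1 w * eps n.+1 w.
Proof. by rewrite /transform big_ord_recr. Qed.

Lemma mF_transform n : mF n (transform n).
Proof.
elim: n => [|n IH].
  by rewrite (_ : transform 0 = fun=> 0)//; apply/funext => w; rewrite /transform big_ord0.
rewrite (_ : transform _ = fun w => transform n w + c n.+1 w * eps n.+1 w).
  apply: measurable_funD; first exact: mF_mono IH.
  apply: measurable_funM; last exact: mF_eps.
  exact: (mF_mono (leqnSn n)).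
by apply/funext => w; rewrite transformS.
Qed.
Arguments mF_transform : clear implicits.

Lemma has_mean_transform2 n : has_mean P (fun w => transform n w ^+ 2).
Proof.
elim: n => [|n IH].
  rewrite (_ : (fun w => _) = fun=> 0); first exact: has_mean_cst.
  by apply/funext => w; rewrite /transform big_ord0 expr0n.
apply: (@has_mean_dom _ _ _ _ _
  (fun w => 2 * transform n w ^+ 2 + 2 * (K ^+ 2 * eps n.+1 w ^+ 2))).
- by apply: measurable_funX; exact: mF_measurable (mF_transform _).
- by apply: has_meanD; apply: has_meanZ => //; apply: has_meanZ; exact: has_mean_eps2.
- move=> w; rewrite transformS ger0_norm ?sqr_ge0//.
  have : (c n.+1 w * eps n.+1 w) ^+ 2 <= K ^+ 2 * eps n.+1 w ^+ 2.
    rewrite exprMn ler_wpM2r ?sqr_ge0// -[_ ^+ 2]real_normK ?num_real//.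
    by rewrite lerXn2r ?nnegrE// (le_trans _ (c_bounded n.+1 w)).
  set x := transform n w; set y := c _ _ * _.
  have := sqr_ge0 (x - y); nra.
Qed.

(** The square of the transform, multiplied by predictable weights that do not
    increase: in one round the cross term has mean zero, the square of the
    increment contributes its conditional variance, and lowering the weight can
    only lower the mean.  With weights 1 / (number of pulls) this replaces a
    maximal inequality for a self-normalized sum. *)
Lemma mean_weighted_transform2 (b : nat -> T -> R) (B : R) n :
  (forall i, mF i (b i.+1)) -> (forall i w, 0 <= b i w <= B) ->
  (forall i w, b i.+1 w <= b i w) ->
  mean P (fun w => b n w * transform n w ^+ 2) <=
  sigma ^+ 2 * \sum_(i < n) mean P (fun w => b i.+1 w * c i.+1 w ^+ 2).
Proof.
move=> mb b0 bS.
have bB i w : `|b i w| <= B by have /andP[? ?] := b0 i w; rewrite ger0_norm.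
have mbT i : measurable_fun [set: T] (b i.+1) by exact: mF_measurable (mb i).
elim: n => [|n IH].
  rewrite big_ord0 mulr0 (_ : (fun w => _) = fun=> 0) ?mean_cst//.
  by apply/funext => w; rewrite /transform big_ord0 expr0n mulr0.
rewrite big_ord_recr mulrDr /=.
have s1 : has_mean P (fun w => b n.+1 w * transform n w ^+ 2).
  by apply: (has_mean_mul_bounded (mbT n) (bB n.+1)); exact: has_mean_transform2.
have mc : mF n (fun w => b n.+1 w * c n.+1 w ^+ 2).
  by apply: measurable_funM => //; exact: measurable_funX.
have bc w : `|b n.+1 w * c n.+1 w ^+ 2| <= B * K ^+ 2.
  rewrite normrM normrX ler_pM//.
  by rewrite lerXn2r ?nnegrE// (le_trans _ (c_bounded 0 w)).
have s3 : has_mean P (fun w => (b n.+1 w * c n.+1 w ^+ 2) * eps n.+1 w ^+ 2).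
  apply: (has_mean_mul_bounded _ bc); last exact: has_mean_eps2.
  exact: mF_measurable mc.
pose g w := 2 * (b n.+1 w * transform n w * c n.+1 w).
have mg : mF n g.
  apply: measurable_funM => //; apply: measurable_funM => //.
  by apply: measurable_funM => //; exact: mF_transform.
have s2 : has_mean P (fun w => g w * eps n.+1 w).
  apply: (@has_mean_dom _ _ _ _ _
    (fun w => b n.+1 w * transform n w ^+ 2 + (b n.+1 w * c n.+1 w ^+ 2) * eps n.+1 w ^+ 2)).
  - apply: measurable_funM; first exact: mF_measurable mg.
    exact: eps_measurable.
  - exact: has_meanD.
  - move=> w; have /andP[b1 _] := b0 n.+1 w.
    rewrite /g; set x := transform n w; set y := c _ _; set z := eps _ _.
    have -> : 2 * (b n.+1 w * x * y) * z = b n.+1 w * (2 * x * (y * z)) by ring.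
    have -> : b n.+1 w * x ^+ 2 + b n.+1 w * y ^+ 2 * z ^+ 2 =
      b n.+1 w * (x ^+ 2 + (y * z) ^+ 2) by ring.
    rewrite normrM (ger0_norm b1) ler_wpM2l// ler_norml.
    have := sqr_ge0 (x - y * z); have := sqr_ge0 (x + y * z).
    rewrite sqrrB sqrrD => h1 h2; apply/andP; split; lra.
have -> : (fun w => b n.+1 w * transform n.+1 w ^+ 2) =
   (fun w => (b n.+1 w * transform n w ^+ 2 + g w * eps n.+1 w) +
      (b n.+1 w * c n.+1 w ^+ 2) * eps n.+1 w ^+ 2).
  by apply/funext => w; rewrite transformS /g; ring.
rewrite meanD//; last exact: has_meanD.
rewrite meanD// (mean_predictable_eps mg s2) addr0 (mean_predictable_var mc bc).
rewrite lerD2r; apply: le_trans IH.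
(* [b 0] is not assumed measurable, but it only multiplies [transform 0] = 0. *)
case: n s1 {s2 s3 mc bc mg g} => [|n] s1.
  rewrite le_eqVlt; apply/orP; left; apply/eqP; congr mean.
  by apply/funext => w; rewrite /transform big_ord0 expr0n !mulr0.
apply: le_mean => //.
  by apply: (has_mean_mul_bounded (mbT n) (bB n.+1)); exact: has_mean_transform2.
by move=> w; rewrite ler_wpM2r ?sqr_ge0.
Qed.

End transform.

End noise.

(** * Tails of the noise *)

Section noise_tail.
Context {disp : measure_display} {T : measurableType disp} {R : realType}.
Variables (P : probability T R) (F : nat -> set (set T)).
Hypothesis filtF : filtration F.
Notation mF i f :=
  (measurable_fun [set: g_sigma_algebraType (F i)]
     (f : g_sigma_algebraType (F i) -> R)).
Variables (eps : nat -> T -> R) (sigma Delta : R) (C : nat -> T -> \bar R).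
Hypothesis eps_adapted : forall i, measurable_wrt (F i.+1) (eps i.+1).
Hypothesis eps_var : forall i,
  is_cond_exp P (F i) (fun w => (eps i.+1 w ^+ 2)%:E) (cst (sigma ^+ 2)%:E).
Hypothesis Delta0 : 0 < Delta.
Hypothesis eps_moment : forall i,
  is_cond_exp P (F i) (fun w => (`|eps i.+1 w| `^ (2 + Delta))%:E) (C i.+1).
Hypothesis moment_bounded : {ae P, forall w,
  (ereal_sup [set C i w | i in [set i | (1 <= i)%N]] < +oo)%E}.

Let meps i : measurable_fun [set: T] (eps i.+1).
Proof. exact: (eps_measurable filtF eps_adapted i). Qed.

Let seps2 i : has_mean P (fun w => eps i.+1 w ^+ 2).
Proof. exact: (has_mean_eps2 filtF eps_adapted eps_var i). Qed.

(** [low i m] belongs to [F i] and on it the conditional moment is at most [m].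
    [exceed m] is the event that this fails in some round; its probability
    tends to 0, since the supremum of the conditional moments is almost surely
    finite. *)
Let low i (m : nat) : set T := [set w | (C i.+1 w <= m%:R%:E)%E].
Let exceed (m : nat) : set T := \bigcup_i ~` low i m.

Let F_low i m : F i (low i m).
Proof.
have [_ mC _] := eps_moment i.
have -> : low i m = C i.+1 @^-1` `]-oo, m%:R%:E]%classic.
  by apply/seteqP; split=> w /=; rewrite in_itv/=.
exact/mC/emeasurable_itv.
Qed.

Let mlow i m : measurable (low i m).
Proof. exact: (filt_sub filtF) (F_low i m). Qed.

Let mexceed m : measurable (exceed m).
Proof. by apply: bigcup_measurable => i _; exact: measurableC. Qed.

Let cvg_exceed : (P (exceed m))%E @[m --> \oo] --> 0%E.
Proof.
have -> : 0%E = P (\bigcap_m exceed m).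
  apply/esym; apply: measure_negligible; first exact: bigcap_measurable.
  have [N [mN PN sN]] := moment_bounded; exists N; split => //.
  move=> w Ew; apply: sN => /= sup_lt.
  have := ltry (0 : R); set S := ereal_sup _ in sup_lt => _.
  have CS i : (C i.+1 w <= S)%E by apply: ereal_sup_ubound; exists i.+1.
  have [m Sm] : exists m : nat, (S <= m%:R%:E)%E.
    case: S sup_lt {CS} => [r| |] // _.
      exists (Num.truncn r).+1; rewrite lee_fin ltW//.
      by have := truncnS_gt r.
    by exists 0%N; rewrite leNye.
  have [i _ /= Cm] := Ew m I.
  by apply: Cm; rewrite /low /= (le_trans (CS i)).
apply: nonincreasing_cvg_mu => //.
- by apply: le_lt_trans (probability_le1 P (@mexceed 0%N)) _; exact: ltry.
- exact: bigcap_measurable.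
- move=> m n mn; apply/subsetPset => w [i _ /= h]; exists i => // h'.
  by apply: h; rewrite /low /= (le_trans h')// lee_fin ler_nat.
Qed.

(** The moment of order 2 + Delta may be infinite without the restriction to
    [low i m], as the conditional moments are finite but not integrable in
    general. *)
Let has_mean_low i m :
  has_mean P (fun w => \1_(low i m) w * `|eps i.+1 w| `^ (2 + Delta)) /\
  (forall A, F i A ->
   mean P (fun w => \1_A w *
     (\1_(low i m) w * `|eps i.+1 w| `^ (2 + Delta) - m%:R)) <= 0).
Proof.
have me : measurable_fun [set: T] (fun w => `|eps i.+1 w| `^ (2 + Delta)).
  apply: (measurableT_comp (measurable_powR _)).
  by apply: measurableT_comp => //; exact: meps.
have [_ mC hC] := eps_moment i.
have mCT : measurable_fun [set: T] (C i.+1).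
  apply: (sub_measurable_fun (filt_sigma filtF i) (@filt_sub _ _ _ filtF i)).
  exact/(measurable_wrtP (filt_sigma filtF i)).
have bnd A : F i A -> (\int[P]_(w in A `&` low i m)
    (`|eps i.+1 w| `^ (2 + Delta))%:E <= m%:R%:E * P A)%E.
  move=> FA; have mA := filt_sub filtF FA.
  have mAl : measurable (A `&` low i m) by exact: measurableI.
  have FAl : F i (A `&` low i m).
    by apply/(sub_measurableP (filt_sigma filtF i)); apply: measurableI;
      apply/(sub_measurableP (filt_sigma filtF i)).
  have mAl' : measurable_fun (A `&` low i m) (C i.+1) by exact: measurable_funTS.
  rewrite -hC// integralE.
  apply: (@le_trans _ _ (\int[P]_(w in A `&` low i m) m%:R%:E)%E).
    apply: (@le_trans _ _ (\int[P]_(w in A `&` low i m) (C i.+1)^\+ w - 0)%E).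
      by apply: leeB => //; apply: integral_ge0.
    rewrite sube0; apply: ge0_le_integral => //.
    - exact: measurable_funepos.
    - by move=> w [_ lw]; rewrite funeposE ge_max lw lee_fin /=.
  rewrite integral_cst//; apply: lee_wpmul2l; rewrite ?lee_fin//.
  by apply: le_measure; [exact: mem_set|exact: mem_set|exact: subIsetl].
have sY : has_mean P (fun w => \1_(low i m) w * `|eps i.+1 w| `^ (2 + Delta)).
  apply/integrableP; split.
    apply/measurable_EFinP/measurable_funM => //.
  rewrite (_ : (\int[P]_w _)%E = (\int[P]_(w in setT `&` low i m)
    (`|eps i.+1 w| `^ (2 + Delta))%:E)%E); last first.
    rewrite setTI [RHS]integral_mkcond; apply: eq_integral => w _.
    rewrite /= /patch indicE; case: (w \in _).
      by rewrite mul1r ger0_norm// powR_ge0.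
    by rewrite mul0r normr0.
  rewrite (le_lt_trans (bnd _ (filt_setT filtF i)))//.
  rewrite lte_mul_pinfty ?lee_fin//.
  by rewrite (le_lt_trans (probability_le1 P measurableT))// ltry.
split=> // A FA; have mA := filt_sub filtF FA.
have sAY : has_mean P (fun w => \1_A w * (\1_(low i m) w * `|eps i.+1 w| `^ (2 + Delta))).
  apply: (@has_mean_mul_bounded _ _ _ _ 1) => //.
  by move=> w; rewrite indicE ger0_norm// lern1 leq_b1.
rewrite (_ : (fun w => _) = (fun w =>
   \1_A w * (\1_(low i m) w * `|eps i.+1 w| `^ (2 + Delta)) - m%:R * \1_A w)); last first.
  by apply/funext => w; rewrite mulrBr [_ * m%:R]mulrC.
rewrite meanB//; last by apply: has_meanZ; exact: has_mean_indic.
rewrite meanZ ?mean_indic//; last exact: has_mean_indic.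
rewrite subr_le0 -lee_fin EFinM EFin_mean// fineK ?fin_num_measure//.
apply: le_trans (bnd _ FA).
rewrite [leRHS]integral_mkcond le_eqVlt; apply/orP; left; apply/eqP.
apply: eq_integral => w _; rewrite /patch in_setI !indicE.
by case: (w \in A); case: (w \in low i m) => /=; rewrite ?mul1r ?mul0r// mulr0.
Qed.

(** Lindeberg's condition, with random predictable weights [g] of bounded total.
    On [low i m], eps^2 beyond the level M is at most M^(-Delta) times
    |eps|^(2+Delta), of conditional mean at most m M^(-Delta).  Off [low i m]
    the conditional mean of eps^2 is still sigma^2, and the total contribution
    is at most sigma^2 B P(exceed m).  First m, then M is chosen. *)
Lemma noise_tail (B eta : R) : 0 <= B -> 0 < eta -> exists2 M, 0 < M &
  forall n (g : nat -> T -> R), (forall i, mF i (g i.+1)) ->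
  (forall i w, 0 <= g i w) -> (forall w, \sum_(i < n) g i.+1 w <= B) ->
  \sum_(i < n) mean P (fun w => g i.+1 w *
     (if M < `|eps i.+1 w| then eps i.+1 w ^+ 2 else 0)) <= eta.
Proof.
move=> B0 eta0.
have [m Pm] : exists m, sigma ^+ 2 * B * fine (P (exceed m)) <= eta / 2.
  have : (fine (P (exceed m)))%R @[m --> \oo] --> (0 : R).
    by apply: fine_cvg; exact: cvg_exceed.
  have K0 : 0 < sigma ^+ 2 * B + 1 by rewrite ltr_wpDl// mulr_ge0// sqr_ge0.
  have e0 : 0 < eta / 2 / (sigma ^+ 2 * B + 1) by rewrite !divr_gt0.
  move=> /cvgrPdist_lt /(_ _ e0) [m _ /(_ m (leqnn m))] /=.
  rewrite sub0r normrN ger0_norm ?fine_ge0// ltr_pdivlMr// => h; exists m.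
  rewrite ltW// (le_lt_trans _ h)// mulrC.
  by rewrite ler_wpM2l ?fine_ge0// lerDl.
(* [x] is M^Delta, chosen so that B m / x <= eta / 2. *)
pose x : R := 2 * B * m%:R / eta + 1.
have x0 : 0 < x.
  by rewrite ltr_wpDl// divr_ge0 ?mulr_ge0// ltW.
exists (x `^ Delta^-1); first exact: powR_gt0.
set M := _ `^ _ => n g mg g0 gB.
have M0 : 0 < M by exact: powR_gt0.
have MD : M `^ Delta = x.
  by rewrite /M -powRrM mulVf ?gt_eqF// powRr1// ltW.
have gn i w : (i < n)%N -> g i.+1 w <= B.
  move=> ni; apply: le_trans (gB w).
  by rewrite (bigD1 (Ordinal ni))//= lerDl sumr_ge0.
have step i : (i < n)%N -> mean P (fun w => g i.+1 w *
     (if M < `|eps i.+1 w| then eps i.+1 w ^+ 2 else 0)) <=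
   m%:R / x * mean P (g i.+1) + sigma ^+ 2 * mean P (fun w => \1_(exceed m) w * g i.+1 w).
  move=> ni.
  have [sY hY] := has_mean_low i m; set Y := fun w => \1_(low i m) w * _ in sY hY.
  have gB1 w : `|g i.+1 w| <= B by rewrite ger0_norm// gn.
  have mgT := mF_measurable filtF (mg i).
  have sgi := has_mean_bounded P mgT gB1.
  have sgY : has_mean P (fun w => g i.+1 w * Y w) by exact: has_mean_mul_bounded gB1 sY.
  pose g' w := g i.+1 w * \1_(~` low i m) w.
  have mg' : mF i g'.
    apply: measurable_funM => //; apply: mF_indic => //.
    by apply/(sub_measurableP (filt_sigma filtF i)); apply: measurableC;
      apply/(sub_measurableP (filt_sigma filtF i)).
  have g'B w : `|g' w| <= B.
    rewrite normrM -[leRHS]mulr1 ler_pM// indicE ger0_norm// lern1.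
    exact: leq_b1.
  have sg' : has_mean P g' by apply: (has_mean_bounded P _ g'B); exact: mF_measurable mg'.
  have sg'e : has_mean P (fun w => g' w * eps i.+1 w ^+ 2).
    apply: (has_mean_mul_bounded _ g'B); first exact: mF_measurable mg'.
    exact: seps2.
  have mE : measurable (exceed m) by exact: mexceed.
  have sEg : has_mean P (fun w => \1_(exceed m) w * g i.+1 w).
    apply: (@has_mean_mul_bounded _ _ _ _ 1) => //.
    by move=> w; rewrite indicE ger0_norm// lern1 leq_b1.
  have h1 : mean P (fun w => g i.+1 w * Y w) <= m%:R * mean P (g i.+1).
    have : mean P (fun w => g i.+1 w * (Y w - m%:R)) <= 0.
      apply: (mean_pull_out_le (filt_sigma filtF i) (@filt_sub _ _ _ filtF i)) => //.
      - by apply: has_meanB => //; exact: has_mean_cst.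
      - apply: (has_mean_mul_bounded _ gB1) => //.
        by apply: has_meanB => //; exact: has_mean_cst.
    rewrite (_ : (fun w => _) = (fun w => g i.+1 w * Y w - m%:R * g i.+1 w)).
      by rewrite meanB ?meanZ ?subr_le0//; exact: has_meanZ.
    by apply/funext => w; rewrite mulrBr [_ * m%:R]mulrC.
  have h2 : mean P (fun w => g' w * eps i.+1 w ^+ 2) <=
      sigma ^+ 2 * mean P (fun w => \1_(exceed m) w * g i.+1 w).
    rewrite (mean_predictable_var filtF eps_adapted eps_var mg' g'B).
    rewrite ler_wpM2l ?sqr_ge0//; apply: le_mean => // w.
    rewrite /g' mulrC ler_wpM2r// !indicE ler_nat.
    case: (boolP (w \in ~` low i m)) => // /set_mem lw.
    by rewrite mem_set//; exists i.
  apply: (@le_trans _ _ (mean P (fun w => x^-1 * (g i.+1 w * Y w) + g' w * eps i.+1 w ^+ 2))).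
    apply: le_mean.
    - apply: (@has_mean_dom _ _ _ _ _ (fun w => B * eps i.+1 w ^+ 2)).
      + apply: measurable_funM => //; apply: measurable_fun_ifT => //.
        * apply: measurable_fun_ltr => //; apply: measurableT_comp => //.
        * by apply: measurable_funX; exact: meps.
      + by apply: has_meanZ; exact: seps2.
      + move=> w; rewrite normrM ler_pM//.
        by case: ifP => _; rewrite ?normr0 ?sqr_ge0// ger0_norm ?sqr_ge0.
    - by apply: has_meanD => //; exact: has_meanZ.
    - move=> w; rewrite /g' /Y mulrCA -mulrA -mulrDr ler_wpM2l// !indicE in_setC.
      case: (w \in low i m) => /=; last first.
        rewrite mul0r mulr0 add0r mul1r; case: ifP => //_; exact: sqr_ge0.
      rewrite mul1r mul0r addr0; case: ifPn => [Me|_]; last first.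
        by rewrite mulr_ge0 ?powR_ge0// invr_ge0 ltW.
      have e0 : 0 < `|eps i.+1 w| by exact: lt_trans Me.
      rewrite mulrC ler_pdivlMr// powRD; last by rewrite (gt_eqF e0) implybT.
      rewrite -[2 in X in _ <= X]/(2%:R) powR_mulrn// real_normK ?num_real//.
      rewrite ler_wpM2l ?sqr_ge0// -MD; apply: ge0_ler_powR; rewrite ?nnegrE ?ltW//.
  rewrite meanD//; last exact: has_meanZ.
  by rewrite meanZ// lerD// [m%:R / x]mulrC -mulrA ler_wpM2l// invr_ge0 ltW.
have sg i : (i < n)%N -> has_mean P (g i.+1).
  move=> ni; apply: (@has_mean_bounded _ _ _ _ B).
    exact: mF_measurable (mg i).
  by move=> w; rewrite ger0_norm// gn.
apply: (@le_trans _ _ (\sum_(i < n) (m%:R / x * mean P (g i.+1) +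
   sigma ^+ 2 * mean P (fun w => \1_(exceed m) w * g i.+1 w)))).
  by apply: ler_sum => i _; exact: step.
rewrite big_split /= -!mulr_sumr.
have mE : measurable (exceed m) by exact: mexceed.
have hB : \sum_(i < n) mean P (g i.+1) <= B.
  rewrite -(@mean_sum _ _ _ _ _ _ (fun i : 'I_n => g i.+1)) => [|i]; last exact: sg.
  rewrite -[leRHS](mean_cst P B); apply: le_mean => //; last exact: has_mean_cst.
  by apply: has_mean_sum => i; exact: sg.
have sEg i : (i < n)%N -> has_mean P (fun w => \1_(exceed m) w * g i.+1 w).
  move=> ni; apply: (@has_mean_mul_bounded _ _ _ _ 1) => //; last exact: sg.
  by move=> w; rewrite indicE ger0_norm// lern1 leq_b1.
have hE : \sum_(i < n) mean P (fun w => \1_(exceed m) w * g i.+1 w) <=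
    B * fine (P (exceed m)).
  rewrite -(@mean_sum _ _ _ _ _ _
    (fun (i : 'I_n) w => \1_(exceed m) w * g i.+1 w)) => [|i]; last exact: sEg.
  rewrite -mean_indic// -meanZ; last exact: has_mean_indic.
  apply: le_mean; first by apply: has_mean_sum => i; exact: sEg.
    by apply: has_meanZ; exact: has_mean_indic.
  by move=> w; rewrite -mulr_sumr mulrC ler_wpM2r.
have h1 : m%:R / x * \sum_(i < n) mean P (g i.+1) <= eta / 2.
  apply: (@le_trans _ _ (m%:R / x * B)).
    by rewrite ler_wpM2l// divr_ge0// ltW.
  rewrite mulrAC ler_pdivrMr// /x mulrDr mulr1.
  have -> : eta / 2 * (2 * B * m%:R / eta) = m%:R * B by field; rewrite gt_eqF.
  by rewrite lerDl divr_ge0// ltW.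
have h2 : sigma ^+ 2 * \sum_(i < n) mean P (fun w => \1_(exceed m) w * g i.+1 w) <= eta / 2.
  by apply: le_trans Pm; rewrite -mulrA ler_wpM2l// sqr_ge0.
lra.
Qed.
End noise_tail.

(** * One step of Lindeberg's method *)

Section measurability.
Context {R : realType}.

Lemma measurable_invsqrt : measurable_fun [set: R] (fun x : R => (Num.sqrt x)^-1).
Proof.
rewrite (_ : (fun x => _) = (fun x : R => Num.sqrt x `^ (-1))).
  apply: (measurableT_comp (measurable_powR _)).
  by apply: continuous_measurable_fun; exact: sqrt_continuous.
by apply/funext => x; rewrite powR_inv1// sqrtr_ge0.
Qed.

Lemma measurable_ncdf : measurable_fun [set: R] (@ncdf R).
Proof. by apply: continuous_measurable_fun; exact: ncdf_continuous. Qed.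

Lemma measurable_npdf : measurable_fun [set: R] (@npdf R).
Proof. exact: measurable_normal_pdf. Qed.

Lemma sum_pred1_mul (I : finType) (a : I) (f : I -> R) :
  \sum_b (a == b)%:R * f b = f a.
Proof.
rewrite (bigD1 a)//= eqxx mul1r big1 ?addr0// => b.
by rewrite eq_sym => /negbTE ->; rewrite mul0r.
Qed.

End measurability.

Section lindeberg.
Context {disp : measure_display} {T : measurableType disp} {R : realType}.
Variables (P : probability T R) (F : nat -> set (set T)).
Hypothesis filtF : filtration F.
Notation mF i f :=
  (measurable_fun [set: g_sigma_algebraType (F i)]
     (f : g_sigma_algebraType (F i) -> R)).
Variables (eps : nat -> T -> R) (sigma : R).
Hypothesis eps_adapted : forall i, measurable_wrt (F i.+1) (eps i.+1).
Hypothesis eps_mean : forall i,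
  is_cond_exp P (F i) (fun w => (eps i.+1 w)%:E) (cst 0%:E).
Hypothesis eps_var : forall i,
  is_cond_exp P (F i) (fun w => (eps i.+1 w ^+ 2)%:E) (cst (sigma ^+ 2)%:E).

Variables (d : nat) (k : nat -> T -> 'I_d).
Hypothesis k_predictable : forall i a, F i [set w | k i.+1 w = a].

Variables (c : nat -> T -> R) (delta : R).
Hypothesis c_predictable : forall i, mF i (c i.+1).
Hypothesis c_bounded : forall i w, `|c i w| <= delta.

Definition arm_coef (a : 'I_d) i w : R := (k i w == a)%:R * c i w.

Definition arm_sum (a : 'I_d) : nat -> T -> R := transform eps (arm_coef a).

(** The conditional variance not used in the first [n] rounds, out of a total
    of 1. *)
Definition arm_left (a : 'I_d) (n : nat) (w : T) : R :=
  1 - sigma ^+ 2 * \sum_(i < n) arm_coef a i.+1 w ^+ 2.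

Lemma mF_arm i a : mF i (fun w => (k i.+1 w == a)%:R).
Proof.
rewrite (_ : (fun w => _) = \1_[set w | k i.+1 w = a]).
  exact: mF_indic.
apply/funext => w; rewrite indicE; congr (nat_of_bool _)%:R.
by apply/eqP/idP => [h|/set_mem//]; exact/mem_set.
Qed.

Lemma mF_arm_coef a i : mF i (arm_coef a i.+1).
Proof. by apply: measurable_funM; [exact: mF_arm|exact: c_predictable]. Qed.

Lemma arm_coef_bounded a i w : `|arm_coef a i w| <= delta.
Proof.
rewrite normrM; case: eqP => _; rewrite ?normr0 ?normr1 ?mul1r// mul0r.
by rewrite (le_trans _ (c_bounded i w)).
Qed.

Lemma mF_arm_sum a i : mF i (arm_sum a i).
Proof. by apply: mF_transform => //; exact: mF_arm_coef. Qed.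

Lemma mF_arm_leftS a i : mF i (arm_left a i.+1).
Proof.
apply: measurable_funB => //; apply: measurable_funM => //.
apply: measurable_sum => j; apply: measurable_funX.
have ji : (j <= i)%N by rewrite -ltnS.
exact: (mF_mono filtF ji (@mF_arm_coef a j)).
Qed.

Lemma mF_arm_left a i : mF i (arm_left a i).
Proof.
case: i => [|i]; last exact: (mF_mono filtF (leqnSn i) (@mF_arm_leftS a i)).
rewrite (_ : arm_left a 0 = fun=> 1)//.
by apply/funext => w; rewrite /arm_left big_ord0 mulr0 subr0.
Qed.

Variable n : nat.
Hypothesis left_ge0 : forall a w, 0 <= arm_left a n w.

Let left0 a i w : (i <= n)%N -> 0 <= arm_left a i w.
Proof.
move=> i_n; apply: le_trans (left_ge0 a w) _.
rewrite lerD2l lerN2 ler_wpM2l ?sqr_ge0//.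
rewrite -(big_mkord xpredT (fun j => arm_coef a j.+1 w ^+ 2)).
rewrite -(big_mkord xpredT (fun j => arm_coef a j.+1 w ^+ 2)).
rewrite (big_cat_nat _ i_n)//= lerDl sumr_ge0// => j _.
exact: sqr_ge0.
Qed.

Variables (t : 'I_d -> R) (s : R).
Hypothesis s0 : 0 < s.

(** Conditionally on the past, the final sum of the arm would be normal with mean
    [arm_sum] and variance [arm_left] if the remaining noise were Gaussian; this
    is the probability that it then stays below [t a], after smoothing by an
    independent normal variable of variance [s ^+ 2]. The smoothing keeps the
    derivatives bounded when no variance is left. *)
Definition factor (a : 'I_d) i w : R :=
  ncdf ((t a - arm_sum a i w) / Num.sqrt (s ^+ 2 + arm_left a i w)).

Definition test_fun i w : R := \prod_a factor a i w.

Lemma mF_factor a i : mF i (factor a i).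
Proof.
apply: (measurableT_comp measurable_ncdf); apply: measurable_funM.
  by apply: measurable_funB => //; exact: mF_arm_sum.
apply: (measurableT_comp measurable_invsqrt); apply: measurable_funD => //.
exact: mF_arm_left.
Qed.

Lemma mF_test_fun i : mF i (test_fun i).
Proof. by apply: measurable_prod => a _; exact: mF_factor. Qed.

Lemma test_fun_ge0 i w : 0 <= test_fun i w.
Proof. by apply: prodr_ge0 => a _; exact: ncdf_ge0. Qed.

Lemma test_fun_le1 i w : test_fun i w <= 1.
Proof. by apply: prodr_ile1 => a _; rewrite ncdf_ge0 ncdf_le1. Qed.

Lemma has_mean_test_fun i : has_mean P (test_fun i).
Proof.
apply: (@has_mean_bounded _ _ _ _ 1).
  exact: (mF_measurable filtF (mF_test_fun (i := i))).
by move=> w; rewrite ger0_norm ?test_fun_ge0// test_fun_le1.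
Qed.

Variable K : R.
Hypothesis K0 : 0 <= K.
Hypothesis HK : forall q v x D, s ^+ 2 <= q -> 0 <= v ->
  `|ncdf ((x + D) / Num.sqrt q) - ncdf (x / Num.sqrt (q + v))
    - npdf (x / Num.sqrt q) / Num.sqrt q * D
    - - (x / Num.sqrt q) * npdf (x / Num.sqrt q) / (2 * q) * (D ^+ 2 - v)|
  <= K * (Num.min (D ^+ 2) (`|D| ^+ 3) + v ^+ 2).

(** The main part of the heat expansion is G1 eps + G2 (eps^2 - sigma^2) with G1
    and G2 bounded and [F i]-measurable, and its mean is 0.  The measurability
    of G2 rests on the fact that the variance to come after round i + 1 is
    already known after round i. *)
Lemma lindeberg_step i : (i < n)%N ->
  `|mean P (test_fun i.+1) - mean P (test_fun i)| <=
  K * (mean P (fun w => Num.min ((c i.+1 w * eps i.+1 w) ^+ 2)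
                                (`|c i.+1 w * eps i.+1 w| ^+ 3)) +
       mean P (fun w => (sigma ^+ 2 * c i.+1 w ^+ 2) ^+ 2)).
Proof.
move=> i_n.
pose q a w := s ^+ 2 + arm_left a i.+1 w.
pose y a w := (t a - arm_sum a i w) / Num.sqrt (q a w).
pose A a w := - npdf (y a w) / Num.sqrt (q a w).
pose B a w := - y a w * npdf (y a w) / (2 * q a w).
pose Q a w := \prod_(b | b != a) factor b i w.
have qs a w : s ^+ 2 <= q a w by rewrite lerDl left0.
have q0 a w : 0 < q a w by apply: lt_le_trans (qs a w); rewrite exprn_gt0.
have sqs a w : s <= Num.sqrt (q a w).
  by rewrite -[s]gtr0_norm// -sqrtr_sqr ler_wsqrtr.
have mq a : mF i (q a) by apply: measurable_funD => //; exact: mF_arm_leftS.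
have misq a : mF i (fun w => (Num.sqrt (q a w))^-1).
  exact: (measurableT_comp measurable_invsqrt).
have my a : mF i (y a).
  apply: measurable_funM => //.
  by apply: measurable_funB => //; exact: mF_arm_sum.
have mphi a : mF i (fun w => npdf (y a w)).
  exact: (measurableT_comp measurable_npdf).
have mA a : mF i (A a).
  by apply: measurable_funM => //; exact: measurableT_comp.
have mB a : mF i (B a).
  rewrite (_ : B a = fun w => - y a w * npdf (y a w) *
    (2^-1 * ((Num.sqrt (q a w))^-1 * (Num.sqrt (q a w))^-1))).
    apply: measurable_funM; last first.
      by apply: measurable_funM => //; exact: measurable_funM.
    by apply: measurable_funM => //; exact: measurableT_comp.
  apply/funext => w; rewrite /B -[in LHS](sqr_sqrtr (ltW (q0 a w))).
  by rewrite expr2 !invfM.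
have mQ a : mF i (Q a).
  rewrite (_ : Q a = fun w => \prod_(b <- [seq b <- index_enum 'I_d | b != a]) factor b i w).
    by apply: measurable_prod => b _; exact: mF_factor.
  by apply/funext => w; rewrite big_filter.
have Q0 a w : 0 <= Q a w by apply: prodr_ge0 => b _; exact: ncdf_ge0.
have Q1 a w : Q a w <= 1.
  by apply: prodr_ile1 => b _; rewrite ncdf_ge0 ncdf_le1.
pose p : R := normal_peak 1.
have p0 : 0 <= p by exact: normal_peak_ge0.
have npB z : npdf z <= p by apply: normal_pdf_ub; rewrite oner_eq0.
have Abound a w : `|Q a w * A a w| <= p / s.
  rewrite normrM -[leRHS]mul1r ler_pM// ?(ger0_norm (Q0 a w))//.
  rewrite normrM normrN ger0_norm ?npdf_ge0// ler_pM ?npdf_ge0 ?npB//.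
    by rewrite ger0_norm ?npdf_ge0.
  rewrite lef_pV2 ?posrE//.
  exact: lt_le_trans (sqs a w).
have Bbound a w : `|Q a w * B a w| <= 7 * p / s ^+ 2.
  rewrite normrM -[leRHS]mul1r ler_pM// ?(ger0_norm (Q0 a w))//.
  rewrite /B normrM ler_pM// ?npdf1_bounded//.
  rewrite ger0_norm ?invr_ge0 ?mulr_ge0 ?(ltW (q0 a w))//.
  rewrite lef_pV2 ?posrE ?mulr_gt0 ?exprn_gt0//.
  by have := qs a w; have := q0 a w; lra.
pose G1 w := \sum_a arm_coef a i.+1 w * (Q a w * A a w).
pose G2 w := \sum_a arm_coef a i.+1 w ^+ 2 * (Q a w * B a w).
have mG1 : mF i G1.
  apply: measurable_sum => a; apply: measurable_funM; first exact: mF_arm_coef.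
  exact: measurable_funM.
have mG2 : mF i G2.
  apply: measurable_sum => a; apply: measurable_funM; last exact: measurable_funM.
  by apply: measurable_funX; exact: mF_arm_coef.
have bG1 w : `|G1 w| <= \sum_(a : 'I_d) delta * (p / s).
  rewrite (le_trans (ler_norm_sum _ _ _))//; apply: ler_sum => a _.
  by rewrite normrM ler_pM// arm_coef_bounded.
have bG2 w : `|G2 w| <= \sum_(a : 'I_d) delta ^+ 2 * (7 * p / s ^+ 2).
  rewrite (le_trans (ler_norm_sum _ _ _))//; apply: ler_sum => a _.
  rewrite normrM ler_pM// normrX lerXn2r ?nnegrE//.
    by rewrite (le_trans _ (c_bounded 0 w)).
  exact: arm_coef_bounded.
pose D w := c i.+1 w * eps i.+1 w.
pose v w := sigma ^+ 2 * c i.+1 w ^+ 2.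
pose M w := Num.min (D w ^+ 2) (`|D w| ^+ 3).
(* Only the factor of the arm that is pulled changes in the round. *)
pose Rem w := test_fun i.+1 w - test_fun i w - G1 w * eps i.+1 w
  - G2 w * (eps i.+1 w ^+ 2 - sigma ^+ 2).
have RemB w : `|Rem w| <= K * (M w + v w ^+ 2).
  pose a := k i.+1 w.
  have G1E : G1 w = c i.+1 w * (Q a w * A a w).
    rewrite /G1 -(sum_pred1_mul a (fun a => c i.+1 w * (Q a w * A a w))).
    by apply: eq_bigr => b _; rewrite /arm_coef -mulrA.
  have G2E : G2 w = c i.+1 w ^+ 2 * (Q a w * B a w).
    rewrite /G2 -(sum_pred1_mul a (fun a => c i.+1 w ^+ 2 * (Q a w * B a w))).
    apply: eq_bigr => b _; rewrite /arm_coef exprMn -mulrA /a.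
    by case: (k i.+1 w == b); rewrite ?expr1n// expr0n /= !mul0r.
  have ca : arm_coef a i.+1 w = c i.+1 w by rewrite /arm_coef eqxx mul1r.
  have fb b : b != a -> factor b i.+1 w = factor b i w.
    move=> ba; have cb : arm_coef b i.+1 w = 0.
      by rewrite /arm_coef eq_sym (negbTE ba) mul0r.
    rewrite /factor /arm_sum transformS /arm_left big_ord_recr /= cb.
    by rewrite mul0r addr0 expr0n addr0.
  have Q' : \prod_(b | b != a) factor b i.+1 w = Q a w.
    by apply: eq_bigr => b; exact: fb.
  have qv : s ^+ 2 + arm_left a i w = q a w + v w.
    by rewrite /q /v /arm_left big_ord_recr /= ca; ring.
  have fa : factor a i w = ncdf ((t a - arm_sum a i w) / Num.sqrt (q a w + v w)).
    by rewrite /factor qv.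
  have fa' : factor a i.+1 w =
      ncdf ((t a - arm_sum a i w + - D w) / Num.sqrt (q a w)).
    by rewrite /factor /arm_sum transformS ca opprD addrA.
  have v0 : 0 <= v w by rewrite mulr_ge0 ?sqr_ge0.
  have := @HK (q a w) (v w) (t a - arm_sum a i w) (- D w) (qs a w) v0.
  rewrite -fa -fa' -/(y a w) sqrrN normrN -/(M w).
  set Z := (X in `|X| <= _) => hZ.
  have -> : Rem w = Q a w * Z.
    rewrite /Rem /test_fun (bigD1 a)//= Q' [X in _ - X - _ - _](bigD1 a)//=.
    rewrite -/(Q a w) G1E G2E /Z /A /B /D /v; ring.
  rewrite normrM ger0_norm// -[leRHS]mul1r.
  by apply: ler_pM.
have mD : measurable_fun [set: T] D.
  apply: measurable_funM; first exact: (mF_measurable filtF (c_predictable (i := i))).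
  exact: (eps_measurable filtF eps_adapted i).
have mc : measurable_fun [set: T] (c i.+1).
  exact: (mF_measurable filtF (c_predictable (i := i))).
have d0 : 0 <= delta.
  by apply: le_trans (c_bounded 0 point).
have sD2 : has_mean P (fun w => D w ^+ 2).
  apply: (@has_mean_dom _ _ _ _ _ (fun w => delta ^+ 2 * eps i.+1 w ^+ 2)).
  - exact: measurable_funX.
  - by apply: has_meanZ; exact: (has_mean_eps2 filtF eps_adapted eps_var i).
  - move=> w; rewrite exprMn normrM !normrX ler_pM//.
      by rewrite lerXn2r ?nnegrE.
    by rewrite -normrX ger0_norm ?sqr_ge0.
have sM : has_mean P M.
  apply: (@has_mean_dom _ _ _ _ _ (fun w => D w ^+ 2)) => //.
    apply: measurable_minr; first exact: measurable_funX.
    by apply: measurable_funX; exact: measurableT_comp.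
  move=> w; rewrite ger0_norm ?ge_min ?lexx//.
  by rewrite le_min sqr_ge0 exprn_ge0.
have sv : has_mean P (fun w => v w ^+ 2).
  apply: (@has_mean_bounded _ _ _ _ ((sigma ^+ 2 * delta ^+ 2) ^+ 2)).
    by apply: measurable_funX; apply: measurable_funM => //; exact: measurable_funX.
  move=> w; have vd : v w <= sigma ^+ 2 * delta ^+ 2.
    rewrite ler_wpM2l ?sqr_ge0// -[_ ^+ 2]real_normK ?num_real//.
    by rewrite lerXn2r ?nnegrE.
  have v0 : 0 <= v w by rewrite mulr_ge0 ?sqr_ge0.
  by rewrite ger0_norm ?sqr_ge0// lerXn2r ?nnegrE// (le_trans v0).
have sG1 : has_mean P (fun w => G1 w * eps i.+1 w).
  apply: (has_mean_mul_bounded _ bG1); first exact: (mF_measurable filtF mG1).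
  exact: (has_mean_eps filtF eps_adapted eps_var i).
have sG2 : has_mean P (fun w => G2 w * (eps i.+1 w ^+ 2 - sigma ^+ 2)).
  apply: (has_mean_mul_bounded _ bG2); first exact: (mF_measurable filtF mG2).
  apply: has_meanB; last exact: has_mean_cst.
  exact: (has_mean_eps2 filtF eps_adapted eps_var i).
have st j := has_mean_test_fun j.
have sRem : has_mean P Rem by do 3! apply: has_meanB => //.
have -> : mean P (test_fun i.+1) - mean P (test_fun i) = mean P Rem.
  rewrite /Rem meanB//; last by do 2! apply: has_meanB => //.
  rewrite meanB//; last by apply: has_meanB => //.
  rewrite meanB//.
  rewrite (mean_predictable_eps filtF eps_adapted eps_mean eps_var mG1 sG1).
  by rewrite (mean_predictable_eps2 filtF eps_adapted eps_var mG2 bG2) !subr0.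
rewrite (le_trans (norm_mean sRem))// -meanD// -meanZ//; last exact: has_meanD.
apply: le_mean => //; first exact: integrable_norm.
by apply: has_meanZ; exact: has_meanD.
Qed.

Let d0 : 0 <= delta.
Proof. exact: le_trans (c_bounded 0 point). Qed.

Let meps i : measurable_fun [set: T] (eps i.+1).
Proof. exact: (eps_measurable filtF eps_adapted i). Qed.

Let mc i : measurable_fun [set: T] (c i.+1).
Proof. exact: (mF_measurable filtF (c_predictable (i := i))). Qed.

Hypothesis sigma0 : 0 < sigma.

Lemma sum_coef_sqr w : \sum_(i < n) c i.+1 w ^+ 2 <= d%:R / sigma ^+ 2.
Proof.
rewrite ler_pdivlMr ?exprn_gt0// mulrC.
rewrite (_ : \sum_(i < n) _ = \sum_(i < n) \sum_a arm_coef a i.+1 w ^+ 2).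
  rewrite exchange_big mulr_sumr /= -[d in d%:R]card_ord -sumr_const.
  apply: ler_sum => a _; have := left_ge0 a w.
  by rewrite /arm_left subr_ge0.
apply: eq_bigr => i _; rewrite -(sum_pred1_mul (k i.+1 w) (fun=> c i.+1 w ^+ 2)).
apply: eq_bigr => a _; rewrite /arm_coef exprMn.
by case: (k i.+1 w == a); rewrite ?expr1n// expr0n /= !mul0r.
Qed.

Let csq i w : c i w ^+ 2 <= delta ^+ 2.
Proof. by rewrite -[_ ^+ 2]real_normK ?num_real// lerXn2r ?nnegrE. Qed.

Let has_mean_c2 i : has_mean P (fun w => c i.+1 w ^+ 2).
Proof.
apply: (@has_mean_bounded _ _ _ _ (delta ^+ 2)); first exact: measurable_funX.
by move=> w; rewrite ger0_norm ?sqr_ge0.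
Qed.

Let sum_mean_c2 : sigma ^+ 2 * \sum_(i < n) mean P (fun w => c i.+1 w ^+ 2) <= d%:R.
Proof.
rewrite -(@mean_sum _ _ _ _ _ _
  (fun i : 'I_n => fun w => c i.+1 w ^+ 2)) => [|i]; last exact: has_mean_c2.
rewrite mulrC -ler_pdivlMr ?exprn_gt0// -[leRHS](mean_cst P).
apply: le_mean; [|exact: has_mean_cst|exact: sum_coef_sqr].
by apply: has_mean_sum => i; exact: has_mean_c2.
Qed.

Variables (M eta : R).
Hypothesis M0 : 0 < M.
Hypothesis tail : \sum_(i < n) mean P (fun w => c i.+1 w ^+ 2 *
     (if M < `|eps i.+1 w| then eps i.+1 w ^+ 2 else 0)) <= eta.

(** At time 0 the test function is the constant product of normal distribution
    functions.  In each round the cubic bound is used when |eps| <= M, at the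
    price delta M c^2 eps^2, and the quadratic bound otherwise; the squared
    coefficients add up to at most d / sigma^2, since each arm uses a variance
    of at most 1. *)
Lemma lindeberg_bound :
  `|mean P (test_fun n) - \prod_a ncdf (t a / Num.sqrt (s ^+ 2 + 1))| <=
  K * (eta + d%:R * (delta * M + sigma ^+ 2 * delta ^+ 2)).
Proof.
have -> : \prod_a ncdf (t a / Num.sqrt (s ^+ 2 + 1)) = mean P (test_fun 0).
  rewrite -[LHS](mean_cst P); congr mean; apply/funext => w.
  apply: eq_bigr => a _; rewrite /factor /arm_sum /transform /arm_left.
  by rewrite !big_ord0 mulr0 !subr0.
have -> : mean P (test_fun n) - mean P (test_fun 0) =
    \sum_(i < n) (mean P (test_fun i.+1) - mean P (test_fun i)).
  rewrite -(big_mkord xpredT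
    (fun i => mean P (test_fun i.+1) - mean P (test_fun i))).
  by rewrite telescope_sumr.
pose tl i w := c i.+1 w ^+ 2 * (if M < `|eps i.+1 w| then eps i.+1 w ^+ 2 else 0).
have stl i : has_mean P (tl i).
  apply: (@has_mean_mul_bounded _ _ _ _ (delta ^+ 2)).
  - exact: measurable_funX.
  - by move=> w; rewrite ger0_norm ?sqr_ge0.
  - apply: (@has_mean_dom _ _ _ _ _ (fun w => eps i.+1 w ^+ 2)).
    + apply: measurable_fun_ifT => //; last exact: measurable_funX.
      by apply: measurable_fun_ltr => //; exact: measurableT_comp.
    + exact: (has_mean_eps2 filtF eps_adapted eps_var i).
    + by move=> w; case: ifP => _; rewrite ?normr0 ?sqr_ge0// ger0_norm ?sqr_ge0.
have m1 i : mean P (fun w => Num.min ((c i.+1 w * eps i.+1 w) ^+ 2)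
      (`|c i.+1 w * eps i.+1 w| ^+ 3)) <=
    delta * M * (sigma ^+ 2 * mean P (fun w => c i.+1 w ^+ 2)) + mean P (tl i).
  have mc2 : mF i (fun w => c i.+1 w ^+ 2) by exact: measurable_funX.
  have bc2 w : `|c i.+1 w ^+ 2| <= delta ^+ 2 by rewrite ger0_norm ?sqr_ge0.
  have sce : has_mean P (fun w => c i.+1 w ^+ 2 * eps i.+1 w ^+ 2).
    apply: (has_mean_mul_bounded _ bc2); first exact: measurable_funX.
    exact: (has_mean_eps2 filtF eps_adapted eps_var i).
  rewrite -(mean_predictable_var filtF eps_adapted eps_var mc2 bc2).
  rewrite -meanZ// -meanD//; last exact: has_meanZ.
  have mD : measurable_fun [set: T] (fun w => c i.+1 w * eps i.+1 w) by exact: measurable_funM.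
  have pw w : Num.min ((c i.+1 w * eps i.+1 w) ^+ 2)
      (`|c i.+1 w * eps i.+1 w| ^+ 3) <=
      delta * M * (c i.+1 w ^+ 2 * eps i.+1 w ^+ 2) + tl i w.
    have dM : 0 <= delta * M by rewrite mulr_ge0// ltW.
    rewrite /tl ge_min -exprMn; case: ltP => Me; [apply/orP; left|apply/orP; right].
      by rewrite -exprMn lerDr mulr_ge0 ?sqr_ge0.
    rewrite mulr0 addr0 exprS real_normK ?num_real//.
    by rewrite ler_wpM2r ?sqr_ge0// normrM ler_pM.
  apply: le_mean => //; last by apply: has_meanD => //; exact: has_meanZ.
  apply: (@has_mean_dom _ _ _ _ _
    (fun w => delta * M * (c i.+1 w ^+ 2 * eps i.+1 w ^+ 2) + tl i w)).
  - apply: measurable_minr; first exact: measurable_funX.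
    by apply: measurable_funX; exact: measurableT_comp.
  - by apply: has_meanD => //; exact: has_meanZ.
  - by move=> w; rewrite ger0_norm// le_min sqr_ge0 exprn_ge0.
have m2 i : mean P (fun w => (sigma ^+ 2 * c i.+1 w ^+ 2) ^+ 2) <=
    sigma ^+ 2 * delta ^+ 2 * (sigma ^+ 2 * mean P (fun w => c i.+1 w ^+ 2)).
  rewrite -meanZ// -meanZ; last exact: has_meanZ.
  have pw w : (sigma ^+ 2 * c i.+1 w ^+ 2) ^+ 2 <=
      sigma ^+ 2 * delta ^+ 2 * (sigma ^+ 2 * c i.+1 w ^+ 2).
    have c0 : 0 <= sigma ^+ 2 * c i.+1 w ^+ 2 by rewrite mulr_ge0 ?sqr_ge0.
    by rewrite [leLHS]expr2 ler_wpM2r// ler_wpM2l ?sqr_ge0.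
  apply: le_mean => //; last by do 2! apply: has_meanZ.
  apply: (@has_mean_dom _ _ _ _ _
    (fun w => sigma ^+ 2 * delta ^+ 2 * (sigma ^+ 2 * c i.+1 w ^+ 2))).
  - by apply: measurable_funX; apply: measurable_funM => //; exact: measurable_funX.
  - by do 2! apply: has_meanZ.
  - by move=> w; rewrite ger0_norm ?sqr_ge0.
rewrite (le_trans (ler_norm_sum _ _ _))//.
apply: (@le_trans _ _ (\sum_(i < n) K * ((delta * M + sigma ^+ 2 * delta ^+ 2) *
   (sigma ^+ 2 * mean P (fun w => c i.+1 w ^+ 2)) + mean P (tl i)))).
  apply: ler_sum => i _; rewrite (le_trans (lindeberg_step (ltn_ord i)))//.
  by rewrite ler_wpM2l// mulrDl addrAC lerD.
rewrite -mulr_sumr ler_wpM2l// big_split /= addrC lerD// -!mulr_sumr mulrC.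
have dM : 0 <= delta * M by rewrite mulr_ge0// ltW.
have sd : 0 <= sigma ^+ 2 * delta ^+ 2 by rewrite mulr_ge0 ?sqr_ge0.
by rewrite ler_wpM2r// addr_ge0.
Qed.

End lindeberg.

(** * From the test function to probabilities of boxes *)

Lemma measurable_forall {disp} {T : measurableType disp} (I : finType)
    (A : I -> set T) :
  (forall i, measurable (A i)) -> measurable [set w | forall i, A i w].
Proof.
move=> mA; have -> : [set w | forall i, A i w] = \bigcap_(i in [set: I]) A i.
  by apply/seteqP; split=> w /= h i *; exact: h.
by apply: fin_bigcap_measurable => // i _; exact: mA.
Qed.

Lemma measurable_exists {disp} {T : measurableType disp} (I : finType)
    (A : I -> set T) :
  (forall i, measurable (A i)) -> measurable [set w | exists i, A i w].
Proof.
move=> mA; have -> : [set w | exists i, A i w] = \bigcup_(i in [set: I]) A i.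
  by apply/seteqP; split=> w /= [i]; [exists i|move=> _; exists i].
by apply: fin_bigcup_measurable => // i _; exact: mA.
Qed.

Section clt.
Context {disp : measure_display} {T : measurableType disp} {R : realType}.
Variables (P : probability T R) (F : nat -> set (set T)).
Hypothesis filtF : filtration F.
Notation mF i f :=
  (measurable_fun [set: g_sigma_algebraType (F i)]
     (f : g_sigma_algebraType (F i) -> R)).
Variables (eps : nat -> T -> R) (sigma Delta : R) (C : nat -> T -> \bar R).
Hypothesis eps_adapted : forall i, measurable_wrt (F i.+1) (eps i.+1).
Hypothesis eps_mean : forall i,
  is_cond_exp P (F i) (fun w => (eps i.+1 w)%:E) (cst 0%:E).
Hypothesis eps_var : forall i,
  is_cond_exp P (F i) (fun w => (eps i.+1 w ^+ 2)%:E) (cst (sigma ^+ 2)%:E).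
Hypothesis sigma0 : 0 < sigma.
Hypothesis Delta0 : 0 < Delta.
Hypothesis eps_moment : forall i,
  is_cond_exp P (F i) (fun w => (`|eps i.+1 w| `^ (2 + Delta))%:E) (C i.+1).
Hypothesis moment_bounded : {ae P, forall w,
  (ereal_sup [set C i w | i in [set i | (1 <= i)%N]] < +oo)%E}.
Variables (d : nat) (k : nat -> T -> 'I_d).
Hypothesis k_predictable : forall i a, F i [set w | k i.+1 w = a].

(** Uniform over the coefficients, with a threshold depending on their supremum
    only, because in the application the coefficients change with [n]. *)
Lemma uniform_clt (s eta : R) : 0 < s -> 0 < eta ->
  exists2 delta0 : R, 0 < delta0 & forall n c (delta : R) (t : 'I_d -> R),
    (forall i, mF i (c i.+1)) -> (forall i w, `|c i w| <= delta) ->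
    delta <= delta0 -> (forall a w, 0 <= arm_left sigma k c a n w) ->
    `|mean P (test_fun eps sigma k c t s n) -
      \prod_a ncdf (t a / Num.sqrt (s ^+ 2 + 1))| <= eta.
Proof.
move=> s0 eta0; have [K K0 HK] := ncdf_heat_expansion s0.
have K1 : 0 < K + 1 by rewrite ltr_wpDl.
have e3 : 0 < eta / 3 / (K + 1) by rewrite !divr_gt0.
have B0 : 0 <= d%:R / sigma ^+ 2 by rewrite divr_ge0// sqr_ge0.
have [M M0 HM] := noise_tail filtF eps_adapted eps_var Delta0 eps_moment
  moment_bounded B0 e3.
have s2 : 0 <= sigma ^+ 2 by exact: sqr_ge0.
pose Z : R := (d%:R + 1) * (M + sigma ^+ 2).
have Z0 : 0 < Z by apply: mulr_gt0; [rewrite ltr_wpDl|rewrite ltr_wpDr].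
exists (Num.min 1 (eta / 3 / (K + 1) / Z)).
  by rewrite lt_min ltr01 divr_gt0.
move=> n c delta t mc bc; rewrite le_min => /andP[d1 dZ] left0.
have d0 : 0 <= delta by apply: le_trans (bc 0%N point).
have tail := HM n (fun i w => c i w ^+ 2) _ _ _.
have {}tail : \sum_(i < n) mean P (fun w => c i.+1 w ^+ 2 *
    (if M < `|eps i.+1 w| then eps i.+1 w ^+ 2 else 0)) <= eta / 3 / (K + 1).
  apply: tail => [i|i w|w]; [exact: measurable_funX|exact: sqr_ge0|].
  exact: (sum_coef_sqr left0 sigma0).
have := lindeberg_bound filtF eps_adapted eps_mean eps_var k_predictable
  mc bc left0 t s0 K0 HK sigma0 M0 tail.
move=> /le_trans; apply.
have h1 : d%:R * (delta * M + sigma ^+ 2 * delta ^+ 2) <= delta * Z.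
  have -> : delta * Z = (d%:R + 1) * (delta * M + sigma ^+ 2 * delta).
    by rewrite /Z; ring.
  have h2 : delta ^+ 2 <= delta by rewrite expr2 ler_piMl.
  have h3 : sigma ^+ 2 * delta ^+ 2 <= sigma ^+ 2 * delta by rewrite ler_wpM2l.
  have h4 : 0 <= delta * M by rewrite mulr_ge0// ltW.
  have h5 : 0 <= sigma ^+ 2 * delta ^+ 2 by rewrite mulr_ge0// sqr_ge0.
  apply: ler_pM => //; [exact: addr_ge0|by rewrite lerDl|by rewrite lerD2l].
have h2 : delta * Z <= eta / 3 / (K + 1) by rewrite -ler_pdivlMr.
apply: (@le_trans _ _ (K * (eta / 3 / (K + 1) + eta / 3 / (K + 1)))).
  by rewrite ler_wpM2l// lerD2l (le_trans h1).
apply: (@le_trans _ _ ((K + 1) * (eta / 3 / (K + 1) + eta / 3 / (K + 1)))).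
  by rewrite ler_wpM2r ?addr_ge0 ?(ltW e3)// lerDl.
have -> : (K + 1) * (eta / 3 / (K + 1) + eta / 3 / (K + 1)) = 2 / 3 * eta.
  by field; rewrite gt_eqF.
lra.
Qed.

Section box.
Variables (c : nat -> T -> R) (n : nat).
Hypothesis c_predictable : forall i, mF i (c i.+1).
Variable delta : R.
Hypothesis c_bounded : forall i w, `|c i w| <= delta.
Hypothesis left_ge0 : forall a w, 0 <= arm_left sigma k c a n w.

Local Notation X a w := (arm_sum eps k c a n w).
Local Notation V a w := (arm_left sigma k c a n w).
Local Notation box t := [set w | forall a, X a w <= t a].
Local Notation bad s := [set w | exists a, s ^+ 2 < V a w].

Let mX a : measurable_fun [set: T] (arm_sum eps k c a n).
Proof. by apply: (mF_measurable filtF (i := n)); exact: mF_arm_sum. Qed.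

Let mV a : measurable_fun [set: T] (arm_left sigma k c a n).
Proof. by apply: (mF_measurable filtF (i := n)); exact: mF_arm_left. Qed.

Lemma measurable_box (t : 'I_d -> R) : measurable (box t).
Proof.
apply: measurable_forall => a.
have := mX a measurableT (measurable_itv `]-oo, t a]).
by rewrite setTI set_itvE.
Qed.

Lemma measurable_bad (s : R) : measurable (bad s).
Proof.
apply: measurable_exists => a.
have := mV a measurableT (measurable_itv `]s ^+ 2, +oo[).
by rewrite setTI set_itvE.
Qed.

Variables (t : 'I_d -> R) (e s : R).
Hypotheses (e0 : 0 < e) (s0 : 0 < s).

Local Notation tf u := (test_fun eps sigma k c u s n).

Let stf u : has_mean P (tf u).
Proof.
exact: (has_mean_test_fun P filtF sigma eps_adapted k_predictable c_predictable). Qed.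

Let sbox := has_mean_indic P (measurable_box t).
Let sbad := has_mean_indic P (measurable_bad s).

(** Off the bad event the final scale is between 0 and 2 s, so a margin e between
    the sum and the threshold is at least e / (2 s) standard deviations. *)
Let scale_le w : ~ bad s w -> forall a, 0 < Num.sqrt (s ^+ 2 + V a w) <= 2 * s.
Proof.
move=> nb a; have Vs : V a w <= s ^+ 2.
  by rewrite leNgt; apply/negP => h; apply: nb; exists a.
have V0 : 0 <= V a w by exact: left_ge0.
have ss : 0 < s ^+ 2 by rewrite exprn_gt0.
rewrite sqrtr_gt0 ltr_pwDl//=.
rewrite -[leRHS]ger0_norm ?mulr_ge0 ?(ltW s0)// -sqrtr_sqr ler_wsqrtr// exprMn.
lra.
Qed.

(** Inside the box and off the bad event, every factor of the test function with
    thresholds t + e is at least Phi (e / (2 s)). *)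
Lemma box_upper :
  fine (P (box t)) * ncdf (e / (2 * s)) ^+ d <=
  mean P (tf (fun a => t a + e)) + fine (P (bad s)).
Proof.
rewrite -!mean_indic; [|exact: measurable_bad|exact: measurable_box].
rewrite mulrC -meanZ// -meanD//; apply: le_mean; [exact: has_meanZ|exact: has_meanD|].
move=> w; rewrite !indicE.
have N1 : ncdf (e / (2 * s)) ^+ d <= 1 by rewrite exprn_ile1 ?ncdf_ge0 ?ncdf_le1.
have N0 : 0 <= ncdf (e / (2 * s)) ^+ d by rewrite exprn_ge0 ?ncdf_ge0.
have tf0 := test_fun_ge0 eps sigma k c (fun a => t a + e) s n w.
case: (boolP (w \in bad s)) => [_|]; rewrite /=.
  rewrite (@le_trans _ _ 1)// ?lerDr// -[leRHS]mulr1 ler_pM//.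
  by rewrite lern1 leq_b1.
rewrite notin_setE => nb; rewrite addr0.
case: (boolP (w \in box t)) => [/set_mem bw|_]; last by rewrite mulr0.
rewrite mulr1 -[d in _ ^+ d]card_ord -prodr_const; apply: ler_prod => a _.
rewrite ncdf_ge0/=; apply: ncdf_homo.
have /andP[q0 q2] := scale_le nb a.
apply: ler_pM; rewrite ?invr_ge0 ?mulr_ge0 ?(ltW e0) ?(ltW s0)//.
  by have := bw a; lra.
by rewrite lef_pV2 ?posrE ?mulr_gt0.
Qed.

(** Outside the box some sum exceeds its threshold, and then, off the bad event,
    the factor of that arm for the threshold t - e is at most Phi (- e / (2 s)). *)
Lemma box_lower :
  mean P (tf (fun a => t a - e)) <=
  fine (P (box t)) + ncdf (- (e / (2 * s))) + fine (P (bad s)).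
Proof.
rewrite -!mean_indic; [|exact: measurable_bad|exact: measurable_box].
pose r := ncdf (- (e / (2 * s))).
have sr : has_mean P (fun=> r) by exact: has_mean_cst.
have sbr : has_mean P (fun w => \1_(box t) w + r) by exact: has_meanD.
rewrite -/r -[r](mean_cst P) -(meanD sbox sr) -(meanD sbr sbad).
apply: le_mean => //; first exact: has_meanD.
move=> w; rewrite !indicE.
have N0 : 0 <= r by exact: ncdf_ge0.
have tf1 := test_fun_le1 eps sigma k c (fun a => t a - e) s n w.
case: (boolP (w \in bad s)) => [_|]; rewrite /=.
  by rewrite (le_trans tf1)// lerDr addr_ge0.
rewrite notin_setE => nb; rewrite addr0.
case: (boolP (w \in box t)) => [_|]; rewrite /=.
  by rewrite (le_trans tf1)// lerDl.
rewrite notin_setE add0r => nbox.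
have [a Xa] : exists a, t a < X a w.
  apply: contrapT => h; apply: nbox => a; rewrite leNgt; apply/negP => ?.
  by apply: h; exists a.
rewrite /test_fun (bigD1 a)//=; set Q := \prod_(_ | _) _.
have Q1 : Q <= 1 by apply: prodr_ile1 => b _; rewrite ncdf_ge0 ncdf_le1.
rewrite -[leRHS]mulr1 ler_pM ?ncdf_ge0//.
  by apply: prodr_ge0 => b _; exact: ncdf_ge0.
apply: ncdf_homo; have /andP[q0 q2] := scale_le nb a.
rewrite -mulNr -[leRHS]opprK -mulNr lerNr -mulNr opprK.
apply: (@le_trans _ _ (e / Num.sqrt (s ^+ 2 + V a w))).
  by rewrite ler_wpM2l ?(ltW e0)// lef_pV2 ?posrE ?mulr_gt0.
rewrite ler_wpM2r ?invr_ge0 ?sqrtr_ge0//; lra.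
Qed.

End box.

End clt.

(** * The central limit theorem for the sums of the arms *)

Section limits.
Context {R : realType}.

Lemma cvg_prod_ord d (f : nat -> 'I_d -> R) (l : 'I_d -> R) :
  (forall a, f n a @[n --> \oo] --> l a) ->
  \prod_a f n a @[n --> \oo] --> \prod_a l a.
Proof.
move=> fl; have mc := @mul_continuous R.
exact: (cvg_big mc (Ff := fun a n => f n a)).
Qed.

Lemma cvgn_exp (f : nat -> R) (l : R) m :
  f n @[n --> \oo] --> l -> f n ^+ m @[n --> \oo] --> l ^+ m.
Proof. by move=> fl; exact: (cvg_comp _ _ fl (@exprn_continuous R m l)). Qed.

(** The smoothing s = e^2 tends to 0 faster than the margin e, so that
    e / (2 s) = 1 / (2 e) tends to infinity as e tends to 0. *)
Lemma smoothing_scale d (t : 'I_d -> R) (eta : R) : 0 < eta ->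
  exists e : R, [/\ 0 < e,
    1 - eta <= ncdf (e / (2 * e ^+ 2)) ^+ d,
    ncdf (- (e / (2 * e ^+ 2))) <= eta,
    \prod_a ncdf ((t a + e) / Num.sqrt ((e ^+ 2) ^+ 2 + 1)) <= \prod_a ncdf (t a) + eta
  & \prod_a ncdf (t a) - eta <= \prod_a ncdf ((t a - e) / Num.sqrt ((e ^+ 2) ^+ 2 + 1))].
Proof.
move=> eta0; pose e m : R := m.+1%:R^-1.
have e0 : e m @[m --> \oo] --> (0 : R) by exact: cvg_harmonic.
have eE m : e m / (2 * e m ^+ 2) = m.+1%:R / 2.
  have : m.+1%:R != 0 :> R by rewrite pnatr_eq0.
  by rewrite /e; move: (m.+1%:R) => z z0; field.
have ey : m.+1%:R / 2 @[m --> \oo] --> (+oo : set_system R).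
  apply/cvgryPge => A; near=> m; rewrite ler_pdivlMr//.
  near: m; exists (Num.truncn (A * 2)) => // m /= Am.
  by rewrite (le_trans (ltW (truncnS_gt _)))// ler_nat ltnS.
have l1 : ncdf (e m / (2 * e m ^+ 2)) ^+ d @[m --> \oo] --> (1 : R).
  under eq_fun do rewrite eE.
  have h : ncdf (m.+1%:R / 2) @[m --> \oo] --> (1 : R).
    exact: (cvg_comp _ _ ey cvg_ncdfy1).
  by have := cvgn_exp (m := d) h; rewrite expr1n.
have l2 : ncdf (- (e m / (2 * e m ^+ 2))) @[m --> \oo] --> (0 : R).
  under eq_fun do rewrite eE.
  apply: (cvg_comp _ _ _ cvg_ncdfNy0); exact/cvgNrNy.
have sq1 : Num.sqrt ((e m ^+ 2) ^+ 2 + 1) @[m --> \oo] --> (1 : R).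
  have h : (e m ^+ 2) ^+ 2 + 1 @[m --> \oo] --> ((0 ^+ 2) ^+ 2 + 1 : R).
    by apply: cvgD; [do 2! apply: cvgn_exp|exact: cvg_cst].
  have := cvg_comp _ _ h (@sqrt_continuous R _).
  by rewrite !expr0n add0r sqrtr1.
have lim (sg : R) : \prod_a ncdf ((t a + sg * e m) / Num.sqrt ((e m ^+ 2) ^+ 2 + 1))
    @[m --> \oo] --> \prod_a ncdf (t a).
  apply: cvg_prod_ord => a.
  have h1 : t a + sg * e m @[m --> \oo] --> t a + sg * 0.
    by apply: cvgD; [exact: cvg_cst|exact: cvgMl_tmp].
  have h2 : (Num.sqrt ((e m ^+ 2) ^+ 2 + 1))^-1 @[m --> \oo] --> (1^-1 : R).
    exact: (cvgV (oner_neq0 R) sq1).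
  have h := cvg_comp _ _ (cvgM h1 h2) (@ncdf_continuous R _).
  by have {}h := h _; rewrite mulr0 addr0 invr1 mulr1 in h; exact: h.
have lp := lim 1; have ln := lim (-1).
have : \forall m \near \oo, [/\ 1 - eta <= ncdf (e m / (2 * e m ^+ 2)) ^+ d,
    ncdf (- (e m / (2 * e m ^+ 2))) <= eta,
    \prod_a ncdf ((t a + 1 * e m) / Num.sqrt ((e m ^+ 2) ^+ 2 + 1)) <= \prod_a ncdf (t a) + eta
  & \prod_a ncdf (t a) - eta <=
      \prod_a ncdf ((t a + -1 * e m) / Num.sqrt ((e m ^+ 2) ^+ 2 + 1))].
  near=> m; split; near: m.
  - by apply: (cvgr_ge 1 l1); rewrite gtrBl.
  - exact: (cvgr_le 0 l2).
  - by apply: (cvgr_le (\prod_a ncdf (t a)) lp); rewrite ltrDl.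
  - by apply: (cvgr_ge (\prod_a ncdf (t a)) ln); rewrite gtrBl.
case/filter_ex => m []; rewrite ?mul1r ?mulN1r => h1 h2 h3 h4.
by exists (e m); split => //; rewrite invr_gt0.
Unshelve. all: by end_near. Qed.

Lemma sandwich_bound (G x q m1 m2 g1 g2 r A eta : R) :
  x - eta <= q -> g1 - eta <= m1 -> m2 <= g2 + eta -> m1 <= x + r + A ->
  q <= m2 + A -> r <= eta -> g2 <= G + eta -> G - eta <= g1 -> A <= eta ->
  `|G - x| <= 4 * eta.
Proof. by move=> *; rewrite ler_distl; apply/andP; split; lra. Qed.

End limits.

Section arm_clt.
Context {disp : measure_display} {T : measurableType disp} {R : realType}.
Variables (P : probability T R) (F : nat -> set (set T)).
Hypothesis filtF : filtration F.
Notation mF i f :=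
  (measurable_fun [set: g_sigma_algebraType (F i)]
     (f : g_sigma_algebraType (F i) -> R)).
Variables (eps : nat -> T -> R) (sigma Delta : R) (C : nat -> T -> \bar R).
Hypothesis eps_adapted : forall i, measurable_wrt (F i.+1) (eps i.+1).
Hypothesis eps_mean : forall i,
  is_cond_exp P (F i) (fun w => (eps i.+1 w)%:E) (cst 0%:E).
Hypothesis eps_var : forall i,
  is_cond_exp P (F i) (fun w => (eps i.+1 w ^+ 2)%:E) (cst (sigma ^+ 2)%:E).
Hypothesis sigma0 : 0 < sigma.
Hypothesis Delta0 : 0 < Delta.
Hypothesis eps_moment : forall i,
  is_cond_exp P (F i) (fun w => (`|eps i.+1 w| `^ (2 + Delta))%:E) (C i.+1).
Hypothesis moment_bounded : {ae P, forall w,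
  (ereal_sup [set C i w | i in [set i | (1 <= i)%N]] < +oo)%E}.
Variables (d : nat) (k : nat -> T -> 'I_d).
Hypothesis k_predictable : forall i a, F i [set w | k i.+1 w = a].

Variables (c : nat -> nat -> T -> R) (delta : nat -> R).
Hypothesis c_predictable : forall n i, mF i (c n i.+1).
Hypothesis c_small : \forall n \near \oo, forall i w, `|c n i w| <= delta n.
Hypothesis left_ge0 : \forall n \near \oo, forall a w,
  0 <= arm_left sigma k (c n) a n w.
Hypothesis delta_cvg0 : delta n @[n --> \oo] --> (0 : R).
Hypothesis left_cvg0 : forall r, 0 < r ->
  fine (P [set w | exists a, r < arm_left sigma k (c n) a n w]) @[n --> \oo]
  --> (0 : R).

(** For fixed e and s the test function converges by [uniform_clt], and
    [box_upper] and [box_lower] enclose the probability of the box between two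
    means of test functions; [smoothing_scale] lets e and s tend to 0. *)
Theorem arm_clt (t : 'I_d -> R) :
  fine (P [set w | forall a, arm_sum eps k (c n) a n w <= t a]) @[n --> \oo]
  --> \prod_a ncdf (t a).
Proof.
apply/cvgrPdist_le => eta' eta'0; pose eta := eta' / 4.
have eta0 : 0 < eta by rewrite divr_gt0.
have [e [e0 h1 h2 h3 h4]] := smoothing_scale t eta0.
have s0 : 0 < e ^+ 2 by rewrite exprn_gt0.
have [delta0 d0 U] := uniform_clt filtF eps_adapted eps_mean eps_var sigma0
  Delta0 eps_moment moment_bounded k_predictable s0 eta0.
near=> n.
have cn : forall i w, `|c n i w| <= delta n by near: n.
have ln : forall a w, 0 <= arm_left sigma k (c n) a n w by near: n.
have dn : delta n <= delta0.
  by near: n; apply: (cvgr_le (0 : R) delta_cvg0).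
have bn : fine (P [set w | exists a, (e ^+ 2) ^+ 2 < arm_left sigma k (c n) a n w]) <= eta.
  near: n; apply: (cvgr_le (0 : R) (@left_cvg0 _ _)) => //.
  by rewrite exprn_gt0.
have := box_upper P filtF eps_adapted k_predictable (@c_predictable n) ln t e0 s0.
have := box_lower P filtF eps_adapted k_predictable (@c_predictable n) ln t e0 s0.
have := U n (c n) (delta n) (fun a => t a + e) (@c_predictable n) cn dn ln.
have := U n (c n) (delta n) (fun a => t a - e) (@c_predictable n) cn dn ln.
set p := fine (P [set w | forall a, _]).
have p1 : p <= 1.
  have mb := measurable_box filtF eps_adapted k_predictable n (@c_predictable n) t.
  by rewrite -lee_fin fineK ?fin_num_measure ?probability_le1.
have p0 : 0 <= p by rewrite fine_ge0.
set N := ncdf _ ^+ d in h1 *.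
have pN : p - eta <= p * N.
  have : p * (1 - eta) <= p * N by rewrite ler_wpM2l.
  have : p * eta <= eta by rewrite ler_piMl// ltW.
  lra.
rewrite ler_distl => /andP[u1 _]; rewrite ler_distl => /andP[_ u2] b1 b2.
have -> : eta' = 4 * eta by rewrite /eta mulrC divfK// pnatr_eq0.
exact: (sandwich_bound pN u1 u2 b1 b2).
Unshelve. all: by end_near. Qed.

End arm_clt.

(** * Asymptotics of logarithms, counts and boxes *)

Section log_asymptotics.
Context {R : realType}.

Lemma cvg_ln_pinfty : ln x @[x --> +oo] --> (+oo : set_system R).
Proof.
apply/cvgryPge => A; near=> x.
have Ax : expR A <= x by near: x; exact: nbhs_pinfty_ge.
by rewrite -[leLHS]expRK ler_ln ?posrE ?expR_gt0// (lt_le_trans _ Ax) ?expR_gt0.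
Unshelve. all: by end_near. Qed.

Lemma cvg_log : (@log R n) @[n --> \oo] --> (+oo : set_system R).
Proof. exact: (cvg_comp _ _ (@cvgr_idn R) cvg_ln_pinfty). Qed.

Lemma cvg_loglog : (@loglog R n) @[n --> \oo] --> (+oo : set_system R).
Proof. exact: (cvg_comp _ _ cvg_log cvg_ln_pinfty). Qed.

Lemma ln_le_sqrt (x : R) : 0 < x -> ln x <= 2 * Num.sqrt x.
Proof.
move=> x0; have s0 : 0 < Num.sqrt x by rewrite sqrtr_gt0.
rewrite -[in leLHS](sqr_sqrtr (ltW x0)) lnXn// mulr2n.
by have := ln_sublinear s0; lra.
Qed.

Lemma cvgn_inv_pinfty (f : nat -> R) : f n @[n --> \oo] --> (+oo : set_system R) ->
  (f n)^-1 @[n --> \oo] --> (0 : R).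
Proof.
move=> /cvgryPge foo; apply/cvgrPdist_le => e e0; near=> n.
have fe : e^-1 <= f n by near: n; exact: foo.
rewrite sub0r normrN.
have f0 : 0 < f n by apply: lt_le_trans fe; rewrite invr_gt0.
rewrite ger0_norm ?invr_ge0 ?(ltW f0)//.
by rewrite -[leRHS]invrK lef_pV2 ?posrE ?invr_gt0.
Unshelve. all: by end_near. Qed.

Lemma cvgn_squeeze0 (f g : nat -> R) : (\forall n \near \oo, 0 <= f n <= g n) ->
  g n @[n --> \oo] --> (0 : R) -> f n @[n --> \oo] --> (0 : R).
Proof. by move=> fg g0; exact: (squeeze_cvgr fg (cvg_cst _) g0). Qed.

Lemma cvg_loglog_log : (@loglog R n) / log n @[n --> \oo] --> (0 : R).
Proof.
have l1 : 2 * Num.sqrt (@log R n)^-1 @[n --> \oo] --> (0 : R).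
  have h := cvg_comp _ _ (cvgn_inv_pinfty cvg_log) (@sqrt_continuous R 0).
  have {}h := cvgMl_tmp (a := 2) h.
  by have {}h := h _; rewrite sqrtr0 mulr0 in h; exact: h.
apply: cvgn_squeeze0 l1; near=> n.
have L1 : 1 <= @log R n by near: n; move/cvgryPge: cvg_log; exact.
have L0 : 0 < @log R n by exact: lt_le_trans L1.
have l0 : 0 <= @loglog R n by rewrite /loglog ln_ge0.
apply/andP; split; first by rewrite divr_ge0// ltW.
rewrite ler_pdivrMr//.
rewrite (le_trans (ln_le_sqrt L0))// -mulrA ler_wpM2l//.
rewrite sqrtrV ?(ltW L0)// -[X in _ * X](sqr_sqrtr (ltW L0)) expr2 mulrA mulVf ?mul1r//.
by rewrite gt_eqF// sqrtr_gt0.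
Unshelve. all: by end_near. Qed.

Lemma cvg_gammaL : (@gammaL R n) @[n --> \oo] --> (0 : R).
Proof.
apply: cvgn_squeeze0 (cvgn_inv_pinfty cvg_log); near=> n.
have L1 : 1 <= @log R n by near: n; move/cvgryPge: cvg_log; exact.
have l1 : 1 <= @loglog R n by near: n; move/cvgryPge: cvg_loglog; exact.
have L0 : 0 < @log R n by exact: lt_le_trans L1.
have l0 : 0 < @loglog R n by exact: lt_le_trans l1.
have Ll : 0 < log n * @loglog R n by rewrite mulr_gt0.
apply/andP; split; first by rewrite invr_ge0 ltW.
by rewrite lef_pV2 ?posrE// ler_peMr// ltW.
Unshelve. all: by end_near. Qed.

Lemma harmonic_le_ln n : (0 < n)%N ->
  \sum_(1 <= t < n.+1) (t%:R : R)^-1 <= 1 + ln n%:R.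
Proof.
case: n => // n _; elim: n => [|n IH]; first by rewrite big_nat1 invr1 ln1 addr0.
rewrite big_nat_recr//.
have n1 : 0 < n.+1%:R :> R by [].
have n2 : 0 < n.+2%:R :> R by [].
have h : (n.+2%:R : R)^-1 <= ln n.+2%:R - ln n.+1%:R.
  rewrite -[leRHS]opprK opprB -ln_div ?posrE// lerNr.
  have -> : n.+1%:R / n.+2%:R = 1 + - (n.+2%:R)^-1 :> R.
    have -> : n.+1%:R = n.+2%:R - 1 :> R by rewrite -[n.+2]addn1 natrD addrK.
    by rewrite mulrBl divff ?gt_eqF// mul1r.
  by apply: le_ln1Dx; rewrite ltrN2 invf_lt1// ltr1n.
apply: (le_trans (lerD IH h)).
by rewrite -addrA [ln n.+1%:R + _]addrC subrK.
Qed.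

End log_asymptotics.

Section pulls_measurable.
Context {disp : measure_display} {T : measurableType disp} {R : realType}.
Variables (d : nat) (k : nat -> T -> 'I_d).

Lemma measurable_arm_ind j a : measurable [set w | k j w = a] ->
  measurable_fun [set: T] (fun w => (k j w == a)%:R : R).
Proof.
move=> mk; rewrite (_ : (fun w => _) = \1_[set w | k j w = a]).
  exact: measurable_indic.
apply/funext => w; rewrite indicE; congr (nat_of_bool _)%:R.
by apply/eqP/idP => [h|/set_mem//]; exact/mem_set.
Qed.

(** The induction needs all functions [f] at once, as the count after round i + 1
    is the count after round i, or its successor. *)
Lemma measurable_pulls a i (f : nat -> R) :
  (forall j, (0 < j <= i)%N -> measurable [set w | k j w = a]) ->
  measurable_fun [set: T] (fun w => f (pulls (k^~ w) a i)).
Proof.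
elim: i f => [|i IH] f mk.
  by rewrite (_ : (fun w => _) = cst (f 0%N))//; apply/funext => w; rewrite pulls0.
have mk' j : (0 < j <= i)%N -> measurable [set w | k j w = a].
  by case/andP => j0 ji; apply: mk; rewrite j0 (leq_trans ji).
rewrite (_ : (fun w => _) = (fun w => f (pulls (k^~ w) a i) + (k i.+1 w == a)%:R *
   (f (pulls (k^~ w) a i).+1 - f (pulls (k^~ w) a i)))).
  apply: measurable_funD; first exact: IH.
  apply: measurable_funM.
    by apply: measurable_arm_ind; apply: mk; rewrite ltnSn.
  by apply: measurable_funB; [exact: (IH (fun t => f t.+1))|exact: IH].
apply/funext => w; rewrite pullsS; case: (k i.+1 w == a).
  by rewrite addn1 mul1r addrC subrK.
by rewrite addn0 mul0r addr0.
Qed.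

End pulls_measurable.

Lemma slutsky_bound (R : realType) (p qp qm gp gm G A eta : R) :
  p <= qp + A -> qm <= p + A -> qp <= gp + eta -> gm - eta <= qm -> A <= eta ->
  gp <= G + eta -> G - eta <= gm -> `|G - p| <= 3 * eta.
Proof. by move=> *; rewrite ler_distl; apply/andP; split; lra. Qed.

Section probability_limits.
Context {disp : measure_display} {T : measurableType disp} {R : realType}.
Variable P : probability T R.

Lemma fine_le_measure (A B : set T) : measurable A -> measurable B ->
  A `<=` B -> fine (P A) <= fine (P B).
Proof.
move=> mA mB AB; apply: fine_le; rewrite ?fin_num_measure//.
by apply: le_measure => //; exact: mem_set.
Qed.

Lemma fine_measureU (A B : set T) : measurable A -> measurable B ->
  fine (P (A `|` B)) <= fine (P A) + fine (P B).
Proof.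
move=> mA mB; rewrite -fineD ?fin_num_measure//.
by apply: fine_le; rewrite ?fin_numD ?fin_num_measure//; [exact: measurableU|exact: measureU2].
Qed.

(** The rank from which A_n fails may depend on the outcome; the unions of the
    A_m with m >= n decrease to a null set. *)
Lemma cvg_probability_eventually (A : nat -> set T) :
  (forall n, measurable (A n)) ->
  {ae P, forall w, \forall n \near \oo, ~ A n w} ->
  fine (P (A n)) @[n --> \oo] --> (0 : R).
Proof.
move=> mA ae; pose U n := \bigcup_(m in [set m | (n <= m)%N]) A m.
have mU n : measurable (U n) by apply: bigcup_measurable.
have U0 : (P (U n))%E @[n --> \oo] --> 0%E.
  have -> : 0%E = P (\bigcap_n U n).
    apply/esym; apply: measure_negligible; first exact: bigcap_measurable.
    have [N [mN PN sN]] := ae; exists N; split => // w Uw; apply: sN => /= -[n _ h].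
    have [m nm Am] := Uw n I.
    exact: (h m nm).
  apply: nonincreasing_cvg_mu => //.
  - by apply: le_lt_trans (probability_le1 P (mU 0%N)) _; exact: ltry.
  - exact: bigcap_measurable.
  - move=> m n mn; apply/subsetPset => w [j /= nj Aj]; exists j => //=.
    exact: leq_trans nj.
have f0 : fine (P (U n)) @[n --> \oo] --> (0 : R) by exact: fine_cvg.
apply: cvgn_squeeze0 f0; apply: nearW => n; rewrite fine_ge0//=.
by apply: fine_le_measure => // w Aw; exists n => /=.
Qed.

(** Slutsky's lemma for boxes: if X and Y differ by at most e in each coordinate,
    the box of X with thresholds t lies between those of Y with thresholds t - e
    and t + e. *)
Lemma box_slutsky d (X Y : nat -> T -> 'I_d -> R) (G : ('I_d -> R) -> R)
    (t : 'I_d -> R) :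
  (\forall n \near \oo, forall a, measurable_fun [set: T] (fun w => X n w a)) ->
  (\forall n \near \oo, forall a, measurable_fun [set: T] (fun w => Y n w a)) ->
  (forall e : R, 0 < e ->
    fine (P [set w | exists a, e < `|X n w a - Y n w a|]) @[n --> \oo] --> (0 : R)) ->
  (forall u, fine (P [set w | forall a, Y n w a <= u a]) @[n --> \oo] --> G u) ->
  (forall eta : R, 0 < eta -> exists e : R, [/\ 0 < e, G (fun a => t a + e) <= G t + eta
     & G t - eta <= G (fun a => t a - e)]) ->
  fine (P [set w | forall a, X n w a <= t a]) @[n --> \oo] --> G t.
Proof.
move=> mX mY XY YG Gt; apply/cvgrPdist_le => eta' eta'0.
pose eta := eta' / 3; have eta0 : 0 < eta by rewrite divr_gt0.
have [e [e0 h1 h2]] := Gt _ eta0.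
near=> n.
have mXn : forall a, measurable_fun [set: T] (fun w => X n w a) by near: n.
have mYn : forall a, measurable_fun [set: T] (fun w => Y n w a) by near: n.
have mbox (Z : T -> 'I_d -> R) (u : 'I_d -> R) :
    (forall a, measurable_fun [set: T] (fun w => Z w a)) ->
    measurable [set w | forall a, Z w a <= u a].
  move=> mZ; apply: measurable_forall => a.
  have := mZ a measurableT _ (measurable_itv `]-oo, u a]).
  by rewrite setTI set_itvE.
have mA : measurable [set w | exists a, e < `|X n w a - Y n w a|].
  apply: measurable_exists => a.
  have mD : measurable_fun [set: T] (fun w => `|X n w a - Y n w a|).
    by apply: measurableT_comp => //; exact: measurable_funB.
  have := mD measurableT _ (measurable_itv `]e, +oo[).
  by rewrite setTI set_itvE.
have PA : fine (P [set w | exists a, e < `|X n w a - Y n w a|]) <= eta.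
  by near: n; apply: (cvgr_le (0 : R) (@XY _ e0)).
set A := [set w | exists a, _] in mA PA.
have Yp : fine (P [set w | forall a, Y n w a <= t a + e]) <= G (fun a => t a + e) + eta.
  near: n; apply: (cvgr_le _ (YG (fun a => t a + e))).
  by rewrite ltrDl.
have Ym : G (fun a => t a - e) - eta <= fine (P [set w | forall a, Y n w a <= t a - e]).
  near: n; apply: (cvgr_ge _ (YG (fun a => t a - e))).
  by rewrite gtrBl.
have b1 : fine (P [set w | forall a, X n w a <= t a]) <=
    fine (P [set w | forall a, Y n w a <= t a + e]) + fine (P A).
  apply: le_trans (fine_measureU _ _); [|exact: mbox|exact: mA].
  apply: fine_le_measure; [exact: mbox|by apply: measurableU => //; exact: mbox|].
  move=> w Xw; case: (pselect (A w)) => [?|nA]; [by right|left => a].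
  have : `|X n w a - Y n w a| <= e.
    by rewrite leNgt; apply/negP => h; apply: nA; exists a.
  rewrite ler_distl => /andP[h _]; have := Xw a; lra.
have b2 : fine (P [set w | forall a, Y n w a <= t a - e]) <=
    fine (P [set w | forall a, X n w a <= t a]) + fine (P A).
  apply: le_trans (fine_measureU _ _); [|exact: mbox|exact: mA].
  apply: fine_le_measure; [exact: mbox|by apply: measurableU => //; exact: mbox|].
  move=> w Yw; case: (pselect (A w)) => [?|nA]; [by right|left => a].
  have : `|X n w a - Y n w a| <= e.
    by rewrite leNgt; apply/negP => h; apply: nA; exists a.
  rewrite ler_distl => /andP[_ h]; have := Yw a; lra.
have -> : eta' = 3 * eta by rewrite /eta mulrC divfK// pnatr_eq0.
exact: (slutsky_bound b1 b2 Yp Ym PA h1 h2).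
Unshelve. all: by end_near. Qed.

End probability_limits.

Lemma cdf_prod_modulus (R : realType) d (t : 'I_d -> R) (eta : R) : 0 < eta ->
  exists e : R, [/\ 0 < e, \prod_a ncdf (t a + e) <= \prod_a ncdf (t a) + eta
     & \prod_a ncdf (t a) - eta <= \prod_a ncdf (t a - e)].
Proof.
move=> eta0; pose e m : R := m.+1%:R^-1.
have e0 : e m @[m --> \oo] --> (0 : R) by exact: cvg_harmonic.
have lim (sg : R) : \prod_a ncdf (t a + sg * e m) @[m --> \oo] --> \prod_a ncdf (t a).
  apply: cvg_prod_ord => a.
  have h1 : t a + sg * e m @[m --> \oo] --> t a + sg * 0.
    by apply: cvgD; [exact: cvg_cst|exact: cvgMl_tmp].
  have h := cvg_comp _ _ h1 (@ncdf_continuous R _).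
  by have {}h := h _; rewrite mulr0 addr0 in h; exact: h.
have : \forall m \near \oo,
    \prod_a ncdf (t a + 1 * e m) <= \prod_a ncdf (t a) + eta /\
    \prod_a ncdf (t a) - eta <= \prod_a ncdf (t a + -1 * e m).
  near=> m; split; near: m.
  - by apply: (cvgr_le _ (lim 1)); rewrite ltrDl.
  - by apply: (cvgr_ge _ (lim (-1))); rewrite gtrBl.
case/filter_ex => m []; rewrite mul1r mulN1r => h1 h2.
by exists (e m); split => //; rewrite invr_gt0.
Unshelve. all: by end_near. Qed.

(** * The estimator as a random variable *)

Section od_setting.
Context {disp : measure_display} {T : measurableType disp} {R : realType}.
Variables (P : probability T R) (F : nat -> set (set T)).
Hypothesis filtF : filtration F.
Notation mF i f :=
  (measurable_fun [set: g_sigma_algebraType (F i)]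
     (f : g_sigma_algebraType (F i) -> R)).
Variables (eps y : nat -> T -> R) (sigma : R).
Hypothesis eps_adapted : forall i, measurable_wrt (F i.+1) (eps i.+1).
Hypothesis eps_mean : forall i,
  is_cond_exp P (F i) (fun w => (eps i.+1 w)%:E) (cst 0%:E).
Hypothesis eps_var : forall i,
  is_cond_exp P (F i) (fun w => (eps i.+1 w ^+ 2)%:E) (cst (sigma ^+ 2)%:E).
Hypothesis sigma0 : 0 < sigma.
Variables (d : nat) (k : nat -> T -> 'I_d).
Hypothesis k_predictable : forall i a, F i [set w | k i.+1 w = a].
Variable theta : 'cV[R]_d.
Hypothesis yE : forall i w, (0 < i)%N -> y i w = theta (k i w) 0 + eps i w.

Let k_measurable j a : (0 < j)%N -> measurable [set w | k j w = a].
Proof. by case: j => // j _; exact: (filt_sub filtF) (k_predictable j a). Qed.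

Lemma mF_pulls (a : 'I_d) i (f : nat -> R) :
  mF i (fun w => f (pulls (k^~ w) a i.+1)).
Proof.
apply: (@measurable_pulls _ (g_sigma_algebraType (F i)) R d k a i.+1 f) => j.
case: j => // j /= ji; apply/(sub_measurableP (filt_sigma filtF i)).
by have [_ _ Fm] := filtF; apply: (Fm j) => //; exact: k_predictable.
Qed.

Lemma measurable_count (a : 'I_d) i (f : nat -> R) :
  measurable_fun [set: T] (fun w => f (pulls (k^~ w) a i)).
Proof. by apply: measurable_pulls => j /andP[j0 _]; exact: k_measurable. Qed.

Lemma y_measurable i : measurable_fun [set: T] (y i.+1).
Proof.
rewrite (_ : y i.+1 = fun w => (\sum_a (k i.+1 w == a)%:R * theta a 0) + eps i.+1 w).
  apply: measurable_funD; last exact: (eps_measurable filtF eps_adapted i).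
  apply: measurable_sum => a; apply: measurable_funM => //.
  by apply: measurable_arm_ind; exact: k_measurable.
by apply/funext => w; rewrite yE// sum_pred1_mul.
Qed.

(** The two cases of [diag_inv] are joined by the indicator [p] of the event that
    all the entries are nonzero. *)
Lemma measurable_diag_inv (f : nat -> R) n a :
  measurable_fun [set: T] (fun w => diag_inv (fun b => f (pulls (k^~ w) b n)) a).
Proof.
pose p w : R := \prod_b (f (pulls (k^~ w) b n) != 0)%:R.
rewrite (_ : (fun w => _) = fun w => p w * (f (pulls (k^~ w) a n))^-1 +
   (1 - p w) * f (pulls (k^~ w) a n)).
  have mp : measurable_fun [set: T] p.
    by apply: measurable_prod => b _; exact: (measurable_count b n (fun t => (f t != 0)%:R)).
  apply: measurable_funD; apply: measurable_funM => //.
  - exact: (measurable_count a n (fun t => (f t)^-1)).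
  - exact: measurable_funB.
  - exact: measurable_count.
apply/funext => w; rewrite /diag_inv /p; case: ifPn => [/forallP h|].
  by rewrite big1 => [|b _]; rewrite ?h// subrr mul0r addr0 mul1r.
rewrite negb_forall => /existsP[b hb].
by rewrite (bigD1 b)//= (negbTE hb) !mul0r add0r subr0 mul1r.
Qed.

Lemma measurable_od_error n a : log n != 0 :> R -> 0 < @gammaL R n ->
  measurable_fun [set: T] (fun w => (sqrtmx (gram (k^~ w) n) *m
    (theta_OD (k^~ w) (y^~ w) (gammaL n) (GammaL (k^~ w) n) n - theta)) a 0).
Proof.
move=> logn0 g0.
rewrite (_ : (fun w => _) = fun w =>
  Num.sqrt (pulls (k^~ w) a n)%:R * (LS_mean (k^~ w) (y^~ w) n a +
    diag_inv (fun b => Num.sqrt (pulls (k^~ w) b n)%:R) a *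
    \sum_(1 <= i < n.+1)
      (k i w == a)%:R * (od_coef (gammaL n) (log n ^+ 2) (pulls (k^~ w) a i) *
        (y i w - LS_mean (k^~ w) (y^~ w) n a))
    - theta a 0)); last by apply/funext => w; rewrite od_errorE.
have mk i : measurable_fun [set: T] (fun w => (k i.+1 w == a)%:R : R).
  by apply: measurable_arm_ind; exact: k_measurable.
have mLS : measurable_fun [set: T] (fun w => LS_mean (k^~ w) (y^~ w) n a).
  apply: measurable_funM; first exact: (measurable_diag_inv (fun t => t%:R)).
  rewrite (_ : (fun w => _) = fun w => \sum_(0 <= i < n) (k i.+1 w == a)%:R * y i.+1 w).
    by apply: measurable_sum => i; apply: measurable_funM => //; exact: y_measurable.
  by apply/funext => w; rewrite big_add1.
apply: measurable_funM; first exact: (measurable_count a n (fun t => Num.sqrt t%:R)).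
apply: measurable_funB => //; apply: measurable_funD => //.
apply: measurable_funM; first exact: (measurable_diag_inv (fun t => Num.sqrt t%:R)).
rewrite (_ : (fun w => _) = fun w => \sum_(0 <= i < n) (k i.+1 w == a)%:R *
   (od_coef (gammaL n) (log n ^+ 2) (pulls (k^~ w) a i.+1) *
        (y i.+1 w - LS_mean (k^~ w) (y^~ w) n a))).
  apply: measurable_sum => i; apply: measurable_funM => //; apply: measurable_funM.
    exact: measurable_count.
  by apply: measurable_funB => //; exact: y_measurable.
by apply/funext => w; rewrite big_add1.
Qed.

(** The weights, normalized so that the conditional variance of each arm is at
    most 1. *)
Definition coef n i w : R := Num.sqrt (gammaL n) / sigma *
  od_coef (gammaL n) (log n ^+ 2) (pulls (k^~ w) (k i w) i).

Lemma mF_coef n i : mF i (coef n i.+1).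
Proof.
apply: measurable_funM => //.
rewrite (_ : (fun w => _) = fun w => \sum_a (k i.+1 w == a)%:R *
    od_coef (gammaL n) (log n ^+ 2) (pulls (k^~ w) a i.+1)).
  apply: measurable_sum => a; apply: measurable_funM.
    exact: mF_arm.
  exact: mF_pulls.
by apply/funext => w; rewrite sum_pred1_mul.
Qed.

Lemma arm_coefE n a i w : arm_coef k (coef n) a i w =
  Num.sqrt (gammaL n) / sigma * ((k i w == a)%:R *
    od_coef (gammaL n) (log n ^+ 2) (pulls (k^~ w) a i)).
Proof.
rewrite /arm_coef /coef; case: eqVneq => [->|_]; first by rewrite !mul1r.
by rewrite !mul0r mulr0.
Qed.

Lemma arm_sumE n a w : arm_sum eps k (coef n) a n w =
  Num.sqrt (gammaL n) / sigma * \sum_(1 <= i < n.+1) (k i w == a)%:R *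
    (od_coef (gammaL n) (log n ^+ 2) (pulls (k^~ w) a i) * eps i w).
Proof.
rewrite /arm_sum /transform big_add1 big_mkord mulr_sumr.
by apply: eq_bigr => i _; rewrite arm_coefE !mulrA.
Qed.

Lemma arm_leftE n a w : 0 <= @gammaL R n -> arm_left sigma k (coef n) a n w =
  1 - gammaL n * \sum_(1 <= t < (pulls (k^~ w) a n).+1)
    od_coef (gammaL n) (log n ^+ 2) t ^+ 2.
Proof.
move=> g0; rewrite /arm_left; congr (1 - _); rewrite -sum_pulls.
rewrite [in RHS]big_add1 big_mkord !mulr_sumr; apply: eq_bigr => i _.
rewrite arm_coefE; move: (od_coef _ _ _) => W; rewrite !exprMn sqr_sqrtr// exprVn.
case: (k i.+1 w == a); last by rewrite expr0n /= !mul0r !mulr0.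
by rewrite expr1n !mul1r; field; rewrite gt_eqF.
Qed.

Definition noise a n w : R := noise_sum (k^~ w) n (eps^~ w) a.

(** The inverse of the number of pulls; the maximum avoids a division by zero,
    which would break monotonicity at the first pull. *)
Definition count_wt a i w : R := (Num.max (pulls (k^~ w) a i)%:R 1)^-1.

(** [mean_weighted_transform2] with the weights [count_wt]: the t-th pull of the
    arm contributes sigma^2 / t, and N pulls at most sigma^2 times the harmonic
    sum up to n >= N. *)
Lemma mean_noise_sqr a n : (0 < n)%N ->
  has_mean P (fun w => count_wt a n w * noise a n w ^+ 2) /\
  mean P (fun w => count_wt a n w * noise a n w ^+ 2) <= sigma ^+ 2 * (1 + log n).
Proof.
move=> n0; pose ind i w : R := (k i w == a)%:R.
have mind i : mF i (ind i.+1) by exact: mF_arm.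
have bind i w : `|ind i w| <= 1 by rewrite ger0_norm// lern1 leq_b1.
have noiseE : noise a n = transform eps ind n.
  apply/funext => w; rewrite /noise /noise_sum /transform big_add1 big_mkord.
  by [].
have mwt i : mF i (count_wt a i.+1).
  exact: (@mF_pulls a i (fun t => (Num.max t%:R 1)^-1)).
have wt01 i w : 0 <= count_wt a i w <= 1.
  have h : 1 <= Num.max (pulls (k^~ w) a i)%:R 1 :> R by rewrite le_max lexx orbT.
  by rewrite invr_ge0 (le_trans _ h)//= invf_le1// (lt_le_trans _ h).
have wtS i w : count_wt a i.+1 w <= count_wt a i w.
  rewrite lef_pV2 ?posrE ?lt_max ?ltr01 ?orbT//.
  rewrite ge_max !le_max lexx orbT andbT ler_nat.
  by rewrite (pulls_homo (k^~ w) a (leqnSn i)).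
have s1 i : has_mean P (fun w => count_wt a i.+1 w * ind i.+1 w ^+ 2).
  apply: (@has_mean_bounded _ _ _ _ 1).
    apply: (mF_measurable filtF (i := i)).
    by apply: measurable_funM => //; exact: measurable_funX.
  move=> w; have /andP[h1 h2] := wt01 i.+1 w.
  rewrite normrM ger0_norm// mulr_ile1// normrX exprn_ile1//.
split.
  rewrite noiseE; case: n n0 {noiseE} => // n _.
  apply: (@has_mean_mul_bounded _ _ _ _ 1).
  - exact: (mF_measurable filtF (mwt n)).
  - by move=> w; have /andP[? ?] := wt01 n.+1 w; rewrite ger0_norm.
  - exact: (has_mean_transform2 filtF eps_adapted eps_var mind bind).
rewrite noiseE.
apply: le_trans (mean_weighted_transform2 filtF eps_adapted eps_mean eps_var
  mind bind n mwt wt01 wtS) _.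
rewrite ler_wpM2l ?sqr_ge0// -(@mean_sum _ _ _ _ _ _
  (fun (i : 'I_n) w => count_wt a i.+1 w * ind i.+1 w ^+ 2)) => [|i];
  last exact: s1.
rewrite -[leRHS](mean_cst P); apply: le_mean; [exact: has_mean_sum|exact: has_mean_cst|].
move=> w; apply: le_trans (harmonic_le_ln n0).
rewrite -(big_mkord xpredT (fun i => count_wt a i.+1 w * ind i.+1 w ^+ 2)).
rewrite -(big_add1 _ _ 0 n.+1 xpredT (fun i => count_wt a i w * ind i w ^+ 2)).
rewrite (eq_bigr (fun i => (k i w == a)%:R *
  (Num.max (pulls (k^~ w) a i)%:R 1)^-1)); last first.
  move=> i _; rewrite mulrC /ind /count_wt; case: (k i w == a).
    by rewrite expr1n.
  by rewrite expr0n.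
rewrite (sum_pulls (k^~ w) a (fun t => (Num.max t%:R 1)^-1)).
rewrite (big_cat_nat (n := (pulls (k^~ w) a n).+1) (p := n.+1))//=; last first.
  by rewrite ltnS pulls_le.
rewrite -[leLHS]addr0 lerD//; last by apply: sumr_ge0 => t _; rewrite invr_ge0.
rewrite big_nat [leRHS]big_nat; apply: ler_sum => t /andP[t1 _].
by rewrite max_l// ler1n.
Qed.

End od_setting.

(** * Variance of the normalized sums *)

Lemma log_large (R : realType) :
  \forall n \near \oo, [/\ (0 < n)%N, 1 <= @log R n & 1 <= @loglog R n].
Proof.
near=> n; split.
- by near: n; exact: nbhs_infty_gt.
- by near: n; move/cvgryPge: (@cvg_log R); exact.
- by near: n; move/cvgryPge: (@cvg_loglog R); exact.
Unshelve. all: by end_near. Qed.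

Section od_limits.
Context {disp : measure_display} {T : measurableType disp} {R : realType}.
Variables (P : probability T R) (F : nat -> set (set T)).
Hypothesis filtF : filtration F.
Variables (eps y : nat -> T -> R) (sigma : R).
Hypothesis eps_adapted : forall i, measurable_wrt (F i.+1) (eps i.+1).
Hypothesis eps_mean : forall i,
  is_cond_exp P (F i) (fun w => (eps i.+1 w)%:E) (cst 0%:E).
Hypothesis eps_var : forall i,
  is_cond_exp P (F i) (fun w => (eps i.+1 w ^+ 2)%:E) (cst (sigma ^+ 2)%:E).
Hypothesis sigma0 : 0 < sigma.
Variables (d : nat) (k : nat -> T -> 'I_d).
Hypothesis k_predictable : forall i a, F i [set w | k i.+1 w = a].
Variable theta : 'cV[R]_d.
Hypothesis yE : forall i w, (0 < i)%N -> y i w = theta (k i w) 0 + eps i w.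
Hypothesis min_pulls_large : {ae P, forall w, \forall n \near \oo,
  log n ^+ 2 <= (min_pulls (k^~ w) n)%:R :> R}.

(** The bound 2 / (gamma sqrt c) of [od_coef_le] times sqrt gamma / sigma, for
    c = (log n)^2 and gamma = 1 / (log n * loglog n). *)
Definition coef_bound n : R := 2 / sigma * Num.sqrt (loglog n / log n).

Lemma cvg_coef_bound : coef_bound n @[n --> \oo] --> (0 : R).
Proof.
have h := cvg_comp _ _ (@cvg_loglog_log R) (@sqrt_continuous R 0).
have {}h := cvgMl_tmp (a := 2 / sigma) h.
by have {}h := h _; rewrite sqrtr0 mulr0 in h; exact: h.
Qed.

Lemma coef_small : \forall n \near \oo,
  forall i w, `|coef sigma k n i w| <= coef_bound n.
Proof.
apply: filterS (log_large R) => n [n0 L1 l1] i w.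
have L0 : 0 < @log R n by exact: lt_le_trans L1.
have l0 : 0 < @loglog R n by exact: lt_le_trans l1.
have g0 : 0 < @gammaL R n by rewrite invr_gt0 mulr_gt0.
have c0 : 0 < @log R n ^+ 2 by rewrite exprn_gt0.
rewrite ger0_norm; last first.
  by rewrite mulr_ge0 ?od_coef_ge0// divr_ge0 ?sqrtr_ge0// ltW.
rewrite /coef (le_trans (ler_wpM2l _ (od_coef_le g0 c0 _)))//.
  by rewrite divr_ge0 ?sqrtr_ge0// ltW.
rewrite sqrtr_sqr (gtr0_norm L0) /coef_bound le_eqVlt; apply/orP; left; apply/eqP.
have s0 : 0 < Num.sqrt (@gammaL R n) by rewrite sqrtr_gt0.
have -> : loglog n / log n = ((Num.sqrt (gammaL n) * log n)^-1) ^+ 2 :> R.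
  rewrite exprVn exprMn sqr_sqrtr ?(ltW g0)// /gammaL; field.
  by rewrite !gt_eqF.
rewrite sqrtr_sqr ger0_norm ?invr_ge0 ?mulr_ge0 ?(ltW s0) ?(ltW L0)//.
rewrite -[X in _ / (X * _)](sqr_sqrtr (ltW g0)).
move: s0 L0; move: (Num.sqrt (gammaL n)) (log n) => r l r0 l0'.
by field; rewrite !gt_eqF.
Qed.

Lemma coef_left_ge0 : \forall n \near \oo, forall a w,
  0 <= arm_left sigma k (coef sigma k n) a n w.
Proof.
apply: filterS (log_large R) => n [n0 L1 l1] a w.
have L0 : 0 < @log R n by exact: lt_le_trans L1.
have l0 : 0 < @loglog R n by exact: lt_le_trans l1.
have g0 : 0 < @gammaL R n by rewrite invr_gt0 mulr_gt0.
have c0 : 0 < @log R n ^+ 2 by rewrite exprn_gt0.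
by rewrite arm_leftE ?(ltW g0)// subr_ge0 od_var_le1.
Qed.

Definition few_pulls n : set T :=
  [set w | exists a, (pulls (k^~ w) a n)%:R < @log R n ^+ 2].

Lemma measurable_few_pulls n : measurable (few_pulls n).
Proof.
apply: measurable_exists => a.
have mN := measurable_count filtF k_predictable a n (fun t => t%:R : R).
have := mN measurableT _ (measurable_itv `]-oo, (@log R n ^+ 2)[).
by rewrite setTI set_itvE.
Qed.

Lemma cvg_few_pulls : fine (P (few_pulls n)) @[n --> \oo] --> (0 : R).
Proof.
apply: cvg_probability_eventually; first exact: measurable_few_pulls.
apply: filterS min_pulls_large => w; apply: filterS => n mn [a].
apply/negP; rewrite -leNgt (le_trans mn)// ler_nat.
exact: min_pulls_le.
Qed.

(** Off [few_pulls], [od_var_defect] bounds the variance left by gamma^2 / 4 plus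
    1 / (c gamma) = loglog n / log n, and both tend to 0. *)
Lemma cvg_coef_left (r : R) : 0 < r ->
  fine (P [set w | exists a, r < arm_left sigma k (coef sigma k n) a n w])
    @[n --> \oo] --> (0 : R).
Proof.
move=> r0; apply: cvgn_squeeze0 cvg_few_pulls.
have e1 : (gammaL n / 2) ^+ 2 @[n --> \oo] --> (0 : R).
  have h := cvgn_exp (m := 2) (cvgMr_tmp (b := 2^-1) (@cvg_gammaL R)).
  by rewrite mul0r expr0n in h; exact: h.
near=> n; rewrite fine_ge0//=.
have [n0 L1 l1] : [/\ (0 < n)%N, 1 <= @log R n & 1 <= @loglog R n].
  by near: n; exact: log_large.
have L0 : 0 < @log R n by exact: lt_le_trans L1.
have l0 : 0 < @loglog R n by exact: lt_le_trans l1.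
have g0 : 0 < @gammaL R n by rewrite invr_gt0 mulr_gt0.
have c0 : 0 < @log R n ^+ 2 by rewrite exprn_gt0.
have h1 : (@gammaL R n / 2) ^+ 2 <= r / 2.
  by near: n; apply: (cvgr_le _ e1); rewrite divr_gt0.
have h2 : @loglog R n / log n <= r / 2.
  by near: n; apply: (cvgr_le _ (@cvg_loglog_log R)); rewrite divr_gt0.
apply: fine_le_measure.
- apply: measurable_exists => a.
  have mV : measurable_fun [set: T] (arm_left sigma k (coef sigma k n) a n).
    apply: (mF_measurable filtF (i := n)).
    by apply: (mF_arm_left filtF) => // i; exact: (mF_coef filtF).
  have := mV measurableT _ (measurable_itv `]r, +oo[).
  by rewrite setTI set_itvE.
- exact: measurable_few_pulls.
- move=> w [a ra]; exists a; rewrite ltNge; apply/negP => cN.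
  move: ra; rewrite arm_leftE ?(ltW g0)// ltNge => /negP; apply.
  rewrite (le_trans (od_var_defect g0 c0 cN))//.
  have -> : (log n ^+ 2 * gammaL n)^-1 = loglog n / log n :> R.
    by rewrite /gammaL; field; rewrite !gt_eqF.
  lra.
Unshelve. all: by end_near. Qed.

(** The second moment is the mean of the conditional variance used; it gives the
    tightness needed to replace sigma by its estimate. *)
Lemma mean_arm_sum_sqr a : \forall n \near \oo,
  has_mean P (fun w => arm_sum eps k (coef sigma k n) a n w ^+ 2) /\
  mean P (fun w => arm_sum eps k (coef sigma k n) a n w ^+ 2) <= 1.
Proof.
near=> m.
have cb : forall i w, `|coef sigma k m i w| <= coef_bound m by near: m; exact: coef_small.
have l0 : forall a w, 0 <= arm_left sigma k (coef sigma k m) a m w.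
  by near: m; exact: coef_left_ge0.
have mc i : measurable_fun [set: g_sigma_algebraType (F i)]
     (coef sigma k m i.+1 : g_sigma_algebraType (F i) -> R) by exact: (mF_coef filtF).
have ma i : measurable_fun [set: g_sigma_algebraType (F i)]
     (arm_coef k (coef sigma k m) a i.+1 : g_sigma_algebraType (F i) -> R).
  exact: (mF_arm_coef filtF).
have ab i w : `|arm_coef k (coef sigma k m) a i w| <= coef_bound m.
  exact: arm_coef_bounded.
split; first exact: (has_mean_transform2 filtF eps_adapted eps_var ma ab).
have := mean_weighted_transform2 filtF eps_adapted eps_mean eps_var ma ab m
  (b := fun _ _ => 1) (B := 1).
have E f : mean P (fun w : T => 1 * f w) = mean P f.
  by congr mean; apply/funext => w; rewrite mul1r.
rewrite E => /(_ _ _ _) h; apply: (le_trans (h _ _ _)) => //.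
  by move=> i w; rewrite ler01 lexx.
under eq_bigr do rewrite E.
have s1 i : has_mean P (fun w => arm_coef k (coef sigma k m) a i.+1 w ^+ 2).
  apply: (@has_mean_bounded _ _ _ _ (coef_bound m ^+ 2)).
    by apply: measurable_funX; exact: (mF_measurable filtF (ma i)).
  by move=> w; rewrite normrX lerXn2r ?nnegrE// (le_trans _ (ab i.+1 w)).
rewrite -(@mean_sum _ _ _ _ _ _
  (fun (i : 'I_m) w => arm_coef k (coef sigma k m) a i.+1 w ^+ 2)) => [|i];
  last exact: s1.
rewrite -meanZ; last by apply: has_mean_sum => i; exact: s1.
rewrite -[leRHS](mean_cst P); apply: le_mean; last 1 first.
- by move=> w; have := l0 a w; rewrite /arm_left subr_ge0.
- by apply: has_meanZ; apply: has_mean_sum => i; exact: s1.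
- exact: has_mean_cst.
Unshelve. all: by end_near. Qed.

End od_limits.

(** * Studentization and bias *)

Section studentization.
Context {R : realType}.
Implicit Types sigma kappa v z : R.

(** Continuity of v |-> sigma / sqrt v at sigma^2, by
    |sigma - u| sigma <= |sigma - u| (sigma + u) = |sigma^2 - u^2| for
    u = sqrt v, and u >= sigma / 2. *)
Lemma sqrt_ratio_close sigma kappa : 0 < sigma -> 0 < kappa ->
  exists2 r : R, 0 < r & forall v, `|v - sigma ^+ 2| <= r ->
    0 < v /\ `|sigma / Num.sqrt v - 1| <= kappa.
Proof.
move=> s0 k0; have s2 : 0 < sigma ^+ 2 by rewrite exprn_gt0.
exists (Num.min (3 / 4 * sigma ^+ 2) (kappa * sigma ^+ 2 / 2)).
  by rewrite lt_min; apply/andP; split; [lra|rewrite divr_gt0// mulr_gt0].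
move=> v; rewrite le_min => /andP[h1 h2].
have v4 : (sigma / 2) ^+ 2 <= v.
  by move: h1; rewrite ler_distl => /andP[h _]; rewrite exprMn; lra.
have v0 : 0 < v by apply: lt_le_trans v4; rewrite exprn_gt0// divr_gt0.
split=> //; have u2 : v = Num.sqrt v ^+ 2 by rewrite sqr_sqrtr// ltW.
have su : sigma / 2 <= Num.sqrt v.
  by rewrite -[leLHS]ger0_norm ?divr_ge0 ?(ltW s0)// -sqrtr_sqr ler_wsqrtr.
have u0 : 0 < Num.sqrt v by rewrite sqrtr_gt0.
move: u2 su u0 h2; set u := Num.sqrt v => -> su u0 h2.
have -> : sigma / u - 1 = (sigma - u) / u by field; rewrite gt_eqF.
rewrite normrM normrV ?unitfE ?gt_eqF// (gtr0_norm u0) ler_pdivrMr//.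
have h3 : `|sigma - u| * sigma <= kappa * sigma ^+ 2 / 2.
  apply: le_trans h2; have -> : u ^+ 2 - sigma ^+ 2 = - ((sigma - u) * (sigma + u)) by ring.
  rewrite normrN normrM ler_wpM2l// ger0_norm ?addr_ge0 ?(ltW s0) ?(ltW u0)//.
  by rewrite lerDl ltW.
have h4 : `|sigma - u| <= kappa * (sigma / 2).
  rewrite -(ler_pM2r s0) (le_trans h3)// le_eqVlt; apply/orP; left; apply/eqP.
  by field.
by rewrite (le_trans h4)// ler_wpM2l// ltW.
Qed.

(** Here z = log n * loglog n = 1 / gamma: the normalization of the theorem
    times the inverse of sqrt gamma / sigma leaves a ratio close to 1. *)
Lemma powR_studentized sigma v z : 0 < v -> 0 < z ->
  (v * z) `^ (- 2^-1) * (sigma / Num.sqrt z^-1) = sigma / Num.sqrt v.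
Proof.
move=> v0 z0; rewrite powRN powR12_sqrt ?mulr_ge0 ?(ltW v0) ?(ltW z0)//.
rewrite sqrtrM ?(ltW v0)// sqrtrV ?(ltW z0)//.
have a0 : 0 < Num.sqrt v by rewrite sqrtr_gt0.
have b0 : 0 < Num.sqrt z by rewrite sqrtr_gt0.
by field; rewrite !gt_eqF.
Qed.

Lemma close_bound (rho x0 b m e : R) : 0 < m -> 0 < e ->
  `|rho - 1| <= Num.min 1 (e / (2 * m)) -> x0 ^+ 2 <= m ^+ 2 ->
  b ^+ 2 <= (e / 4) ^+ 2 -> `|rho * (x0 + b) - x0| <= e.
Proof.
move=> m0 e0; rewrite le_min => /andP[r1 r2] xm be.
have xm' : `|x0| <= m.
  by rewrite -(ger0_norm (ltW m0)) -[ `|m|]sqrtr_sqr -[ `|x0|]sqrtr_sqr ler_wsqrtr.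
have be' : `|b| <= e / 4.
  have e4 : 0 <= e / 4 by rewrite divr_ge0// ltW.
  by rewrite -(ger0_norm e4) -[leRHS]sqrtr_sqr -[leLHS]sqrtr_sqr ler_wsqrtr.
have -> : rho * (x0 + b) - x0 = (rho - 1) * x0 + (rho - 1) * b + b by ring.
have h1 : `|(rho - 1) * x0| <= e / 2.
  rewrite normrM (le_trans (ler_pM _ _ r2 xm'))//.
  by rewrite le_eqVlt; apply/orP; left; apply/eqP; field; rewrite gt_eqF.
have h2 : `|(rho - 1) * b| <= e / 4.
  by rewrite normrM (le_trans (ler_pM _ _ r1 be'))// mul1r.
rewrite (le_trans (ler_normD _ _))// (le_trans (lerD (ler_normD _ _) (lexx _)))//.
lra.
Qed.

Lemma share_sum (eta : R) : 0 < eta ->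
  (eta / 8 + eta / 8) + (eta / 2 + eta / 8) <= eta.
Proof. by move=> ?; lra. Qed.

End studentization.

Section od_close.
Context {disp : measure_display} {T : measurableType disp} {R : realType}.
Variables (P : probability T R) (F : nat -> set (set T)).
Hypothesis filtF : filtration F.
Variables (eps y : nat -> T -> R) (sigma : R).
Hypothesis eps_adapted : forall i, measurable_wrt (F i.+1) (eps i.+1).
Hypothesis eps_mean : forall i,
  is_cond_exp P (F i) (fun w => (eps i.+1 w)%:E) (cst 0%:E).
Hypothesis eps_var : forall i,
  is_cond_exp P (F i) (fun w => (eps i.+1 w ^+ 2)%:E) (cst (sigma ^+ 2)%:E).
Hypothesis sigma0 : 0 < sigma.
Variables (d : nat) (k : nat -> T -> 'I_d).
Hypothesis k_predictable : forall i a, F i [set w | k i.+1 w = a].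
Variable theta : 'cV[R]_d.
Hypothesis yE : forall i w, (0 < i)%N -> y i w = theta (k i w) 0 + eps i w.
Hypothesis min_pulls_large : {ae P, forall w, \forall n \near \oo,
  log n ^+ 2 <= (min_pulls (k^~ w) n)%:R :> R}.
Variable s2 : nat -> {RV P >-> R}.
Hypothesis s2_consistent : cvg_in_probability P s2 (sigma ^+ 2).

Definition od_error n w (a : 'I_d) : R := (sqrtmx (gram (k^~ w) n) *m
    (theta_OD (k^~ w) (y^~ w) (gammaL n) (GammaL (k^~ w) n) n - theta)) a 0.

Definition od_student n w (a : 'I_d) : R :=
  (s2 n w * log n * loglog n) `^ (- 2^-1) * od_error n w a.

Lemma od_student_measurable :
  \forall n \near \oo, forall a, measurable_fun [set: T] (fun w => od_student n w a).
Proof.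
apply: filterS (log_large R) => n [n0 L1 l1] a.
have L0 : 0 < @log R n by exact: lt_le_trans L1.
have l0 : 0 < @loglog R n by exact: lt_le_trans l1.
have g0 : 0 < @gammaL R n by rewrite invr_gt0 mulr_gt0.
apply: measurable_funM.
  apply: (measurableT_comp (measurable_powR _)).
  by apply: measurable_funM => //; apply: measurable_funM => //.
apply: (measurable_od_error filtF eps_adapted k_predictable yE a _ g0).
by rewrite gt_eqF.
Qed.

(** Dominates the square of the normalized bias of every arm, off [few_pulls]. *)
Definition bias_sq n w : R := \sum_(a < d)
  gammaL n / sigma ^+ 2 * (count_wt k a n w * noise eps k a n w ^+ 2).

(** With X0 the normalized martingale sum and b the normalized bias, the
    studentized error is rho (X0 + b), where rho = sigma / sigma_hat. *)
Lemma od_student_close n w (m e : R) : (0 < n)%N -> 1 <= @log R n -> 1 <= @loglog R n ->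
  0 < m -> 0 < e ->
  0 < s2 n w -> `|sigma / Num.sqrt (s2 n w) - 1| <= Num.min 1 (e / (2 * m)) ->
  ~ few_pulls (R := R) k n w ->
  \sum_a arm_sum eps k (coef sigma k n) a n w ^+ 2 <= m ^+ 2 ->
  bias_sq n w <= (e / 4) ^+ 2 ->
  forall a, `|od_student n w a - arm_sum eps k (coef sigma k n) a n w| <= e.
Proof.
move=> n0 L1 l1 m0 e0 v0 hr few X0m bm a.
have L0 : 0 < @log R n by exact: lt_le_trans L1.
have l0 : 0 < @loglog R n by exact: lt_le_trans l1.
have g0 : 0 < @gammaL R n by rewrite invr_gt0 mulr_gt0.
have c0 : 0 < @log R n ^+ 2 by rewrite exprn_gt0.
have logn0 : log n != 0 :> R by rewrite gt_eqF.
have cN b : log n ^+ 2 <= (pulls (k^~ w) b n)%:R :> R.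
  by rewrite leNgt; apply/negP => h; apply: few; exists b.
have N0 b : (0 < pulls (k^~ w) b n)%N.
  by rewrite -(ltr_nat R) (lt_le_trans c0).
have yEw i : (0 < i)%N -> y i w = theta (k i w) 0 + eps i w by exact: yE.
set X0 := arm_sum _ _ _ _ _ _.
pose beta : R := 1 - (\sum_(1 <= t < (pulls (k^~ w) a n).+1)
   od_coef (gammaL n) (log n ^+ 2) t) / Num.sqrt (pulls (k^~ w) a n)%:R.
have sN : 0 < Num.sqrt (pulls (k^~ w) a n)%:R :> R by rewrite sqrtr_gt0 ltr0n.
have sg : 0 < Num.sqrt (@gammaL R n) by rewrite sqrtr_gt0.
have beta1 : beta ^+ 2 <= 1.
  have h1 : 0 <= (\sum_(1 <= t < (pulls (k^~ w) a n).+1)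
     od_coef (gammaL n) (log n ^+ 2) t) / Num.sqrt (pulls (k^~ w) a n)%:R :> R.
    by rewrite divr_ge0 ?sqrtr_ge0// sumr_ge0// => t _; rewrite od_coef_ge0.
  have h2 : (\sum_(1 <= t < (pulls (k^~ w) a n).+1)
     od_coef (gammaL n) (log n ^+ 2) t) / Num.sqrt (pulls (k^~ w) a n)%:R <= 1 :> R.
    by rewrite ler_pdivrMr// mul1r sum_od_coef_le.
  by rewrite /beta exprn_ile1//; lra.
pose b : R := Num.sqrt (gammaL n) / sigma * (beta * (noise eps k a n w /
   Num.sqrt (pulls (k^~ w) a n)%:R)).
have EY : od_error n w a = sigma / Num.sqrt (gammaL n) * (X0 + b).
  rewrite /od_error (od_error_decomp logn0 g0 yEw N0 a) /X0 arm_sumE /b.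
  rewrite -/(noise eps k a n w) -/beta.
  set S := \sum_(_ <= _ < _) _; move: (noise _ _ _ _ _ / _) => z.
  by field; rewrite !gt_eqF.
rewrite /od_student EY mulrA.
have -> : s2 n w * log n * loglog n = s2 n w * (log n * loglog n) by rewrite mulrA.
rewrite powR_studentized ?mulr_gt0//.
apply: (close_bound m0 e0 hr).
  apply: le_trans X0m; rewrite (bigD1 a)//= lerDl sumr_ge0// => c _.
  exact: sqr_ge0.
apply: le_trans bm; rewrite /bias_sq (bigD1 a)//=.
rewrite -[leLHS]addr0 lerD//; last first.
  apply: sumr_ge0 => c _; rewrite mulr_ge0 ?divr_ge0 ?sqr_ge0 ?(ltW g0)//.
  by rewrite mulr_ge0 ?sqr_ge0// invr_ge0 le_max ler01 orbT.
have -> : count_wt k a n w = (Num.sqrt (pulls (k^~ w) a n)%:R ^+ 2)^-1 :> R.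
  by rewrite sqr_sqrtr// /count_wt max_l// ler1n.
have -> : gammaL n / sigma ^+ 2 * ((Num.sqrt (pulls (k^~ w) a n)%:R ^+ 2)^-1 *
    noise eps k a n w ^+ 2) = gammaL n / sigma ^+ 2 * (1 * (noise eps k a n w /
    Num.sqrt (pulls (k^~ w) a n)%:R) ^+ 2).
  by rewrite mul1r exprMn exprVn [X in _ * X]mulrC.
rewrite /b 2!exprMn sqr_sqrtr ?(ltW g0)// exprVn ler_wpM2l ?divr_ge0 ?sqr_ge0 ?(ltW g0)//.
by rewrite exprMn ler_wpM2r ?sqr_ge0.
Qed.

Lemma mean_bias_sq n : (0 < n)%N -> 0 < @gammaL R n ->
  has_mean P (bias_sq n) /\ mean P (bias_sq n) <= d%:R * (gammaL n * (1 + log n)).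
Proof.
move=> n0 g0.
have h a := mean_noise_sqr filtF eps_adapted eps_mean eps_var k_predictable a n0.
have s1 a : has_mean P (fun w =>
    gammaL n / sigma ^+ 2 * (count_wt k a n w * noise eps k a n w ^+ 2)).
  by apply: has_meanZ; exact: (h a).1.
split; first exact: has_mean_sum.
rewrite mean_sum// -[d in d%:R]card_ord -[leRHS]mulrC mulr_natr -sumr_const.
apply: ler_sum => a _; rewrite meanZ; last exact: (h a).1.
rewrite (le_trans (ler_wpM2l _ (h a).2)) ?divr_ge0 ?sqr_ge0 ?(ltW g0)//.
by rewrite mulrA divfK// gt_eqF// exprn_gt0.
Qed.

(** This is where gamma must be smaller than 1 / log n by a diverging factor. *)
Lemma cvg_gamma_log : (@gammaL R n) * (1 + log n) @[n --> \oo] --> (0 : R).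
Proof.
have h : 2 / @loglog R n @[n --> \oo] --> (0 : R).
  have h := cvgMl_tmp (a := 2) (cvgn_inv_pinfty (@cvg_loglog R)).
  by have {}h := h _; rewrite mulr0 in h; exact: h.
apply: cvgn_squeeze0 h; apply: filterS (log_large R) => n [n0 L1 l1].
have L0 : 0 < @log R n by exact: lt_le_trans L1.
have l0 : 0 < @loglog R n by exact: lt_le_trans l1.
have Ll : 0 < log n * @loglog R n by rewrite mulr_gt0.
apply/andP; split; first by rewrite mulr_ge0 ?invr_ge0 ?addr_ge0 ?(ltW Ll) ?(ltW L0).
rewrite /gammaL mulrC ler_pdivrMr//.
have -> : 2 / loglog n * (log n * loglog n) = 2 * log n :> R by field; rewrite gt_eqF.
lra.
Qed.

(** The difference exceeds e only if the variance estimate is off, some arm has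
    few pulls, some sum X0 is large, or some bias is large.  The last two events
    are controlled by Markov's inequality. *)
Lemma cvg_od_student (e : R) : 0 < e ->
  fine (P [set w | exists a, e < `|od_student n w a -
     arm_sum eps k (coef sigma k n) a n w|]) @[n --> \oo] --> (0 : R).
Proof.
move=> e0; apply/cvgrPdist_le => eta eta0.
(* The second moments of the d sums are at most 1, so their squares add up to
   more than m^2 with probability at most d / m^2 <= eta / 2. *)
pose m : R := Num.sqrt (2 * d%:R / eta) + 1.
have m0 : 0 < m by rewrite ltr_wpDl ?sqrtr_ge0.
have m2 : d%:R / m ^+ 2 <= eta / 2.
  have z0 : 0 <= 2 * d%:R / eta by rewrite divr_ge0 ?mulr_ge0// ltW.
  rewrite ler_pdivrMr ?exprn_gt0// -ler_pdivrMl ?divr_gt0//.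
  have -> : (eta / 2)^-1 * d%:R = Num.sqrt (2 * d%:R / eta) ^+ 2.
    by rewrite sqr_sqrtr//; field; rewrite gt_eqF.
  by rewrite lerXn2r ?nnegrE ?sqrtr_ge0 ?(ltW m0)// lerDl.
have kap0 : 0 < Num.min 1 (e / (2 * m)) by rewrite lt_min ltr01 divr_gt0// mulr_gt0.
have [r r0 hr] := sqrt_ratio_close sigma0 kap0.
have e8 : 0 < eta / 8 by rewrite divr_gt0.
have cons : fine (P [set w | r < `|s2 n w - sigma ^+ 2|]) @[n --> \oo] --> (0 : R).
  by apply: fine_cvg; exact: s2_consistent.
have bias0 : d%:R * (gammaL n * (1 + log n)) / (e / 4) ^+ 2 @[n --> \oo] --> (0 : R).
  have h := cvgMr_tmp (b := ((e / 4) ^+ 2)^-1) (cvgMl_tmp (a := d%:R) cvg_gamma_log).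
  by have {}h := h _; rewrite mulr0 mul0r in h; exact: h.
have Xsq : \forall n \near \oo, forall a : 'I_d,
    has_mean P (fun w => arm_sum eps k (coef sigma k n) a n w ^+ 2) /\
    mean P (fun w => arm_sum eps k (coef sigma k n) a n w ^+ 2) <= 1.
  apply: filter_forall => a.
  exact: (mean_arm_sum_sqr filtF eps_adapted eps_mean eps_var sigma0 k_predictable a).
near=> n.
have [n0 L1 l1] : [/\ (0 < n)%N, 1 <= @log R n & 1 <= @loglog R n].
  by near: n; exact: log_large.
have L0 : 0 < @log R n by exact: lt_le_trans L1.
have l0 : 0 < @loglog R n by exact: lt_le_trans l1.
have g0 : 0 < @gammaL R n by rewrite invr_gt0 mulr_gt0.
have Xn : forall a : 'I_d,
    has_mean P (fun w => arm_sum eps k (coef sigma k n) a n w ^+ 2) /\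
    mean P (fun w => arm_sum eps k (coef sigma k n) a n w ^+ 2) <= 1.
  by near: n.
have p1 : fine (P [set w | r < `|s2 n w - sigma ^+ 2|]) <= eta / 8.
  by near: n; apply: (cvgr_le _ cons).
have p2 : fine (P (few_pulls (R := R) k n)) <= eta / 8.
  near: n; apply: (cvgr_le _ (cvg_few_pulls filtF k_predictable min_pulls_large)) => //.
have p4' : d%:R * (gammaL n * (1 + log n)) / (e / 4) ^+ 2 <= eta / 8.
  by near: n; apply: (cvgr_le _ bias0).
have mX : forall a, measurable_fun [set: T] (fun w => od_student n w a).
  by near: n; exact: od_student_measurable.
have mX0 a : measurable_fun [set: T] (arm_sum eps k (coef sigma k n) a n).
  apply: (mF_measurable filtF (i := n)).
  by apply: (mF_arm_sum filtF) => // i; exact: (mF_coef filtF).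
pose B1 := [set w | r < `|s2 n w - sigma ^+ 2|].
pose f3 w := \sum_a arm_sum eps k (coef sigma k n) a n w ^+ 2.
pose B3 := [set w | m ^+ 2 < f3 w].
pose B4 := [set w | (e / 4) ^+ 2 < bias_sq n w].
have s3 : has_mean P f3 by apply: has_mean_sum => a; exact: (Xn a).1.
have [s4 h4] := mean_bias_sq n0 g0.
have mlt (f : T -> R) (z : R) : measurable_fun [set: T] f -> measurable [set w | z < f w].
  move=> mf; have := mf measurableT _ (measurable_itv `]z, +oo[).
  by rewrite setTI set_itvE.
have mB1 : measurable B1.
  by apply: mlt; apply: measurableT_comp => //; exact: measurable_funB.
have mB2 := measurable_few_pulls (R := R) filtF k_predictable n.
have mB3 : measurable B3 by apply: mlt; exact: has_mean_measurable s3.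
have mB4 : measurable B4 by apply: mlt; exact: has_mean_measurable s4.
have p3 : fine (P B3) <= eta / 2.
  apply: le_trans m2; apply: (@le_trans _ _ (mean P f3 / m ^+ 2)).
    apply: markov_mean => //; rewrite ?exprn_gt0//.
      by move=> w; apply: sumr_ge0 => a _; exact: sqr_ge0.
    by move=> w /ltW.
  rewrite ler_wpM2r ?invr_ge0 ?sqr_ge0// mean_sum; last by move=> a; exact: (Xn a).1.
  rewrite -[leRHS]mulr1 -[d in d%:R]card_ord mulr_natl -sumr_const.
  by apply: ler_sum => a _; exact: (Xn a).2.
have p4 : fine (P B4) <= eta / 8.
  apply: le_trans p4'; apply: (@le_trans _ _ (mean P (bias_sq n) / (e / 4) ^+ 2)).
    apply: markov_mean => //; rewrite ?exprn_gt0 ?divr_gt0//.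
      move=> w; apply: sumr_ge0 => a _; rewrite mulr_ge0 ?divr_ge0 ?sqr_ge0 ?(ltW g0)//.
      by rewrite mulr_ge0 ?sqr_ge0// invr_ge0 le_max ler01 orbT.
    by move=> w /ltW.
  by rewrite ler_wpM2r ?invr_ge0 ?sqr_ge0.
rewrite sub0r normrN ger0_norm ?fine_ge0//.
apply: (@le_trans _ _ (fine (P ((B1 `|` few_pulls (R := R) k n) `|` (B3 `|` B4))))).
  apply: fine_le_measure.
  - apply: measurable_exists => a; apply: mlt; apply: measurableT_comp => //.
    exact: measurable_funB.
  - by do 2! apply: measurableU => //; exact: measurableU.
  - move=> w [a]; apply: contraPP => /not_orP[/not_orP[nB1 nB2] /not_orP[nB3 nB4]].
    apply/negP; rewrite -leNgt.
    have [v0 hv] : 0 < s2 n w /\ `|sigma / Num.sqrt (s2 n w) - 1| <= Num.min 1 (e / (2 * m)).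
      by apply: hr; rewrite leNgt; apply/negP.
    apply: (od_student_close n0 L1 l1 m0 e0 v0 hv nB2).
      by rewrite leNgt; apply/negP.
    by rewrite leNgt; apply/negP.
have u1 := fine_measureU P mB1 mB2.
have u2 := fine_measureU P mB3 mB4.
have u3 := fine_measureU P (measurableU _ _ mB1 mB2) (measurableU _ _ mB3 mB4).
apply: (le_trans u3); apply: (le_trans (lerD u1 u2)).
apply: (@le_trans _ _ ((eta / 8 + eta / 8) + (eta / 2 + eta / 8))).
  by apply: lerD; apply: lerD.
exact: share_sum.
Unshelve. all: by end_near. Qed.

End od_close.

(** * Joint distribution functions *)

Lemma joint_cdf_std_normal (R : realType) d (t : 'cV[R]_d) :
  joint_cdf (std_normal d) (@std_normal_vec R d) t = \prod_a ncdf (t a 0).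
Proof.
rewrite /joint_cdf.
have -> : [set u : d.-tuple R | forall a, std_normal_vec u a 0 <= t a 0] =
    [set u | forall a, `]-oo, t a 0]%classic (tnth u a)].
  apply/seteqP; split=> u /= h a; have := h a; rewrite mxE in_itv//=.
have h := std_normal_box (B := fun a => `]-oo, t a 0]%classic) (fun a => measurable_itv _).
rewrite [X in fine X](_ : _ = (\prod_a ncdf (t a 0))%:E)//.
rewrite -prodEFin; apply: (etrans h); apply: eq_bigr => a _.
by rewrite ncdfE.
Qed.

Theorem corollary1 (R : realType) (disp : measure_display)
    (T : measurableType disp) (P : probability T R) (d : nat)
    (F : nat -> set (set T)) (k : nat -> T -> 'I_d) (eps y : nat -> T -> R)
    (theta : 'cV[R]_d) (sigma Delta : R) (C : nat -> T -> \bar R)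
    (sigma2_hat : nat -> {RV P >-> R}) :
  filtration F ->
  (forall i a, (1 <= i)%N -> F i.-1 [set w | k i w = a]) ->
  (forall i, (1 <= i)%N -> measurable_wrt (F i) (eps i)) ->
  (forall i w, (1 <= i)%N ->
    y i w = dotv (arm_vec (k^~ w) i) theta + eps i w) ->
  0 < sigma -> 0 < Delta ->
  (forall i, (1 <= i)%N ->
    is_cond_exp P (F i.-1) (fun w => (eps i w)%:E) (cst 0%:E)) ->
  (forall i, (1 <= i)%N ->
    is_cond_exp P (F i.-1) (fun w => (eps i w ^+ 2)%:E) (cst (sigma ^+ 2)%:E)) ->
  (forall i, (1 <= i)%N ->
    is_cond_exp P (F i.-1) (fun w => (`|eps i w| `^ (2 + Delta))%:E) (C i)) ->
  {ae P, forall w,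
    (ereal_sup [set C i w | i in [set i | (1 <= i)%N]] < +oo)%E} ->
  {ae P, forall w, \forall n \near \oo,
    log n ^+ 2 <= (min_pulls (k^~ w) n)%:R :> R} ->
  cvg_in_probability P sigma2_hat (sigma ^+ 2) ->
  cvg_in_distribution P (std_normal d)
    (fun n w => (sigma2_hat n w * log n * loglog n) `^ (- 2^-1) *:
       (sqrtmx (gram (k^~ w) n) *m
         (theta_OD (k^~ w) (y^~ w) (gammaL n) (GammaL (k^~ w) n) n - theta)))
    (@std_normal_vec R d).
Proof.
move=> filtF k_pred eps_ad y_def sigma0 Delta0 cmean cvar cmom mom_bd min_large s2c.
have k_pred' i a : F i [set w | k i.+1 w = a] by exact: (k_pred i.+1 a).
have eps_ad' i : measurable_wrt (F i.+1) (eps i.+1) by exact: eps_ad.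
have cmean' i : is_cond_exp P (F i) (fun w => (eps i.+1 w)%:E) (cst 0%:E).
  exact: (cmean i.+1).
have cvar' i : is_cond_exp P (F i) (fun w => (eps i.+1 w ^+ 2)%:E)
    (cst (sigma ^+ 2)%:E) by exact: (cvar i.+1).
have cmom' i : is_cond_exp P (F i)
    (fun w => (`|eps i.+1 w| `^ (2 + Delta))%:E) (C i.+1) by exact: (cmom i.+1).
have yE i w : (0 < i)%N -> y i w = theta (k i w) 0 + eps i w.
  by move=> i0; rewrite y_def// dotv_arm.
move=> t _; rewrite joint_cdf_std_normal.
pose Y n w a := arm_sum eps k (coef sigma k n) a n w.
have mc n i : measurable_fun [set: g_sigma_algebraType (F i)]
    (coef sigma k n i.+1 : g_sigma_algebraType (F i) -> R).
  exact: (mF_coef filtF).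
have clt (u : 'I_d -> R) :
    fine (P [set w | forall a, Y n w a <= u a]) @[n --> \oo] --> \prod_a ncdf (u a).
  exact: (arm_clt filtF eps_ad' cmean' cvar' sigma0 Delta0 cmom' mom_bd k_pred'
  mc (coef_small sigma0 k) (coef_left_ge0 sigma0 k) (cvg_coef_bound sigma)
  (cvg_coef_left filtF sigma0 k_pred' min_large)).
have mX := od_student_measurable filtF eps_ad' k_pred' yE sigma2_hat.
have mY : \forall n \near \oo, forall a, measurable_fun [set: T] (fun w => Y n w a).
  apply: nearW => n a; apply: (mF_measurable filtF (i := n)).
  by apply: (mF_arm_sum filtF) => // i; exact: mc.
have close := cvg_od_student filtF eps_ad' cmean' cvar' sigma0 k_pred' yE min_large s2c.
have h := box_slutsky (G := fun u : 'I_d -> R => \prod_a ncdf (u a))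
  (t := fun a => t a 0) mX mY close clt (cdf_prod_modulus (fun a => t a 0)).
rewrite (_ : (fun n => _) = fun n => fine (P [set w | forall a,
    od_student y k theta sigma2_hat n w a <= t a 0])); first exact: h.
apply/funext => n; congr (fine (P _)); apply/seteqP; split=> w /= hw a;
  by have := hw a; rewrite /od_student mxE.
Qed.
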